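(* Let $X$ be a topological space and let $f\colon\mathbb{T}^2\times X\to GL_n(\mathbb{C})$ be a continuous map such that for each $x\in X$, $f(x)=f(\cdot,\cdot,x)$ is a two-variable rational matrix function for which the quarter-plane Toeplitz operator $T^{0,\infty}_{f(x)}$ is Fredholm. Then for all $x\in X$ and $z,w\in\mathbb{T}$ the rational matrix functions $f(z,\cdot,x)$ and $f(\cdot,w,x)$ on $\mathbb{T}$ have trivial partial indices, and setting $$f^E(z,w,x)=\begin{cases}(f(z,\cdot,x))^e(w),&(z,w)\in\mathbb{T}\times\mathbb{D}^2,\\(f(\cdot,w,x))^e(z),&(z,w)\in\mathbb{D}^2\times\mathbb{T},\end{cases}$$ gives a well-defined continuous map $f^E\colon\tilde{\mathbb{S}}^3\times X\to GL_n(\mathbb{C})$, canonically associated with $f$ through matrix factorization, that extends $f$.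
   Context: $\mathbb{T}$ is the unit circle in $\mathbb{C}$, $\mathbb{D}^2$ the closed unit disk, $\tilde{\mathbb{S}}^3=\partial(\mathbb{D}^2\times\mathbb{D}^2)=(\mathbb{T}\times\mathbb{D}^2)\cup(\mathbb{D}^2\times\mathbb{T})\subset\mathbb{C}^2$ (topologically a 3-sphere). For a continuous $f\colon\mathbb{T}^2\to M_n(\mathbb{C})$, $T^{0,\infty}_f$ is the compression to $l^2(\mathbb{Z}_{\ge0}\times\mathbb{Z}_{\ge0};\mathbb{C}^n)$ of the operator on $l^2(\mathbb{Z}^2;\mathbb{C}^n)$ corresponding by Fourier transform to multiplication by $f$. A (two-variable) rational matrix function has entries that are rational functions with no poles on $\mathbb{T}$ (resp. $\mathbb{T}^2$). Let $D_+=\{|z|<1\}$, $D_-=\{|z|>1\}\cup\{\infty\}$. A nonsingular rational matrix function $h$ on $\mathbb{T}$ has a right factorization $h=h_-\Lambda h_+$, with $\Lambda(z)=\mathrm{diag}(z^{\kappa_1},\dots,z^{\kappa_n})$, integers $\kappa_1\ge\dots\ge\kappa_n$ (partial indices), and $h_\pm$ rational matrix functions having continuous nonsingular extensions $h_\pm^e$ to $\mathbb{T}\cup D_\pm$, analytic on $D_\pm$. Partial indices are trivial if all $\kappa_j=0$; then $h=h_-h_+$ is a canonical factorization and $h^e(z)=h_-^e(\bar z^{-1})h_+^e(z)$ for $z\in\mathbb{D}^2$ ($\bar0^{-1}=\infty$), which is independent of the choice of canonical factorization and restricts to $h$ on $\mathbb{T}$. *)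

(* Defs.v *)
From HB Require Import structures.
From mathcomp Require Import all_boot all_order all_algebra.
From mathcomp Require Import polyXY complex.
From mathcomp Require Import all_classical all_reals all_analysis.

Set Implicit Arguments.
Unset Strict Implicit.
Unset Printing Implicit Defensive.

Import Order.TTheory GRing.Theory Num.Theory.
Import numFieldNormedType.Exports.

Local Open Scope classical_set_scope.
Local Open Scope complex_scope.
Local Open Scope ring_scope.

(* R[i] with its usual norm topology, as a normed space over itself; since the
   scalars are R[i], derivable g z 1 then means complex differentiability. *)
HB.instance Definition _ (R : realType) := NormedModule.copy R[i] R[i]^o.

Section subsets.
Context {R : realType}.

Definition circle : set R[i] := [set z | `|z| = 1].
Definition closed_disk : set R[i] := [set z | `|z| <= 1].
Definition open_disk : set R[i] := [set z | `|z| < 1].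

(* The boundary of closed_disk `*` closed_disk. *)
Definition sphere3 : set (R[i] * R[i]) :=
  (circle `*` closed_disk) `|` (closed_disk `*` circle).

(* The Riemann sphere is the one-point compactification of R[i]; None is oo. *)
Definition closed_exterior : set (one_point_compactification R[i]) :=
  [set s | if s is Some z then 1 <= `|z| else True].

Definition sphere_inv (z : R[i]) : one_point_compactification R[i] :=
  if z == 0 then None else Some z^-1.

End subsets.

Section matrix_factorization.
Context {R : realType} {n : nat}.
Implicit Types h : R[i] -> 'M[R[i]]_n.

(* Functions on the circle and on the torus are encoded as total functions, of
   which only the values there matter. *)
Definition rational_mx h : Prop :=
  forall i j, exists p q : {poly R[i]}, forall z, circle z ->
    q.[z] != 0 /\ h z i j = p.[z] / q.[z].

Definition rational2_mx (f : R[i] -> R[i] -> 'M[R[i]]_n) : Prop :=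
  forall i j, exists p q : {poly {poly R[i]}}, forall z w,
    circle z -> circle w ->
    q.[z, w] != 0 /\ f z w i j = p.[z, w] / q.[z, w].

Definition plus_extension h (he : R[i] -> 'M[R[i]]_n) : Prop :=
  [/\ forall z, circle z -> he z = h z,
      {within closed_disk, continuous he},
      forall z, closed_disk z -> he z \in unitmx &
      forall z, open_disk z -> derivable he z 1].

(* Analyticity at oo is tested in the chart u |-> 1/u. *)
Definition minus_extension h
    (he : one_point_compactification R[i] -> 'M[R[i]]_n) : Prop :=
  [/\ forall z, circle z -> he (Some z) = h z,
      {within closed_exterior, continuous he},
      forall s, closed_exterior s -> he s \in unitmx,
      forall z : R[i], 1 < `|z| -> derivable (fun u : R[i] => he (Some u)) z 1 &
      derivable (fun u : R[i] => he (sphere_inv u)) 0 1].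

(* h = h_- Lambda h_+, together with the extensions of the factors h_- and h_+. *)
Definition right_factorization h (kappa : 'I_n -> int)
    (hm : R[i] -> 'M[R[i]]_n)
    (hme : one_point_compactification R[i] -> 'M[R[i]]_n)
    (hp hpe : R[i] -> 'M[R[i]]_n) : Prop :=
  [/\ rational_mx h /\ (forall z, circle z -> h z \in unitmx),
      forall i j : 'I_n, (i <= j)%N -> kappa j <= kappa i,
      rational_mx hm /\ minus_extension hm hme,
      rational_mx hp /\ plus_extension hp hpe &
      forall z, circle z ->
        h z = hm z *m diag_mx (\row_j z ^ kappa j) *m hp z].

Definition partial_indices h (kappa : 'I_n -> int) : Prop :=
  exists hm hme hp hpe, right_factorization h kappa hm hme hp hpe.

Definition trivial_partial_indices h : Prop :=
  (exists kappa, partial_indices h kappa) /\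
  forall kappa, partial_indices h kappa -> forall j, kappa j = 0.

(* A is the value h^e(z) = h_-^e(1 / conj z) h_+^e(z) computed from some
   canonical factorization h = h_- h_+. *)
Definition canonical_extension_value h (z : R[i]) (A : 'M[R[i]]_n) : Prop :=
  exists hm hme hp hpe,
    right_factorization h (fun=> 0) hm hme hp hpe /\
    A = hme (sphere_inv (conjc z)) *m hpe z.

End matrix_factorization.

Section square_summable.
Context {R : realType} {n : nat}.

Definition sqnorm (v : 'cV[R[i]]_n) : R :=
  \sum_(i < n) (complex.Re (v i 0) ^+ 2 + complex.Im (v i 0) ^+ 2).

Context {I : choiceType}.
Implicit Types (a b : I -> 'cV[R[i]]_n)
  (T : (I -> 'cV[R[i]]_n) -> (I -> 'cV[R[i]]_n)).

Definition l2_sqnorm a : \bar R := (\esum_(k in [set: I]) (sqnorm (a k))%:E)%E.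

Definition in_l2 a : Prop := (l2_sqnorm a < +oo)%E.

(* Operators on l^2 are encoded as total maps, of which only the values on l^2
   matter. *)
Definition bounded_operator T : Prop :=
  (forall (c : R[i]) a b, in_l2 a -> in_l2 b ->
     T (fun k => c *: a k + b k) = (fun k => c *: T a k + T b k)) /\
  exists C : R, forall a, in_l2 a -> (l2_sqnorm (T a) <= C%:E * l2_sqnorm a)%E.

Definition fredholm T : Prop :=
  [/\ bounded_operator T,
      exists m (u : 'I_m -> I -> 'cV[R[i]]_n), forall a,
        in_l2 a -> T a = (fun=> 0) ->
        exists c : 'I_m -> R[i], a = (fun k => \sum_(i < m) c i *: u i k) &
      exists m (u : 'I_m -> I -> 'cV[R[i]]_n),
        (forall i, in_l2 (u i)) /\
        forall b, in_l2 b -> exists a (c : 'I_m -> R[i]), in_l2 a /\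
          b = (fun k => T a k + \sum_(i < m) c i *: u i k)].

End square_summable.

Section quarter_plane_toeplitz.
Context {R : realType} {n : nat}.
Implicit Types (f : R[i] -> R[i] -> 'M[R[i]]_n) (g : R[i] -> R[i] -> 'cV[R[i]]_n).

Definition expi (t : R) : R[i] := cos t +i* sin t.

(* Integration over the torus, parametrized by pairs of angles. *)
Definition angles : set (R * R) :=
  `[0, 2 * pi]%classic `*` `[0, 2 * pi]%classic.

Definition angle_measure := (@lebesgue_measure R \x @lebesgue_measure R)%E.

Definition L2_torus g : Prop :=
  (forall i,
     measurable_fun angles (fun t => complex.Re (g (expi t.1) (expi t.2) i 0)) /\
     measurable_fun angles (fun t => complex.Im (g (expi t.1) (expi t.2) i 0))) /\
  (\int[angle_measure]_(t in angles) (sqnorm (g (expi t.1) (expi t.2)))%:E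
     < +oo)%E.

Definition cintegral (F : R * R -> R[i]) : R[i] :=
  Rintegral angle_measure angles (fun t => complex.Re (F t)) +i*
  Rintegral angle_measure angles (fun t => complex.Im (F t)).

Definition fourier g (k : int * int) : 'cV[R[i]]_n :=
  \col_i (((2 * pi) ^- 2)%:C * cintegral (fun t =>
    expi t.1 ^ (- k.1) * expi t.2 ^ (- k.2) * g (expi t.1) (expi t.2) i 0)).

(* M is the operator on l^2(Z^2; C^n) that corresponds to multiplication by f
   under the Fourier transform.  The latter maps L^2(T^2; C^n) onto
   l^2(Z^2; C^n), so that f determines M on l^2. *)
Definition fourier_multiplication f
    (M : (int * int -> 'cV[R[i]]_n) -> (int * int -> 'cV[R[i]]_n)) : Prop :=
  bounded_operator M /\
  forall g, L2_torus g -> M (fourier g) = fourier (fun z w => f z w *m g z w).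

Definition extend_by_zero (a : nat * nat -> 'cV[R[i]]_n) (k : int * int) :
    'cV[R[i]]_n :=
  if (0 <= k.1) && (0 <= k.2) then a (`|k.1|%N, `|k.2|%N) else 0.

Definition compression
    (M : (int * int -> 'cV[R[i]]_n) -> (int * int -> 'cV[R[i]]_n))
    (a : nat * nat -> 'cV[R[i]]_n) (k : nat * nat) : 'cV[R[i]]_n :=
  M (extend_by_zero a) (k.1%:Z, k.2%:Z).

(* T is the quarter-plane Toeplitz operator T_f^{0,oo}. *)
Definition is_quarter_plane_toeplitz f
    (T : (nat * nat -> 'cV[R[i]]_n) -> (nat * nat -> 'cV[R[i]]_n)) : Prop :=
  exists M, fourier_multiplication f M /\ T = compression M.

End quarter_plane_toeplitz.

(* Main.v *)
Require Import Defs.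
From HB Require Import structures.
From mathcomp Require Import all_boot all_order all_algebra.
From mathcomp Require Import fingroup perm polyXY complex.
From mathcomp Require Import all_classical all_reals all_analysis measurable_realfun.
From mathcomp Require Import ring lra zify.

Set Implicit Arguments.
Unset Strict Implicit.
Unset Printing Implicit Defensive.

Import Order.TTheory GRing.Theory Num.Theory.
Import numFieldNormedType.Exports.

Local Open Scope classical_set_scope.
Local Open Scope complex_scope.
Local Open Scope ring_scope.

(* Fix z0 on the circle.  Birkhoff's reduction writes f(z0, .) as h_- Lambda h_+
   with rational factors.  If the j-th partial index kappa is negative, then
   v = h_+^{-1} e_j satisfies f(z0, w) v(w) = w^kappa m(1/w) with m analytic, so
   that f maps z^(iN) D_N(z) v(w), where D_N is a normalized Dirichlet kernel
   with its peak at z0, approximately to functions without frequencies in the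
   quarter plane.  For i = 0, 1, 2, ... these are disjointly supported vectors
   which T_f almost annihilates; by the open mapping theorem this is impossible
   for a Fredholm operator.  A positive index is excluded in the same way through
   the transposed operator, and exchanging the variables treats f(., w0).

   For continuity, compare canonical factorizations of h and of a nearby h0.  Up
   to bounded invertible factors, h - h0 is the difference of an analytic and an
   anti-analytic matrix function on the circle; these are orthogonal in the mean
   apart from their constant terms, which bounds the difference of the inverses
   of h^e and h0^e at 0, and a Moebius transformation carries the bound to the
   other points of the disk.  The bound is uniform on the disk and depends only on
   the factors of h0, hence with the compactness of the circle it gives joint
   continuity.  By the reflection principle (an analytic and an anti-analytic
   function that agree on the circle agree on the disk), the indices and h^e do
   not depend on the factorization. *)

(** * Analytic functions on the disk *)

(** All analysis on the disk rests on one limit: the mean of an analytic function over the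
    [2 ^ N]-th roots of unity tends to its value at 0. Powers of two fit Goursat's bisection, which
    halves the number of steps. To stay on the disk, h_- is carried there by z -> 1/z, so that h(z)
    = M(conj z) P(z) on the circle, with M and P analytic and invertible on the closed disk.

    The obstacle to stability is that the factors of the nearby h admit no a priori bound. In the
    estimate for the inverses they occur only in one quantity, which is in turn bounded by the
    difference under study; closeness of h and h0 lets it be absorbed.

    The Toeplitz operator is explicit only on finitely supported sequences, so rational factors are
    replaced by polynomials and the singular vectors are trigonometric polynomials. Exactly disjoint
    supports make their squared norms additive, so that finitely many of them suffice and no weak
    limits occur. Estimates run in squared norms, where each triangle inequality costs a factor 2;
    most numerical constants arise in this way. *)

Section modulus.
Context {R : realType}.
Implicit Types z w : R[i].

(* The modulus as an element of R; normr takes its values in R[i]. *)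
Definition mo z : R := Normc.normc z.

Lemma normr_mo z : `|z| = (mo z)%:C.
Proof. by []. Qed.

Lemma mo_ge0 z : 0 <= mo z.
Proof. by rewrite -ler0c -normr_mo. Qed.

Lemma moM z w : mo (z * w) = mo z * mo w.
Proof. by apply: complexI; rewrite rmorphM -!normr_mo normrM. Qed.

Lemma moD z w : mo (z + w) <= mo z + mo w.
Proof. by rewrite -lecR rmorphD -!normr_mo ler_normD. Qed.

Lemma moN z : mo (- z) = mo z.
Proof. by apply: complexI; rewrite -!normr_mo normrN. Qed.

Lemma mo_distC z w : mo (z - w) = mo (w - z).
Proof. by rewrite -moN opprB. Qed.

Lemma moB z w : mo (z - w) <= mo z + mo w.
Proof. by rewrite -(moN w) moD. Qed.

Lemma mo0 : mo 0 = 0.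
Proof. by apply: complexI; rewrite -normr_mo normr0. Qed.

Lemma mo1 : mo 1 = 1.
Proof. by apply: complexI; rewrite -normr_mo normr1. Qed.

Lemma mo_eq0 z : (mo z == 0) = (z == 0).
Proof. by rewrite -(inj_eq (@complexI R)) -normr_mo normr_eq0. Qed.

Lemma mo_gt0 z : (0 < mo z) = (z != 0).
Proof. by rewrite lt_def mo_eq0 mo_ge0 andbT. Qed.

Lemma moV z : mo z^-1 = (mo z)^-1.
Proof. by apply: complexI; rewrite fmorphV -!normr_mo normfV. Qed.

Lemma moX z k : mo (z ^+ k) = mo z ^+ k.
Proof. by apply: complexI; rewrite rmorphXn -!normr_mo normrX. Qed.

Lemma mo_conj z : mo z^* = mo z.
Proof. by apply: complexI; rewrite -!normr_mo normcJ. Qed.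

Lemma mo_real (x : R) : mo x%:C = `|x|.
Proof. by rewrite /mo /= expr0n /= addr0 sqrtr_sqr. Qed.

Lemma mo_sqr z : mo z ^+ 2 = complex.Re z ^+ 2 + complex.Im z ^+ 2.
Proof.
by rewrite /mo; case: z => a b /=; rewrite sqr_sqrtr // addr_ge0 ?sqr_ge0.
Qed.

Lemma mo_Re z : `|complex.Re z| <= mo z.
Proof. by rewrite -lecR -normr_mo normc_ge_Re. Qed.

Lemma mo_Im z : `|complex.Im z| <= mo z.
Proof.
rewrite -(@ler_pXn2r _ 2) ?nnegrE ?mo_ge0 // mo_sqr real_normK ?num_real //.
by rewrite lerDr sqr_ge0.
Qed.

Lemma mulzJ z : z * z^* = (mo z ^+ 2)%:C.
Proof. by rewrite -sqr_normc normr_mo rmorphXn. Qed.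

Lemma mo_sum (I : Type) (r : seq I) (P : pred I) (F : I -> R[i]) :
  mo (\sum_(i <- r | P i) F i) <= \sum_(i <- r | P i) mo (F i).
Proof.
elim/big_rec2: _ => [|i y x _ h]; first by rewrite mo0.
by rewrite (le_trans (moD _ _)) // lerD2l.
Qed.

Lemma circleE z : circle z <-> mo z = 1.
Proof.
by rewrite /circle /= normr_mo; split=> [/complexI//|->].
Qed.

Lemma closed_diskE z : closed_disk z <-> mo z <= 1.
Proof. by rewrite /closed_disk /= normr_mo -(lecR _ 1). Qed.

Lemma open_diskE z : open_disk z <-> mo z < 1.
Proof. by rewrite /open_disk /= normr_mo -(ltcR _ 1). Qed.

End modulus.

(** * Trapezoid sums and Goursat's theorem *)

Section trapezoid.
Context {R : realType}.
Implicit Types (g : R[i] -> R[i]) (x : R -> R[i]).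

(* Twice the trapezoid rule for the integral of [g] along the curve [x], with
   the parameter running through [m] steps from [a] to [a + l]. *)
Definition trapezoid g x (a l : R) m : R[i] :=
  \sum_(0 <= k < m) (x (a + l * k.+1%:R / m%:R) - x (a + l * k%:R / m%:R)) *
    (g (x (a + l * k%:R / m%:R)) + g (x (a + l * k.+1%:R / m%:R))).

Lemma trapezoid_split g x a h m : (0 < m)%N ->
  trapezoid g x a (h + h) (m + m) =
  trapezoid g x a h m + trapezoid g x (a + h) h m.
Proof.
move=> m0; have m0' : m%:R != 0 :> R by rewrite pnatr_eq0 -lt0n.
have E1 k : a + (h + h) * k%:R / (m + m)%:R = a + h * k%:R / m%:R.
  by rewrite natrD; field; rewrite m0' -mulr2n -mulr_natl mulf_neq0 // pnatr_eq0.
have E2 k : a + (h + h) * (k + m)%:R / (m + m)%:R = a + h + h * k%:R / m%:R.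
  by rewrite !natrD; field; rewrite m0' -mulr2n -mulr_natl mulf_neq0 // pnatr_eq0.
rewrite /trapezoid (@big_cat_nat _ _ _ m) ?leq_addr //=; congr (_ + _).
  by apply: eq_bigr => k _; rewrite !E1.
rewrite -{1}[m]add0n big_addn addnK; apply: eq_bigr => k _.
by rewrite -addSn !E2.
Qed.

Lemma trapezoidD g1 g2 x a l m :
  trapezoid (fun z => g1 z + g2 z) x a l m =
  trapezoid g1 x a l m + trapezoid g2 x a l m.
Proof.
by rewrite /trapezoid -big_split /=; apply: eq_bigr => k _; ring.
Qed.

(** The sum telescopes, since (y - x)(2c + d(x + y)) is a difference of values of 2cz + dz^2.
    Exactness on affine functions along every curve is the reason for the trapezoid rule: in
    Goursat's argument the affine part then cancels without an error term. *)
Lemma trapezoid_affine (c d : R[i]) x a l m : (0 < m)%N ->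
  trapezoid (fun z => c + d * z) x a l m =
  (2%:R * c * x (a + l) + d * x (a + l) ^+ 2) -
  (2%:R * c * x a + d * x a ^+ 2).
Proof.
move=> m0; have m0' : m%:R != 0 :> R by rewrite pnatr_eq0 -lt0n.
rewrite /trapezoid.
pose G k := 2%:R * c * x (a + l * k%:R / m%:R) + d * x (a + l * k%:R / m%:R) ^+ 2.
rewrite (eq_bigr (fun k => G k.+1 - G k)); last first.
  by move=> k _; rewrite /G; ring.
by rewrite telescope_sumr // /G mulfK // mulr0 mul0r addr0.
Qed.

Lemma le_trapezoid g x a l m (D E : R) : (0 < m)%N -> 0 <= l -> 0 <= D ->
  (forall s s', a <= s <= a + l -> a <= s' <= a + l ->
     mo (x s - x s') <= D * `|s - s'|) ->
  (forall s, a <= s <= a + l -> mo (g (x s)) <= E) ->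
  mo (trapezoid g x a l m) <= 2 * D * E * l.
Proof.
move=> m0 l0 D0 hx hg; have m0' : m%:R != 0 :> R by rewrite pnatr_eq0 -lt0n.
have mp : 0 < m%:R :> R by rewrite ltr0n.
have inI k : (k <= m)%N -> a <= a + l * k%:R / m%:R <= a + l.
  move=> km; rewrite lerDl divr_ge0 ?mulr_ge0 //= lerD2l ler_pdivrMr //.
  by rewrite ler_wpM2l // ler_nat.
rewrite /trapezoid (le_trans (mo_sum _ _ _)) //.
have -> : 2 * D * E * l = \sum_(0 <= k < m) (D * (l / m%:R) * (E + E)).
  by rewrite sumr_const_nat subn0 -mulr_natl; field.
rewrite !big_nat ler_sum // => k /andP[_ km]; rewrite moM ler_pM ?mo_ge0 //.
  rewrite (le_trans (hx _ _ (inI _ km) (inI _ (ltnW km)))) //.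
  rewrite ler_wpM2l // -natr1 mulrDr mulr1 mulrDl.
  rewrite (_ : _ - _ = l / m%:R); last by ring.
  by rewrite ger0_norm // divr_ge0.
by rewrite (le_trans (moD _ _)) // lerD // hg // inI // ltnW.
Qed.

End trapezoid.

Section goursat.
Context {R : realType}.
Variables (Z : R -> R -> R[i]) (K : R) (g : R[i] -> R[i]).
Hypothesis K0 : 0 <= K.
Hypothesis Zlip : forall s s' t t',
  0 <= s <= 1 -> 0 <= s' <= 1 -> 0 <= t <= 1 -> 0 <= t' <= 1 ->
  mo (Z s t - Z s' t') <= K * (`|s - s'| + `|t - t'|).
Hypothesis gdiff : forall s t, 0 <= s <= 1 -> 0 <= t <= 1 ->
  exists d, forall e, 0 < e -> exists2 r, 0 < r & forall z,
    mo (z - Z s t) < r ->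
    mo (g z - g (Z s t) - d * (z - Z s t)) <= e * mo (z - Z s t).

(* Twice the trapezoid rule for the integral of [h] along the image under [Z] of
   the boundary of a square of the parameter domain. *)
Definition square_sum (h : R[i] -> R[i]) s t l m : R[i] :=
  trapezoid h (Z ^~ t) s l m + trapezoid h (Z (s + l)) t l m
  - trapezoid h (Z ^~ (t + l)) s l m - trapezoid h (Z s) t l m.

Lemma square_sum_split h s t l m : (0 < m)%N ->
  square_sum h s t (l + l) (m + m) =
  square_sum h s t l m + square_sum h (s + l) t l m +
  square_sum h s (t + l) l m + square_sum h (s + l) (t + l) l m.
Proof.
by move=> m0; rewrite /square_sum !trapezoid_split // !addrA; ring.
Qed.

Let inside (s t l : R) := [/\ 0 <= l, 0 <= s, 0 <= t, s + l <= 1 & t + l <= 1].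

(** The square sum of an affine function is 0, as its end point terms cancel around the boundary.
    What remains is the error of the affine approximation, at most [2 * K * E * l] on each of the
    four sides. *)
Lemma le_square_sum s t l m (d c : R[i]) (E : R) : inside s t l -> (0 < m)%N ->
  (forall s' t', s <= s' <= s + l -> t <= t' <= t + l ->
    mo (g (Z s' t') - (c + d * Z s' t')) <= E) ->
  mo (square_sum g s t l m) <= 8 * K * E * l.
Proof.
move=> [l0 s0 t0 sl tl] m0 hE.
pose h z := g z - (c + d * z).
have gE : g = (fun z => (c + d * z) + h z).
  by apply/funext => z; rewrite /h; ring.
have -> : square_sum g s t l m = square_sum h s t l m.
  have gE' x a l' : trapezoid g x a l' m =
      trapezoid (fun z => c + d * z) x a l' m + trapezoid h x a l' m.
    by rewrite -trapezoidD -gE.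
  by rewrite /square_sum !gE' !trapezoid_affine //; ring.
have b1 (t' : R) : t <= t' <= t + l ->
    mo (trapezoid h (Z ^~ t') s l m) <= 2 * K * E * l.
  move=> ht; apply: le_trapezoid => //; last by move=> s' hs; apply: hE.
  move=> u v hu hv; have := @Zlip u v t' t'; rewrite subrr normr0 addr0; apply; lra.
have b2 (s' : R) : s <= s' <= s + l ->
    mo (trapezoid h (Z s') t l m) <= 2 * K * E * l.
  move=> hs; apply: le_trapezoid => //; last by move=> t' ht; apply: hE.
  move=> u v hu hv; have := @Zlip s' s' u v; rewrite subrr normr0 add0r; apply; lra.
have := b1 t; have := b1 (t + l); have := b2 s; have := b2 (s + l).
rewrite !lexx !lerDl l0 => /(_ isT) h1 /(_ isT) h2 /(_ isT) h3 /(_ isT) h4.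
rewrite /square_sum.
apply: le_trans (moB _ _) _.
apply: le_trans (lerD (moB _ _) (lexx _)) _.
apply: le_trans (lerD (lerD (moD _ _) (lexx _)) (lexx _)) _.
lra.
Qed.

(** The bound is proportional to the area, so that the bounds for four quarters add up to the bound
    for the square. It is asked for all large exponents because bisection lowers [N] by one. *)
Let small (e s t l : R) := exists N0, forall N, (N0 <= N)%N ->
  mo (square_sum g s t l (2 ^ N)) <= e * l ^+ 2.

Lemma small_split e s t l : small e s t l -> small e (s + l) t l ->
  small e s (t + l) l -> small e (s + l) (t + l) l -> small e s t (l + l).
Proof.
move=> [N1 h1] [N2 h2] [N3 h3] [N4 h4].
exists (maxn (maxn N1 N2) (maxn N3 N4)).+1 => -[//|N].
rewrite ltnS !geq_max => /andP[/andP[k1 k2] /andP[k3 k4]].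
rewrite expnS mul2n -addnn square_sum_split ?expn_gt0 //.
have := h1 _ k1; have := h2 _ k2; have := h3 _ k3; have := h4 _ k4.
set A := square_sum _ _ _ _ _; set B := square_sum _ _ _ _ _.
set C := square_sum _ _ _ _ _; set D := square_sum _ _ _ _ _.
move=> {h1 h2 h3 h4} h1 h2 h3 h4.
apply: le_trans (moD _ _) _.
apply: le_trans (lerD (moD _ _) (lexx _)) _.
apply: le_trans (lerD (lerD (moD _ _) (lexx _)) (lexx _)) _.
nra.
Qed.

Let bisect e (q : R * R) (l : R) : R * R :=
  if ~~ `[< small e q.1 q.2 l >] then q else
  if ~~ `[< small e (q.1 + l) q.2 l >] then (q.1 + l, q.2) else
  if ~~ `[< small e q.1 (q.2 + l) l >] then (q.1, q.2 + l) else
  (q.1 + l, q.2 + l).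

Lemma bisectP e q l : 0 <= l -> ~ small e q.1 q.2 (l + l) ->
  let q' := bisect e q l in
  [/\ ~ small e q'.1 q'.2 l, q.1 <= q'.1 <= q.1 + l & q.2 <= q'.2 <= q.2 + l].
Proof.
move=> l0 hq; rewrite /bisect.
case: asboolP => h1 /=; last by rewrite !lexx !lerDl l0.
case: asboolP => h2 /=; last by rewrite !lexx !lerDl l0.
case: asboolP => h3 /=; last by rewrite !lexx !lerDl l0.
rewrite !lexx !lerDl l0; split=> // h4; apply: hq; exact: small_split.
Qed.

Lemma goursat (e : R) : 0 < e ->
  exists N0, forall N, (N0 <= N)%N -> mo (square_sum g 0 0 1 (2 ^ N)) <= e.
Proof.
move=> e0.
suff : small e 0 0 1 by move=> [N0 h]; exists N0 => N /h; rewrite expr1n mulr1.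
(* Otherwise bisection produces nested squares of side [L k], none of them small, which shrink to a
   point (s, t). Differentiability of [g] there contradicts this for a late square. *)
apply: contrapT => nsmall.
pose q := fix q k := if k is k'.+1 then bisect e (q k') (2^-1 ^+ k) else (0, 0).
pose L k : R := 2^-1 ^+ k.
have L0 k : 0 < L k by rewrite exprn_gt0.
have LS k : L k = L k.+1 + L k.+1 by rewrite /L exprS; field.
have step k : ~ small e (q k).1 (q k).2 (L k) /\
   [/\ (q k).1 <= (q k.+1).1, (q k).2 <= (q k.+1).2,
       (q k.+1).1 + L k.+1 <= (q k).1 + L k & (q k.+1).2 + L k.+1 <= (q k).2 + L k].
  suff h : ~ small e (q k).1 (q k).2 (L k).
    split=> //; move: h; rewrite LS => /bisectP /= -/(_ (ltW (L0 _))).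
    rewrite -/(L k.+1) => -[_ /andP[-> h1] /andP[-> h2]]; split=> //; lra.
  elim: k => [|k IH]; first by rewrite /L expr0.
  by move: IH; rewrite LS => /bisectP /= -/(_ (ltW (L0 _))) [].
have mono1 k j : (k <= j)%N -> (q k).1 <= (q j).1 /\ (q k).2 <= (q j).2 /\
    (q j).1 + L j <= (q k).1 + L k /\ (q j).2 + L j <= (q k).2 + L k.
  elim: j => [|j IH]; first by rewrite leqn0 => /eqP ->.
  rewrite leq_eqVlt => /orP[/eqP->//|]; rewrite ltnS => /IH [a [b [c d]]].
  by have [_ [a' b' c' d']] := step j; do !split; lra.
have bnd (F : nat -> R) : (forall k j, (k <= j)%N -> F k <= F j) ->
    (forall k j, (k <= j)%N -> F j + L j <= F k + L k) ->
    exists x, forall k, F k <= x <= F k + L k.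
  move=> m1 m2; exists (sup (range F)) => k.
  have ub : ubound (range F) (F k + L k).
    move=> _ [j _ <-]; have /orP[kj|jk] := leq_total k j.
      by have := m2 _ _ kj; have := L0 j; lra.
    by have := m1 _ _ jk; have := L0 k; lra.
  have hs : has_sup (range F) by split; [exists (F 0), 0 | exists (F k + L k)].
  apply/andP; split; first by apply: ub_le_sup; [exists (F k + L k) | exists k].
  by apply: ge_sup => //; case: hs.
have [s hs] : exists x, forall k, (q k).1 <= x <= (q k).1 + L k.
  by apply: (bnd (fun k => (q k).1)) => k j /mono1 [? [? []]].
have [t ht] : exists x, forall k, (q k).2 <= x <= (q k).2 + L k.
  by apply: (bnd (fun k => (q k).2)) => k j /mono1 [? [? []]].
have s01 : 0 <= s <= 1 by have := hs 0; rewrite /L expr0 /= add0r.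
have t01 : 0 <= t <= 1 by have := ht 0; rewrite /L expr0 /= add0r.
have [d hd] := gdiff s01 t01.
(* In a square of side l around (s, t) the points are within 2Kl of Z(s, t), so the affine error is
   at most 2 e1 K l and [le_square_sum] gives 16 e1 K^2 l^2. Taking [K + 1] covers K = 0. *)
pose e1 := e / (16 * (K + 1) ^+ 2).
have K1 : 0 < K + 1 by rewrite (le_lt_trans K0) // ltrDl.
have e10 : 0 < e1 by rewrite divr_gt0 // mulr_gt0 // exprn_gt0.
have [r r0 hr] := hd _ e10.
have [k hk] : exists k, (K + 1) * (2 * L k) < r.
  have : L @ \oo --> 0 by apply: cvg_expr; rewrite ger0_norm; lra.
  move=> /cvgrPdist_lt /(_ (r / (2 * (K + 1)))) [|k _ hk].
    by rewrite divr_gt0 // mulr_gt0.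
  exists k; have := hk k (leqnn k); rewrite /= sub0r normrN ger0_norm ?ltW //.
  by rewrite ltr_pdivlMr ?mulr_gt0 //; nra.
have [nk _] := step k; apply: nk.
have [a [b [c0 d0]]] := mono1 _ _ (leq0n k).
have Lk := L0 k; have hsk := hs k; have htk := ht k.
have L01 : L 0 = 1 by rewrite /L expr0.
rewrite L01 /= ?add0r in a b c0 d0.
exists 0%N => N _.
have hin : inside (q k).1 (q k).2 (L k) by split=> //; exact: ltW.
apply: le_trans (@le_square_sum _ _ _ _ d (g (Z s t) - d * Z s t)
  (e1 * (K * (2 * L k))) hin _ _) _; first by rewrite expn_gt0.
  move=> s' t' hs' ht'.
  have dd : mo (Z s' t' - Z s t) <= K * (2 * L k).
    rewrite (le_trans (Zlip _ _ _ _)) //; case: hin => *; try lra.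
    by rewrite ler_wpM2l // mulr2n mulrDl mul1r lerD // ler_norml; lra.
  rewrite (_ : _ - _ = g (Z s' t') - g (Z s t) - d * (Z s' t' - Z s t)); last by ring.
  apply: le_trans (hr _ _) _; last by rewrite ler_wpM2l // ltW.
  by apply: le_lt_trans dd _; apply: le_lt_trans hk; rewrite ler_wpM2r //; lra.
rewrite /e1 (_ : _ * L k = e * L k ^+ 2 * (K ^+ 2 / (K + 1) ^+ 2)); last first.
  by field; rewrite gt_eqF.
rewrite ler_piMr ?mulr_ge0 ?sqr_ge0 ?(ltW e0) ?(ltW Lk) //.
by rewrite ler_pdivrMr ?exprn_gt0 // mul1r ler_pXn2r ?nnegrE ?(ltW K1) // lerDl.
Qed.

End goursat.

(** * Limits, differentiability and compactness in the plane *)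

Section matrix_limits.
Context {K : numFieldType} {p q : nat}.

Lemma cvg_mxP (T : Type) (F : set_system T) (FF : Filter F)
    (f : T -> 'M[K]_(p, q)) (l : 'M[K]_(p, q)) :
  f x @[x --> F] --> l <-> forall i j, f x i j @[x --> F] --> l i j.
Proof.
split=> [fl i j|fl].
  apply: (@cvg_comp _ _ _ f (fun M : 'M[K]_(p, q) => M i j) _ _ _ fl).
  exact: coord_continuous.
move=> A [P /= hP PA]; apply: (@filterS _ F FF _ _ (fun x h => PA (f x) h)).
by apply: filter_forall => i; apply: filter_forall => j; exact: (fl i j).
Qed.

Lemma within_continuous_mxP (T : topologicalType) (A : set T)
    (f : T -> 'M[K]_(p, q)) :
  {within A, continuous f} <->
  forall i j, {within A, continuous (fun x => f x i j)}.
Proof.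
split=> [/subspace_continuousP h i j|h].
  by apply/subspace_continuousP => x Ax; move/cvg_mxP: (h x Ax); apply.
apply/subspace_continuousP => x Ax; apply/cvg_mxP => i j.
by have /subspace_continuousP := h i j; apply.
Qed.

Lemma derivable_mx_coordP (V : normedModType K) (f : V -> 'M[K]_(p, q)) x v :
  derivable f x v <-> forall i j, derivable (fun y => f y i j) x v.
Proof.
pose G (h : K) := h^-1 *: (f (h *: v + x) - f x).
have GE i j h : G h i j = h^-1 *: (f (h *: v + x) i j - f x i j).
  by rewrite /G !mxE.
split=> [/cvg_ex[/= l hl] i j|h].
  apply/cvg_ex; exists (l i j); move/cvg_mxP : hl => /(_ i j) /=.
  by under eq_fun do rewrite -/(G _) GE.
have /choice[L hL] : forall i, exists l : 'I_q -> K, forall j, G h i j @[h --> 0^'] --> l j.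
  move=> i; have : forall j, exists l : K, G h i j @[h --> 0^'] --> l.
    move=> j; have /cvg_ex[l hl] := h i j; exists l.
    by under eq_fun do rewrite GE.
  by move=> /choice[l hl]; exists l.
apply/cvg_ex; exists (\matrix_(i, j) L i j); apply/cvg_mxP => i j.
by rewrite mxE; exact: hL.
Qed.

End matrix_limits.

Section plane.
Context {R : realType}.
Implicit Types (e f : R[i] -> R[i]) (A : set R[i]).

Lemma complex_gt0P (r : R[i]) : 0 < r -> exists2 s : R, 0 < s & r = s%:C.
Proof.
case: r => a b; rewrite ltcE /= => /andP[/eqP -> a0]; by exists a.
Qed.

Lemma cvg_moP (T : Type) (F : set_system T) (FF : Filter F) (f : T -> R[i]) l :
  f x @[x --> F] --> l <->
  forall r : R, 0 < r -> \forall x \near F, mo (f x - l) < r.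
Proof.
split=> [/cvgrPdist_lt h r r0|h].
  have r0' : 0 < r%:C by rewrite (ltcR 0).
  by apply: filterS (h _ r0') => x; rewrite normr_mo ltcR mo_distC.
apply/cvgrPdist_lt => r /complex_gt0P[s s0 ->].
by apply: filterS (h _ s0) => x; rewrite normr_mo ltcR mo_distC.
Qed.

Lemma nbhs_moP (z : R[i]) (P : set R[i]) :
  nbhs z P <-> exists2 r : R, 0 < r & forall w, mo (w - z) < r -> P w.
Proof.
split=> [/nbhs_ballP[r /= /complex_gt0P[s s0 ->]] h|[r r0 h]].
  exists s => // w hw; apply: h; rewrite -ball_normE /= normr_mo ltcR.
  by rewrite mo_distC.
apply/nbhs_ballP; exists r%:C => /=; first by rewrite (ltcR 0).
by move=> w; rewrite -ball_normE /= normr_mo ltcR mo_distC => /h.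
Qed.

Lemma within_moP A e : {within A, continuous e} <->
  forall z, A z -> forall r : R, 0 < r -> exists2 s : R, 0 < s &
    forall w, A w -> mo (w - z) < s -> mo (e w - e z) < r.
Proof.
split=> [/subspace_continuousP h z Az r r0|h].
  have /cvg_moP /(_ r r0) := h z Az.
  rewrite near_withinE => /nbhs_moP[s s0 hs]; exists s => // w Aw /hs; exact.
apply/subspace_continuousP => z Az; apply/cvg_moP => r r0.
have [s s0 hs] := h z Az r r0.
by rewrite near_withinE; apply/nbhs_moP; exists s => // w hw Aw; exact: hs.
Qed.

Lemma derivable_moP e z : derivable e z 1 ->
  exists d, forall r : R, 0 < r -> exists2 s : R, 0 < s & forall w,
    mo (w - z) < s -> mo (e w - e z - d * (w - z)) <= r * mo (w - z).
Proof.
move=> /cvg_ex[/= d /cvg_moP hd]; exists d => r r0.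
have := hd r r0; rewrite near_withinE => /nbhs_moP[s s0 hs].
exists s => // w hw; have [->|wz] := eqVneq w z.
  by rewrite !subrr mulr0 subr0 mo0 mulr0.
have := hs (w - z); rewrite subr0 => /(_ hw); rewrite subr_eq0 => /(_ wz).
rewrite scaler1 subrK => /ltW; rewrite -(ler_pM2r (_ : 0 < mo (w - z))) ?mo_gt0 ?subr_eq0 //.
rewrite -moM mulrBl [_ *: _]/(_ * _) mulrAC mulVf ?mul1r // subr_eq0 //.
Qed.

Lemma continuous_conjc : continuous (@conjc R : R[i] -> R[i]).
Proof.
move=> z; apply/(@cvg_moP _ (nbhs z)) => r r0; apply/nbhs_moP; exists r => // w.
by rewrite -(mo_conj (w - z)) rmorphB.
Qed.

Lemma continuous_real_complex : continuous (fun x : R => x%:C : R[i]).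
Proof.
move=> x; apply/cvg_moP => r r0.
have : (fun y : R => y) y @[y --> x] --> x by exact: cvg_id.
move=> /cvgrPdist_lt /(_ r r0); apply: filterS => y.
by rewrite -rmorphB mo_real distrC.
Qed.

Lemma continuous_complex : continuous (fun q : R * R => q.1 +i* q.2 : R[i]).
Proof.
move=> q; rewrite /continuous_at.
have E (s : R * R) : s.1 +i* s.2 = s.1%:C + 'i%C * s.2%:C :> R[i].
  by case: s => a b; rewrite {1}(complexE (a +i* b)).
under eq_fun do rewrite E.
rewrite E; apply: cvgD.
  by apply: cvg_comp; [exact: cvg_fst | exact: continuous_real_complex].
apply: cvgM; first exact: cvg_cst.
by apply: cvg_comp; [exact: cvg_snd | exact: continuous_real_complex].
Qed.

Lemma continuous_mo : continuous (@mo R : R[i] -> R).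
Proof.
move=> z; apply/(@cvgrPdist_lt _ _ _ (nbhs z)) => r r0; apply/nbhs_moP; exists r => // w hw.
rewrite ltr_norml; have := moB w (w - z); have := moD z (w - z).
rewrite subrKC subKr => h1 h2; lra.
Qed.

Lemma closed_mo_le (r : R) : closed [set z : R[i] | mo z <= r].
Proof.
rewrite (_ : [set z | _] = (@mo R : R[i] -> R) @^-1` [set x | x <= r]) //.
by apply: closed_comp => [z _|]; [exact: continuous_mo | exact: closed_le].
Qed.

Lemma compact_mo_le (r : R) : compact [set z : R[i] | mo z <= r].
Proof.
apply: (@subclosed_compact _ _ ((fun q : R * R => q.1 +i* q.2 : R[i]) @`
  (`[- r, r] `*` `[- r, r]))); first exact: closed_mo_le.
  apply: continuous_compact; last by apply: compact_setX; exact: segment_compact.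
  by apply: continuous_subspaceT; exact: continuous_complex.
move=> -[a b] /= h; exists (a, b) => //=; rewrite !in_itv /= -!ler_norml.
by split; apply: le_trans h; [exact: (mo_Re (a +i* b)) | exact: (mo_Im (a +i* b))].
Qed.

Lemma closed_diskS : @closed_disk R = [set z | mo z <= 1].
Proof. by apply/seteqP; split=> z /closed_diskE. Qed.

Lemma circleS : @circle R = [set z | mo z = 1].
Proof. by apply/seteqP; split=> z /circleE. Qed.

Lemma circle_closed_disk : @circle R `<=` closed_disk.
Proof. by move=> z /circleE z1; apply/closed_diskE; rewrite z1. Qed.

Lemma compact_closed_disk : compact (@closed_disk R).
Proof. by rewrite closed_diskS; exact: compact_mo_le. Qed.

Lemma closed_circle : closed (@circle R).
Proof.
rewrite circleS (_ : [set z | _] = (@mo R : R[i] -> R) @^-1` [set 1]) //.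
by apply: closed_comp => [z _|]; [exact: continuous_mo | exact: closed_eq].
Qed.

Lemma compact_circle : compact (@circle R).
Proof.
apply: subclosed_compact circle_closed_disk; first exact: closed_circle.
exact: compact_closed_disk.
Qed.

Lemma compact_uniform_mo A e : compact A -> {within A, continuous e} ->
  forall r : R, 0 < r -> exists2 s : R, 0 < s &
    forall z w, A z -> A w -> mo (w - z) < s -> mo (e w - e z) < r.
Proof.
move=> /compact_near_coveringP cA /within_moP he r r0.
have r2 : 0 < r / 2 by rewrite divr_gt0.
have := cA R (0^'+) (fun s z => forall w, A z -> A w -> mo (w - z) < s ->
  mo (e w - e z) < r) _.
have h : forall z, A z -> \forall z' \near z & s \near 0^'+,
    forall w, A z' -> A w -> mo (w - z') < s -> mo (e w - e z') < r.
  move=> z Az; have [s s0 hs] := he z Az _ r2.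
  exists ([set z' | mo (z' - z) < s / 2], [set t | t < s / 2]) => /=.
    split; last by apply: nbhs_right_lt; rewrite divr_gt0.
    by apply/nbhs_moP; exists (s / 2) => //; rewrite divr_gt0.
  move=> [z' t] /= [hz' ht] w Az' Aw hw.
  have h1 := hs z' Az' (lt_trans hz' _); have h2 : mo (w - z) < s.
    rewrite (_ : w - z = (w - z') + (z' - z)); last by ring.
    by apply: le_lt_trans (moD _ _) _; lra.
  have {}h1 : mo (e z' - e z) < r / 2 by apply: h1; lra.
  have {}h2 := hs w Aw h2.
  rewrite (_ : e w - e z' = (e w - e z) - (e z' - e z)); last by ring.
  by apply: le_lt_trans (moB _ _) _; lra.
move=> /(_ _ h) hh.
have [s [/= s0 hs]] : exists s : R, 0 < s /\ A `<=` (fun z => forall w, A z -> A w ->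
    mo (w - z) < s -> mo (e w - e z) < r).
  near (0 : R)^'+ => s; exists s; split; first by near: s; exact: nbhs_right_gt.
  by near: s.
by exists s => // z w Az; exact: hs.
Unshelve. all: by end_near. Qed.

Lemma compact_mo_bounded (T : topologicalType) (A : set T) (e : T -> R[i]) :
  compact A -> {within A, continuous e} ->
  exists2 M : R, 0 < M & forall z, A z -> mo (e z) <= M.
Proof.
move=> cA he; have : compact (e @` A) by exact: continuous_compact.
move=> /compact_near_coveringP /(_ R (pinfty_nbhs R) (fun M z => mo z <= M) _).
have h : forall z, (e @` A) z -> \forall z' \near z & M \near pinfty_nbhs R, mo z' <= M.
  move=> z _; exists ([set z' | mo (z' - z) < 1], [set M | mo z + 1 < M]) => /=.
    split; first by apply/nbhs_moP; exists 1.
    by apply: nbhs_pinfty_gt; rewrite num_real.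
  move=> [z' M] /= [h1 h2]; have := moD z (z' - z); rewrite subrKC; lra.
move=> /(_ h) hh; near (pinfty_nbhs R) => M.
exists M; first by near: M; exact: nbhs_pinfty_gt.
move=> z Az; suff : (e @` A) `<=` (fun z => mo z <= M) by apply; exists z.
by near: M.
Unshelve. all: by end_near. Qed.

End plane.

(** * The unit circle and the mean value property *)

Section unit_circle.
Context {R : realType}.

Lemma expi0 : expi 0 = 1 :> R[i].
Proof. by rewrite /expi cos0 sin0. Qed.

Lemma expiD (s t : R) : expi (s + t) = expi s * expi t.
Proof. by apply/eqP; rewrite /expi eq_complex /= cosD sinD [cos s * sin t + _]addrC !eqxx. Qed.

Lemma mo_expi (t : R) : mo (expi t) = 1.
Proof.
apply/eqP; rewrite -(@pexpr_eq1 _ _ 2) ?mo_ge0 // mo_sqr /=.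
by rewrite cos2Dsin2.
Qed.

Lemma circle_expi (t : R) : circle (expi t).
Proof. by apply/circleE; rewrite mo_expi. Qed.

Lemma expi_neq0 (t : R) : expi t != 0.
Proof. by rewrite -mo_gt0 mo_expi. Qed.

Lemma expiN (t : R) : expi (- t) = (expi t)^-1.
Proof.
by apply: (mulfI (expi_neq0 t)); rewrite mulfV ?expi_neq0 // -expiD subrr expi0.
Qed.

Lemma conj_circle (z : R[i]) : mo z = 1 -> z^* = z^-1.
Proof.
move=> z1; have z0 : z != 0 by rewrite -mo_gt0 z1.
by apply: (mulfI z0); rewrite mulzJ z1 expr1n mulfV.
Qed.

Lemma expi_conj (t : R) : (expi t)^* = expi (- t).
Proof. by rewrite conj_circle ?mo_expi // expiN. Qed.

Lemma expi2pi : expi (2 * pi) = 1 :> R[i].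
Proof. by rewrite /expi mulr_natl cos2pi sin2pi. Qed.

Lemma lipschitz_derive1 (f f' : R -> R) (M : R) :
  (forall x, is_derive x (1 : R) f (f' x)) -> (forall x, `|f' x| <= M) ->
  forall s t, `|f s - f t| <= M * `|s - t|.
Proof.
move=> df bf; suff h s t : s <= t -> `|f t - f s| <= M * `|t - s|.
  by move=> s t; have [/h|/ltW/h//] := leP s t; rewrite distrC (distrC s).
move=> st; have [] := @MVT_segment R f f' s t st.
- apply: continuous_subspaceT => x; apply: differentiable_continuous.
  by apply/derivable1_diffP; have [] := df x.
by move=> c _ ->; rewrite normrM ler_wpM2r.
Qed.

Lemma mo_i : mo ('i%C : R[i]) = 1.
Proof. by rewrite /mo /= expr0n /= add0r expr1n sqrtr1. Qed.

Lemma expi_lipschitz (s t : R) : mo (expi s - expi t) <= 2 * `|s - t|.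
Proof.
have h1 : `|cos s - cos t| <= 1 * `|s - t|.
  apply: (@lipschitz_derive1 _ (fun x => - sin x)) => x.
  by rewrite normrN ler_norml sin_geN1 sin_le1.
have h2 : `|sin s - sin t| <= 1 * `|s - t|.
  apply: (@lipschitz_derive1 _ cos) => x.
  by rewrite ler_norml cos_geN1 cos_le1.
rewrite (complexE (_ - _)) (le_trans (moD _ _)) // moM !mo_real mo_i /=.
by rewrite mul1r mulrDl lerD.
Qed.

(** Doubling m increases m sin(2 pi / m), because sin 2x = 2 sin x cos x <= 2 sin x, and the
    sequence starts from 4 sin(pi / 2). This keeps the factor in [trapezoid_circle] away from 0. *)
Lemma sin_pow2_ge (N : nat) :
  4 <= (2 ^ N.+2)%:R * sin (2 * pi / (2 ^ N.+2)%:R) :> R.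
Proof.
have E k : 2 * pi / (2 ^ k.+2)%:R = pi / (2 ^ k.+1)%:R :> R.
  by rewrite (expnS _ k.+1) natrM; field; rewrite pnatr_eq0 -lt0n expn_gt0.
rewrite E; elim: N => [|N IH].
  rewrite (_ : (2 ^ 1)%:R = 2) // sin_pihalf mulr1.
  by rewrite ler_nat.
apply: le_trans IH _; set x := pi / (2 ^ N.+2)%:R.
have -> : pi / (2 ^ N.+1)%:R = x *+ 2 :> R.
  by rewrite /x (expnS 2 N.+1) natrM; field; rewrite pnatr_eq0 -lt0n expn_gt0.
rewrite sin_mulr2n (expnS 2 N.+2) natrM.
have sx : 0 <= sin x.
  apply: sin_ge0_pi; rewrite divr_ge0 ?pi_ge0 //= ler_pdivrMr ?ltr0n ?expn_gt0 //.
  by rewrite ler_peMr ?pi_ge0 // ler1n expn_gt0.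
rewrite -mulrnAr mulrA [2 * _]mulrC -!mulrA; apply: ler_wpM2l => //.
by rewrite -mulr_natl; have := cos_le1 x; nra.
Qed.

End unit_circle.

(* Means over the [m]-th roots of unity replace integrals over the circle. *)
Definition circle_avg {R : realType} (e : R[i] -> R[i]) m : R[i] :=
  m%:R^-1 * \sum_(0 <= k < m) e (expi (2 * pi * k%:R / m%:R)).

Definition holomorphic {R : realType} (e : R[i] -> R[i]) : Prop :=
  {within closed_disk, continuous e} /\ forall z, open_disk z -> derivable e z 1.

Section mean_value.
Context {R : realType}.
Variable e : R[i] -> R[i].
Hypothesis hol : holomorphic e.

Let polar (r1 r2 s t : R) : R[i] := (r1 + (r2 - r1) * s)%:C * expi (2 * pi * t).

Lemma polar_lipschitz (r1 r2 s s' t t' : R) : 0 < r1 -> r1 <= r2 -> r2 <= 1 ->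
  0 <= s <= 1 -> 0 <= s' <= 1 ->
  mo (polar r1 r2 s t - polar r1 r2 s' t') <=
  (1 + 4 * pi) * (`|s - s'| + `|t - t'|).
Proof.
move=> r10 r12 r21 hs hs'; have pi0 := pi_ge0 R.
rewrite /polar; set a := r1 + _; set b := r1 + _.
rewrite (_ : _ - _ = (a - b)%:C * expi (2 * pi * t) +
  b%:C * (expi (2 * pi * t) - expi (2 * pi * t'))); last by rewrite rmorphB /=; ring.
rewrite (le_trans (moD _ _)) // !moM !mo_real mo_expi mulr1.
have h1 : `|a - b| <= `|s - s'|.
  rewrite (_ : a - b = (r2 - r1) * (s - s')); last by rewrite /a /b; ring.
  by rewrite normrM ler_piMl // ger0_norm; lra.
have h2 : `|b| * mo (expi (2 * pi * t) - expi (2 * pi * t')) <= 4 * pi * `|t - t'|.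
  rewrite -[leRHS]mul1r ler_pM ?mo_ge0 //.
    have : 0 <= b by rewrite /b; nra.
    by move=> b0; rewrite ger0_norm // /b; nra.
  apply: le_trans (expi_lipschitz _ _) _.
  rewrite -mulrBr normrM (ger0_norm (_ : 0 <= 2 * pi)) ?mulr_ge0 //.
  by rewrite !mulrA -natrM.
apply: le_trans (lerD h1 h2) _.
have u0 := normr_ge0 (s - s'); have v0 := normr_ge0 (t - t'); nra.
Qed.

(** With b = exp(2 pi i / m) and E_k the value of [e] at the k-th point, the k-th term is (b - 1)
    E_k + (1 - 1/b) E_{k+1}; a cyclic shift of the index does not change the sum of the E_k. *)
Lemma trapezoid_circle (r : R) m : 0 < r -> (0 < m)%N ->
  trapezoid (fun z => e z / z) (fun t => r%:C * expi (2 * pi * t)) 0 1 m =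
  (expi (2 * pi / m%:R) - (expi (2 * pi / m%:R))^-1) *
  (m%:R * circle_avg (fun z => e (r%:C * z)) m).
Proof.
move=> r0 m0; set b := expi _.
have b0 : b != 0 by exact: expi_neq0.
have m0' : m%:R != 0 :> R[i] by rewrite pnatr_eq0 -lt0n.
have m0R : m%:R != 0 :> R by rewrite pnatr_eq0 -lt0n.
rewrite /circle_avg [m%:R * _]mulrA mulfV // mul1r.
pose w k := expi (2 * pi * k%:R / m%:R : R).
have wS k : w k.+1 = b * w k.
  by rewrite /w /b -expiD; congr expi; rewrite -natr1; field.
have w0 k : w k != 0 by exact: expi_neq0.
have r0' : r%:C != 0 :> R[i] by rewrite -mo_gt0 mo_real gtr0_norm.
pose E k := e (r%:C * w k).
rewrite /trapezoid (eq_bigr (fun k => (b - 1) * E k + (1 - b^-1) * E k.+1)); last first.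
  move=> k _; rewrite !add0r !mul1r !mulrA -/(w k) -/(w k.+1) /E wS.
  by field; rewrite b0 w0 r0'.
rewrite big_split /= -!mulr_sumr.
have -> : \sum_(0 <= k < m) E k.+1 = \sum_(0 <= k < m) E k.
  case: m m0 m0' m0R @b b0 @w wS w0 @E => // m _ _ m0R b _ w _ _ E.
  rewrite big_nat_recr //= [RHS]big_nat_recl // addrC; congr (_ + _).
  rewrite /E /w mulfK // expi2pi mulr0 mul0r expi0 //.
by rewrite /E /w; ring.
Qed.

(** Goursat's theorem for e(z) / z on the annulus between the two radii, in polar coordinates: the
    two radial sides are the same curve and cancel, and the circles give multiples of the
    averages. *)
Lemma avg_radius (r1 r2 eps : R) : 0 < r1 -> r1 <= r2 -> r2 < 1 -> 0 < eps ->
  exists N0, forall N, (N0 <= N)%N ->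
  mo (circle_avg (fun z => e (r2%:C * z)) (2 ^ N) -
      circle_avg (fun z => e (r1%:C * z)) (2 ^ N)) <= eps.
Proof.
move=> r10 r12 r21 eps0; have pi0 := pi_ge0 R.
have K0 : 0 <= 1 + 4 * pi :> R by rewrite addr_ge0 // mulr_ge0.
have gd s t : 0 <= s <= 1 -> 0 <= t <= 1 ->
  exists d, forall e', 0 < e' -> exists2 r, 0 < r & forall z,
    mo (z - polar r1 r2 s t) < r ->
    mo (e z / z - e (polar r1 r2 s t) / polar r1 r2 s t - d * (z - polar r1 r2 s t))
      <= e' * mo (z - polar r1 r2 s t).
  move=> hs ht; set p := polar _ _ _ _.
  have rs : r1 <= r1 + (r2 - r1) * s <= r2 by nra.
  have mp : mo p = r1 + (r2 - r1) * s.
    by rewrite moM mo_expi mulr1 mo_real ger0_norm //; lra.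
  have p0 : p != 0 by rewrite -mo_gt0 mp; lra.
  have : derivable (e * (fun z => z^-1)) p 1.
    apply: derivableM; first by apply: hol.2; apply/open_diskE; rewrite mp; lra.
    by apply: derivableV => //; exact: derivable_id.
  by move=> /derivable_moP.
have [N0 hN0] := goursat K0 (fun s s' t t' hs hs' _ _ =>
  @polar_lipschitz r1 r2 s s' t t' r10 r12 (ltW r21) hs hs') gd eps0.
(* Two more doublings ensure at least 4 points, as [sin_pow2_ge] requires. *)
exists (N0 + 2)%N => N hN; have := hN0 N (leq_trans (leq_addr _ _) hN).
have [M NE] : exists M, N = M.+2.
  by exists (N - 2)%N; rewrite -addn2 subnK // (leq_trans _ hN) // leq_addl.
set m := (2 ^ N)%N; have m0 : (0 < m)%N by rewrite expn_gt0.
have r20 : 0 < r2 by lra.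
have -> : square_sum (polar r1 r2) (fun z => e z / z) 0 0 1 m =
   trapezoid (fun z => e z / z) (fun t => r2%:C * expi (2 * pi * t)) 0 1 m -
   trapezoid (fun z => e z / z) (fun t => r1%:C * expi (2 * pi * t)) 0 1 m.
  rewrite /square_sum.
  have -> : polar r1 r2 ^~ 0 = polar r1 r2 ^~ (0 + 1).
    by apply/funext => s; rewrite /polar add0r !mulr1 mulr0 expi0 expi2pi.
  have -> : polar r1 r2 0 = fun t => r1%:C * expi (2 * pi * t).
    by apply/funext => t; rewrite /polar mulr0 addr0.
  have -> : polar r1 r2 (0 + 1) = fun t => r2%:C * expi (2 * pi * t).
    by apply/funext => t; rewrite /polar add0r mulr1 subrKC.
  ring.
rewrite !trapezoid_circle // -mulrBr -mulrBr; set A := circle_avg _ _ - _.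
(* The common factor has modulus 2 m sin(2 pi / m) >= 8, so dropping it only helps. *)
rewrite mulrA moM; apply: le_trans.
rewrite ler_peMl ?mo_ge0 //.
set b := expi _.
have -> : b - b^-1 = (2 * sin (2 * pi / m%:R))%:C * 'i%C.
  rewrite -expiN -expi_conj subcJ rmorphM /= rmorph_nat //.
rewrite !moM mo_real mo_i.
have -> : mo (m%:R : R[i]) = m%:R.
  by rewrite -(rmorph_nat (real_complex R)) mo_real ger0_norm.
have := @sin_pow2_ge R M; rewrite -NE -/m => h.
have h' : (2 * sin (2 * pi / m%:R : R)) <= `|2 * sin (2 * pi / m%:R : R)|.
  exact: ler_norm.
have mp : 0 <= m%:R :> R by [].
by rewrite mulr1; nra.
Qed.

Lemma le_avg (f : R[i] -> R[i]) m (M : R) : (0 < m)%N ->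
  (forall t, mo (f (expi t)) <= M) -> mo (circle_avg f m) <= M.
Proof.
move=> m0 hM; rewrite /circle_avg moM moV.
have -> : mo (m%:R : R[i]) = m%:R.
  by rewrite -(rmorph_nat (real_complex R)) mo_real ger0_norm.
rewrite mulrC ler_pdivrMr ?ltr0n // (le_trans (mo_sum _ _ _)) //.
rewrite -[m in leRHS]subn0 mulr_natr -sumr_const_nat.
by apply: ler_sum => k _; exact: hM.
Qed.

Lemma avgB (f g : R[i] -> R[i]) m :
  circle_avg (fun z => f z - g z) m = circle_avg f m - circle_avg g m.
Proof. by rewrite /circle_avg sumrB mulrBr. Qed.

Lemma avg_cst (c : R[i]) m : (0 < m)%N -> circle_avg (fun=> c) m = c.
Proof.
move=> m0; rewrite /circle_avg sumr_const_nat subn0 -[c *+ m]mulr_natl mulrA mulVf ?mul1r //.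
by rewrite pnatr_eq0 -lt0n.
Qed.

(** Differentiability holds only in the interior, hence the detour through the radii r1 and 1 - r1.
    Uniform continuity compares the unit circle with the outer of these circles, and the inner one
    with the center. *)
Lemma mean_value : circle_avg e (2 ^ N) @[N --> \oo] --> e 0.
Proof.
apply/cvg_moP => eps eps0.
have eps4 : 0 < eps / 4 by rewrite divr_gt0.
have [d d0 hd] := compact_uniform_mo (@compact_closed_disk R) hol.1 eps4.
pose r1 := Num.min d 1 / 2; pose r2 := 1 - r1.
have md0 : 0 < Num.min d 1 by rewrite lt_min d0 ltr01.
have md1 : Num.min d 1 <= 1 by rewrite ge_min lexx orbT.
have mdd : Num.min d 1 <= d by rewrite ge_min lexx.
have r10 : 0 < r1 by rewrite /r1; lra.
have r12 : r1 <= r2 by rewrite /r2 /r1; lra.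
have r21 : r2 < 1 by rewrite /r2; lra.
have r1d : r1 < d by rewrite /r1; lra.
have [N0 hN0] := avg_radius r10 r12 r21 eps4.
exists N0 => // N /= hN; have := hN0 N hN => {hN0}.
have m0 : (0 < 2 ^ N)%N by rewrite expn_gt0.
have h2 : mo (circle_avg e (2 ^ N) - circle_avg (fun z => e (r2%:C * z)) (2 ^ N)) <= eps / 4.
  rewrite -avgB; apply: le_avg => // t; apply/ltW/hd.
  - by apply/closed_diskE; rewrite moM mo_expi mo_real mulr1 ger0_norm; lra.
  - by apply: circle_closed_disk; exact: circle_expi.
  rewrite (_ : _ - _ = r1%:C * expi t); last by rewrite /r2 rmorphB rmorph1; ring.
  by rewrite moM mo_expi mulr1 mo_real gtr0_norm.
have h1 : mo (circle_avg (fun z => e (r1%:C * z)) (2 ^ N) - e 0) <= eps / 4.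
  rewrite -{1}(@avg_cst (e 0) (2 ^ N)) // -avgB; apply: le_avg => // t; apply/ltW/hd.
  - by apply/closed_diskE; rewrite mo0.
  - by apply/closed_diskE; rewrite moM mo_expi mo_real mulr1 ger0_norm; lra.
  by rewrite subr0 moM mo_expi mulr1 mo_real gtr0_norm.
move: h1 h2; set a := circle_avg e _; set b := circle_avg _ _; set c := circle_avg _ _.
move=> h1 h2 h3.
rewrite (_ : a - e 0 = (a - c) + ((c - b) + (b - e 0))); last by ring.
apply: le_lt_trans (moD _ _) _.
apply: le_lt_trans (lerD (lexx _) (moD _ _)) _; lra.
Qed.

End mean_value.

(** * Operations on analytic functions, Moebius maps and reflection *)

Section holomorphic_closure.
Context {R : realType}.
Implicit Types (e g : R[i] -> R[i]) (a z : R[i]).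

Lemma conjK z : (z^*)^* = z.
Proof. exact: conjCK. Qed.

Lemma conjcE z : conjc z = z^*.
Proof. by []. Qed.

Lemma conjM z w : (z * w)^* = z^* * w^*. Proof. exact: rmorphM. Qed.

Lemma conjD z w : (z + w)^* = z^* + w^*. Proof. exact: rmorphD. Qed.

Lemma conjB z w : (z - w)^* = z^* - w^*. Proof. exact: rmorphB. Qed.

Lemma conjV z : (z^-1)^* = (z^*)^-1. Proof. exact: fmorphV. Qed.

Lemma conj1 : (1 : R[i])^* = 1. Proof. exact: rmorph1. Qed.

Lemma open_closed_disk z : open_disk z -> closed_disk z.
Proof. by move=> /open_diskE/ltW h; apply/closed_diskE. Qed.

Lemma near_open_disk z : open_disk z -> \forall w \near z, closed_disk w.
Proof.
move=> /open_diskE z1; apply/nbhs_moP; exists (1 - mo z); first by rewrite subr_gt0.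
move=> w hw; apply/closed_diskE; have := moD z (w - z); rewrite subrKC; lra.
Qed.

Lemma holomorphic_eq e g : (forall z, closed_disk z -> e z = g z) ->
  holomorphic e -> holomorphic g.
Proof.
move=> eg [ec ed]; split.
  apply/within_moP => z Dz r r0; have /within_moP/(_ z Dz r r0) [s s0 hs] := ec.
  by exists s => // w Dw /hs; rewrite !eg //; apply.
move=> z Dz; have := ed z Dz; apply: near_eq_derivable => //.
by apply: filterS (near_open_disk Dz) => w /eg ->.
Qed.

Lemma holomorphic_cst (c : R[i]) : holomorphic (fun=> c).
Proof.
split; first by apply: continuous_subspaceT; exact: cst_continuous.
by move=> z _; exact: derivable_cst.
Qed.

Lemma holomorphic_id : holomorphic (fun z : R[i] => z).
Proof.
split; first by apply: continuous_subspaceT => z; exact: cvg_id.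
by move=> z _; exact: derivable_id.
Qed.

Lemma holomorphicD e g : holomorphic e -> holomorphic g ->
  holomorphic (fun z => e z + g z).
Proof.
move=> [/subspace_continuousP ec ed] [/subspace_continuousP gc gd]; split.
  by apply/subspace_continuousP => z Dz; apply: cvgD; [exact: ec | exact: gc].
by move=> z Dz; apply: derivableD; [exact: ed | exact: gd].
Qed.

Lemma holomorphicM e g : holomorphic e -> holomorphic g ->
  holomorphic (fun z => e z * g z).
Proof.
move=> [/subspace_continuousP ec ed] [/subspace_continuousP gc gd]; split.
  by apply/subspace_continuousP => z Dz; apply: cvgM; [exact: ec | exact: gc].
by move=> z Dz; apply: derivableM; [exact: ed | exact: gd].
Qed.

Lemma holomorphicB e g : holomorphic e -> holomorphic g ->
  holomorphic (fun z => e z - g z).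
Proof.
move=> he hg; apply: (@holomorphic_eq (fun z => e z + (-1) * g z)).
  by move=> z _; rewrite mulN1r.
exact: (holomorphicD he (holomorphicM (holomorphic_cst (-1)) hg)).
Qed.

Lemma holomorphicV e : (forall z, closed_disk z -> e z != 0) ->
  holomorphic e -> holomorphic (fun z => (e z)^-1).
Proof.
move=> e0 [/subspace_continuousP ec ed]; split.
  apply/subspace_continuousP => z Dz; apply: cvgV; first exact: e0.
  exact: ec.
move=> z Dz; apply: derivableV; first exact/e0/open_closed_disk.
exact: ed.
Qed.

Lemma holomorphic_sum (I : Type) (r : seq I) (P : pred I) (e : I -> R[i] -> R[i]) :
  (forall i, P i -> holomorphic (e i)) ->
  holomorphic (fun z => \sum_(i <- r | P i) e i z).
Proof.
move=> he; elim: r => [|i r IH].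
  by under eq_fun do rewrite big_nil; exact: holomorphic_cst.
under eq_fun do rewrite big_cons.
by case Pi: (P i); [exact: (holomorphicD (he _ Pi) IH) | exact: IH].
Qed.

Lemma holomorphic_prod (I : Type) (r : seq I) (P : pred I) (e : I -> R[i] -> R[i]) :
  (forall i, P i -> holomorphic (e i)) ->
  holomorphic (fun z => \prod_(i <- r | P i) e i z).
Proof.
move=> he; elim: r => [|i r IH].
  by under eq_fun do rewrite big_nil; exact: holomorphic_cst.
under eq_fun do rewrite big_cons.
by case Pi: (P i); [exact: (holomorphicM (he _ Pi) IH) | exact: IH].
Qed.

Lemma holomorphic_conj e : holomorphic e -> holomorphic (fun z => (e z^*)^*).
Proof.
have cD z : closed_disk z -> closed_disk z^*.
  by move=> /closed_diskE h; apply/closed_diskE; rewrite mo_conj.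
move=> [/within_moP ec ed]; split.
  apply/within_moP => z Dz r r0; have [s s0 hs] := ec _ (cD _ Dz) r r0.
  exists s => // w Dw hw; rewrite -rmorphB mo_conj; apply: hs; first exact: cD.
  by rewrite -rmorphB mo_conj.
move=> z Dz.
have Dz' : open_disk z^* by apply/open_diskE; rewrite mo_conj; apply/open_diskE.
have /cvg_ex[/= d hd] := ed _ Dz'.
apply/cvg_ex; exists d^*.
pose G (h : R[i]) := h^-1 *: (e (h *: 1 + z^*) - e z^*).
have GE (h : R[i]) : h^-1 *: ((e (h *: 1 + z)^*)^* - (e z^*)^*) = (G h^*)^*.
  have -> : G h^* = (h^*)^-1 * (e (h^* + z^*) - e z^*).
    by rewrite /G [_ *: 1]mulr1.
  by rewrite conjM conjB conjV conjK [_ *: 1]mulr1 conjD.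
under eq_fun do rewrite /= GE.
apply: (@cvg_comp _ _ _ (fun h : R[i] => G h^*) (@conjc R) _ (nbhs d)); last first.
  exact: continuous_conjc.
apply: (@cvg_comp _ _ _ (@conjc R) G _ (0^')) hd.
move=> A; rewrite /= !nbhs_simpl /= => /nbhs_moP[r r0 hr].
apply/nbhs_moP; exists r => // w hw w0 /=.
by apply: hr; rewrite ?conjc_eq0 // subr0 mo_conj -(subr0 w).
Qed.

Definition moebius a z := (z + a) / (1 + a^* * z).

Lemma moebius_den a z : mo a < 1 -> mo z <= 1 -> 1 + a^* * z != 0.
Proof.
move=> a1 z1; rewrite -mo_gt0.
have := moB (1 + a^* * z) (a^* * z); rewrite addrK mo1 moM mo_conj.
by have := mo_ge0 z; have := mo_ge0 a; nra.
Qed.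

Lemma moebius_identity a z :
  mo (1 + a^* * z) ^+ 2 - mo (z + a) ^+ 2 = (1 - mo z ^+ 2) * (1 - mo a ^+ 2).
Proof.
apply: complexI; rewrite rmorphM !rmorphB /= -!mulzJ rmorph1 !conjD conjM conjK conj1.
by ring.
Qed.

Lemma mo_moebius a z : mo a < 1 ->
  [/\ mo z < 1 -> mo (moebius a z) < 1, mo z <= 1 -> mo (moebius a z) <= 1 &
      mo z = 1 -> mo (moebius a z) = 1].
Proof.
move=> a1; have hid := moebius_identity a z.
have aa : 0 < 1 - mo a ^+ 2 by have := mo_ge0 a; nra.
have u0 := mo_ge0 (z + a); have z0 := mo_ge0 z.
have den : mo z <= 1 -> 0 < mo (1 + a^* * z).
  by move=> z1; rewrite mo_gt0 moebius_den.
split=> z1; rewrite /moebius moM moV.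
- rewrite ltr_pdivrMr ?mul1r; last by apply: den; exact: ltW.
  have := den (ltW z1); have : 0 < (1 - mo z ^+ 2) * (1 - mo a ^+ 2).
    by rewrite mulr_gt0 //; nra.
  by nra.
- rewrite ler_pdivrMr ?mul1r; last exact: den.
  have := den z1; have : 0 <= (1 - mo z ^+ 2) * (1 - mo a ^+ 2).
    by rewrite mulr_ge0 ?(ltW aa) //; nra.
  by nra.
- have h : mo (1 + a^* * z) ^+ 2 = mo (z + a) ^+ 2.
    by apply/eqP; rewrite -subr_eq0 hid z1 expr1n subrr mul0r.
  have : mo (z + a) == mo (1 + a^* * z).
    by rewrite -(@eqrXn2 _ 2) ?mo_ge0 // h.
  by move=> /eqP ->; rewrite divff // gt_eqF // den // z1.
Qed.

Lemma moebius0 a : moebius a 0 = a.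
Proof. by rewrite /moebius add0r mulr0 addr0 divr1. Qed.

Lemma conj_moebius a z : (moebius a z)^* = moebius a^* z^*.
Proof. by rewrite /moebius rmorphM /= fmorphV !rmorphD rmorph1 rmorphM. Qed.

Lemma holomorphic_moebius a : mo a < 1 -> holomorphic (moebius a).
Proof.
move=> a1; rewrite /moebius; apply: holomorphicM.
  by apply: holomorphicD; [exact: holomorphic_id | exact: holomorphic_cst].
apply: holomorphicV; first by move=> z /closed_diskE; exact: moebius_den.
apply: holomorphicD; first exact: holomorphic_cst.
by apply: holomorphicM; [exact: holomorphic_cst | exact: holomorphic_id].
Qed.

Lemma holomorphic_comp_moebius a e : mo a < 1 -> holomorphic e ->
  holomorphic (fun z => e (moebius a z)).
Proof.
move=> a1 [/within_moP ec ed]; have [/within_moP mc md] := holomorphic_moebius a1.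
split.
  apply/within_moP => z Dz r r0.
  have Dz' w : closed_disk w -> closed_disk (moebius a w).
    move=> /closed_diskE w1; apply/closed_diskE.
    by have [_ h _] := mo_moebius w a1; exact: h.
  have [s s0 hs] := ec _ (Dz' _ Dz) r r0; have [t t0 ht] := mc _ Dz s s0.
  by exists t => // w Dw /(ht _ Dw) /(hs _ (Dz' _ Dw)).
move=> z Dz; apply/derivable1_diffP; apply: differentiable_comp.
  exact/derivable1_diffP/md.
apply/derivable1_diffP/ed; apply/open_diskE; have [h _ _] := mo_moebius z a1.
by apply: h; apply/open_diskE.
Qed.

Lemma mean_value_conj g : holomorphic g ->
  circle_avg (fun z => g z^*) (2 ^ N) @[N --> \oo] --> g 0.
Proof.
move=> hg; have := mean_value (holomorphic_conj hg).
rewrite rmorph0 => h.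
have -> : (fun N => circle_avg (fun z => g z^*) (2 ^ N)) =
    (fun N => (circle_avg (fun z => (g z^*)^*) (2 ^ N))^*).
  apply/funext => N; rewrite /circle_avg conjM conjV rmorph_nat rmorph_sum.
  by congr (_ * _); apply: eq_bigr => k _; exact/esym/conjK.
rewrite -[g 0]conjK; apply: cvg_comp h _; exact: continuous_conjc.
Qed.

Lemma eq_circle_avg e g m : (forall z, circle z -> e z = g z) ->
  circle_avg e m = circle_avg g m.
Proof.
move=> eg; congr (_ * _); apply: eq_bigr => k _; apply: eg.
exact: circle_expi.
Qed.

(** Both values are limits of the same sequence of means: once Moebius maps have moved [a] and its
    conjugate to 0, the mean value property computes e(a) and g(conj a) from equal values on the
    circle. *)
Lemma reflection e g : holomorphic e -> holomorphic g ->
  (forall z, circle z -> g z^* = e z) ->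
  forall a, closed_disk a -> g a^* = e a.
Proof.
move=> he hg eg a /closed_diskE; rewrite le_eqVlt => /orP[/eqP/circleE/eg//|a1].
have a1' : mo a^* < 1 by rewrite mo_conj.
have := mean_value (holomorphic_comp_moebius a1 he); rewrite moebius0 => h1.
have := mean_value_conj (holomorphic_comp_moebius a1' hg); rewrite moebius0 => h2.
apply: (norm_cvg_unique h2); move: h1.
suff -> : (fun N => circle_avg (fun z => g (moebius a^* z^*)) (2 ^ N)) =
  (fun N => circle_avg (fun z => e (moebius a z)) (2 ^ N)) by apply.
apply/funext => N; apply: eq_circle_avg => z /circleE z1.
rewrite -conj_moebius; apply: eg; apply/circleE.
by have [_ _ ->] := mo_moebius z a1.
Qed.

End holomorphic_closure.

Section holomorphic_matrix.
Context {R : realType}.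

Definition holomorphic_mx {p q} (H : R[i] -> 'M[R[i]]_(p, q)) : Prop :=
  forall i j, holomorphic (fun z => H z i j).

Lemma holomorphic_mx_cst p q (A : 'M[R[i]]_(p, q)) : holomorphic_mx (fun=> A).
Proof. by move=> i j; exact: holomorphic_cst. Qed.

Lemma holomorphic_mx_eq p q (H K : R[i] -> 'M[R[i]]_(p, q)) :
  (forall z, closed_disk z -> H z = K z) -> holomorphic_mx H -> holomorphic_mx K.
Proof.
by move=> HK h i j; apply: holomorphic_eq (h i j) => z Dz; rewrite HK.
Qed.

Lemma holomorphic_mulmx p q r (H : R[i] -> 'M[R[i]]_(p, q))
    (K : R[i] -> 'M[R[i]]_(q, r)) :
  holomorphic_mx H -> holomorphic_mx K -> holomorphic_mx (fun z => H z *m K z).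
Proof.
move=> hH hK i j; under eq_fun do rewrite mxE.
by apply: holomorphic_sum => k _; exact: holomorphicM.
Qed.

Lemma holomorphic_det n (H : R[i] -> 'M[R[i]]_n) :
  holomorphic_mx H -> holomorphic (fun z => \det (H z)).
Proof.
move=> hH; apply: holomorphic_sum => s _; apply: holomorphicM.
  exact: holomorphic_cst.
by apply: holomorphic_prod => i _; exact: hH.
Qed.

Lemma holomorphic_invmx n (H : R[i] -> 'M[R[i]]_n) :
  (forall z, closed_disk z -> H z \in unitmx) ->
  holomorphic_mx H -> holomorphic_mx (fun z => invmx (H z)).
Proof.
move=> uH hH; apply: (@holomorphic_mx_eq _ _ (fun z => (\det (H z))^-1 *: \adj (H z))).
  by move=> z Dz; rewrite /invmx uH.
move=> i j; under eq_fun do rewrite !mxE.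
apply: holomorphicM.
  apply: holomorphicV; last exact: holomorphic_det.
  by move=> z Dz; have := uH z Dz; rewrite unitmxE unitfE.
apply: holomorphicM; first exact: holomorphic_cst.
apply: holomorphic_det => i' j'; under eq_fun do rewrite !mxE.
exact: hH.
Qed.

Lemma reflection_mx p q (H K : R[i] -> 'M[R[i]]_(p, q)) :
  holomorphic_mx H -> holomorphic_mx K ->
  (forall z, circle z -> K z^* = H z) ->
  forall a, closed_disk a -> K a^* = H a.
Proof.
move=> hH hK HK a Da; apply/matrixP => i j.
by apply: (reflection (hH i j) (hK i j)) Da => z Cz; rewrite HK.
Qed.

End holomorphic_matrix.

(** * Stability of canonical factorizations *)

Section frobenius.
Context {R : realType}.

(** Lagrange's identity: twice the difference of the two sides is the sum of all (x_i y_j - x_j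
    y_i)^2. *)
Lemma cauchy_schwarz_sum (I : finType) (x y : I -> R) :
  (\sum_i x i * y i) ^+ 2 <= (\sum_i x i ^+ 2) * (\sum_i y i ^+ 2).
Proof.
have : 0 <= \sum_i \sum_j (x i * y j - x j * y i) ^+ 2.
  by apply: sumr_ge0 => i _; apply: sumr_ge0 => j _; exact: sqr_ge0.
under eq_bigr do under eq_bigr do rewrite sqrrB !exprMn.
have e1 : \sum_i \sum_j x i ^+ 2 * y j ^+ 2 = (\sum_i x i ^+ 2) * \sum_i y i ^+ 2.
  by rewrite mulr_suml; apply: eq_bigr => i _; rewrite mulr_sumr.
have e2 : \sum_i \sum_j x j ^+ 2 * y i ^+ 2 = (\sum_i x i ^+ 2) * \sum_i y i ^+ 2.
  by rewrite exchange_big /= e1.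
have e3 : \sum_i \sum_j x i * y j * (x j * y i) = (\sum_i x i * y i) ^+ 2.
  rewrite expr2 mulr_suml; apply: eq_bigr => i _; rewrite mulr_sumr.
  by apply: eq_bigr => j _; ring.
under eq_bigr do rewrite big_split sumrB.
rewrite big_split sumrB /= e1 e2.
under [X in _ - X]eq_bigr do rewrite sumrMnl.
rewrite sumrMnl e3; lra.
Qed.

Lemma mx_subE p q (A B : 'M[R[i]]_(p, q)) i j : (A - B) i j = A i j - B i j.
Proof. by rewrite !mxE. Qed.

(** The squared Frobenius norm. It is submultiplicative and comes from an inner product, and the
    stability estimate uses both properties. *)
Definition nsq {p q} (A : 'M[R[i]]_(p, q)) : R := \sum_i \sum_j mo (A i j) ^+ 2.

Lemma nsq_ge0 p q (A : 'M[R[i]]_(p, q)) : 0 <= nsq A.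
Proof. by apply: sumr_ge0 => i _; apply: sumr_ge0 => j _; exact: sqr_ge0. Qed.

Lemma nsqN p q (A : 'M[R[i]]_(p, q)) : nsq (- A) = nsq A.
Proof. by apply: eq_bigr => i _; apply: eq_bigr => j _; rewrite mxE moN. Qed.

Lemma mo_sqrD (x y : R[i]) : mo (x + y) ^+ 2 <= 2 * mo x ^+ 2 + 2 * mo y ^+ 2.
Proof. by have := moD x y; have := mo_ge0 (x + y); have := sqr_ge0 (mo x - mo y); nra. Qed.

Lemma nsqD p q (A B : 'M[R[i]]_(p, q)) : nsq (A + B) <= 2 * nsq A + 2 * nsq B.
Proof.
rewrite /nsq !mulr_sumr -big_split /=; apply: ler_sum => i _.
rewrite !mulr_sumr -big_split /=; apply: ler_sum => j _.
by rewrite mxE mo_sqrD.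
Qed.

Lemma nsqB p q (A B : 'M[R[i]]_(p, q)) : nsq (A - B) <= 2 * nsq A + 2 * nsq B.
Proof. by rewrite -(nsqN B) nsqD. Qed.

Lemma nsqM p q r (A : 'M[R[i]]_(p, q)) (B : 'M[R[i]]_(q, r)) :
  nsq (A *m B) <= nsq A * nsq B.
Proof.
rewrite /nsq mulr_suml; apply: ler_sum => i _.
rewrite exchange_big mulr_sumr /=; apply: ler_sum => j _; rewrite mxE.
apply: le_trans (cauchy_schwarz_sum _ _).
rewrite ler_pXn2r ?nnegrE ?mo_ge0 ?sumr_ge0 // => [|k _]; last first.
  by rewrite mulr_ge0 ?mo_ge0.
apply: le_trans (mo_sum _ _ _) _; apply: ler_sum => k _.
by rewrite moM.
Qed.

Lemma le_entry_nsq p q (A : 'M[R[i]]_(p, q)) i j : mo (A i j) ^+ 2 <= nsq A.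
Proof.
rewrite /nsq (bigD1 i) //= (bigD1 j) //= -addrA lerDl addr_ge0 //.
  by apply: sumr_ge0 => k _; exact: sqr_ge0.
by apply: sumr_ge0 => k _; apply: sumr_ge0 => l _; exact: sqr_ge0.
Qed.

Lemma nsq_cross p q (A B : 'M[R[i]]_(p, q)) :
  nsq (A - B) =
  nsq A + nsq B - 2 * complex.Re (\sum_i \sum_j A i j * (B i j)^*).
Proof.
have ReD (x y : R[i]) : complex.Re (x + y) = complex.Re x + complex.Re y.
  by case: x; case: y.
have Re_sum (I : finType) (F : I -> R[i]) :
    complex.Re (\sum_i F i) = \sum_i complex.Re (F i).
  by apply: (big_morph _ ReD).
have key (x y : R[i]) : mo (x - y) ^+ 2 = mo x ^+ 2 + mo y ^+ 2 - 2 * complex.Re (x * y^*).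
  by rewrite !mo_sqr -conjcE; case: x => a b; case: y => c d /=; ring.
rewrite /nsq Re_sum mulr_sumr -big_split -sumrB /=; apply: eq_bigr => i _.
rewrite Re_sum mulr_sumr -big_split -sumrB /=; apply: eq_bigr => j _.
by rewrite !mxE key.
Qed.

Lemma nsq_cross_le p q (A B : 'M[R[i]]_(p, q)) :
  nsq B + (- 2) * complex.Re (\sum_i \sum_j A i j * (B i j)^*) <= nsq (A - B).
Proof. by rewrite nsq_cross; have := nsq_ge0 A; lra. Qed.

End frobenius.

Lemma cvg_sumr (K : numFieldType) (T : Type) (F : set_system T) (FF : Filter F)
    (I : Type) (r : seq I) (f : I -> T -> K) (l : I -> K) :
  (forall i, f i t @[t --> F] --> l i) ->
  (\sum_(i <- r) f i t) @[t --> F] --> \sum_(i <- r) l i.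
Proof.
move=> fl; elim: r => [|i r IH].
  by rewrite big_nil; under eq_fun do rewrite big_nil; exact: cvg_cst.
rewrite big_cons; under eq_fun do rewrite big_cons.
exact: (cvgD (fl i) IH).
Qed.

Lemma cvg_nsq {R : realType} p q (T : Type) (F : set_system T) (FF : Filter F)
    (H : T -> 'M[R[i]]_(p, q)) (A : 'M[R[i]]_(p, q)) :
  (forall i j, H t i j @[t --> F] --> A i j) -> nsq (H t) @[t --> F] --> nsq A.
Proof.
move=> HA; apply: cvg_sumr => i; apply: cvg_sumr => j.
have mH : mo (H t i j) @[t --> F] --> mo (A i j).
  by apply: cvg_comp (HA i j) _; exact: continuous_mo.
by rewrite expr2; under eq_fun do rewrite expr2; exact: (cvgM mH mH).
Qed.

Definition real_avg {R : realType} (F : R[i] -> R) m : R :=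
  m%:R^-1 * \sum_(0 <= k < m) F (expi (2 * pi * k%:R / m%:R)).

Section real_average.
Context {R : realType}.
Implicit Types F G : R[i] -> R.

Lemma le_real_avg F G m : (forall z, circle z -> F z <= G z) ->
  real_avg F m <= real_avg G m.
Proof.
move=> FG; rewrite ler_wpM2l ?invr_ge0 //; apply: ler_sum => k _.
by apply: FG; exact: circle_expi.
Qed.

Lemma real_avgD F G m :
  real_avg (fun z => F z + G z) m = real_avg F m + real_avg G m.
Proof. by rewrite /real_avg big_split mulrDr. Qed.

Lemma real_avgZ c F m : real_avg (fun z => c * F z) m = c * real_avg F m.
Proof. by rewrite /real_avg -mulr_sumr mulrCA. Qed.

Lemma real_avg_cst (c : R) m : (0 < m)%N -> real_avg (fun=> c) m = c.
Proof.
move=> m0; rewrite /real_avg sumr_const_nat subn0 -[c *+ m]mulr_natl mulrA.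
by rewrite mulVf ?mul1r // pnatr_eq0 -lt0n.
Qed.

Lemma real_avg_Re (f : R[i] -> R[i]) m :
  real_avg (fun z => complex.Re (f z)) m = complex.Re (circle_avg f m).
Proof.
have ReD (x y : R[i]) : complex.Re (x + y) = complex.Re x + complex.Re y.
  by case: x; case: y.
have ReZ (r : R) (x : R[i]) : complex.Re (r%:C * x) = r * complex.Re x.
  by case: x => a b /=; rewrite mul0r subr0.
rewrite /real_avg /circle_avg -(rmorph_nat (real_complex R)) -fmorphV ReZ.
by congr (_ * _); symmetry; apply: (big_morph _ ReD).
Qed.


Lemma real_avg_sum (I : finType) (f : I -> R[i] -> R) m :
  real_avg (fun z => \sum_i f i z) m = \sum_i real_avg (f i) m.
Proof. by rewrite /real_avg exchange_big mulr_sumr. Qed.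

Lemma mo_circle_avg_sqr (f : R[i] -> R[i]) m : (0 < m)%N ->
  mo (circle_avg f m) ^+ 2 <= real_avg (fun z => mo (f z) ^+ 2) m.
Proof.
move=> m0; have mp : 0 < m%:R :> R by rewrite ltr0n.
rewrite /circle_avg /real_avg moM moV exprMn.
have -> : mo (m%:R : R[i]) = m%:R.
  by rewrite -(rmorph_nat (real_complex R)) mo_real ger0_norm.
rewrite !big_mkord exprVn expr2 invfM -mulrA ler_wpM2l ?invr_ge0 //.
rewrite ler_pdivrMl //.
pose F (k : 'I_m) := f (expi (2 * pi * (k : nat)%:R / m%:R)).
have := @cauchy_schwarz_sum R 'I_m (fun k => mo (F k)) (fun=> 1).
under eq_bigr do rewrite mulr1.
under [X in _ * X]eq_bigr do rewrite expr1n.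
rewrite sumr_const card_ord mulrC => h; apply: le_trans h.
by rewrite ler_pXn2r ?nnegrE ?mo_ge0 ?sumr_ge0 // ?mo_sum // => k _; exact: mo_ge0.
Qed.

Lemma nsq_circle_avg p q (D : R[i] -> 'M[R[i]]_(p, q)) m : (0 < m)%N ->
  nsq (\matrix_(i, j) circle_avg (fun z => D z i j) m) <=
  real_avg (fun z => nsq (D z)) m.
Proof.
move=> m0; rewrite /nsq real_avg_sum; apply: ler_sum => i _.
rewrite real_avg_sum; apply: ler_sum => j _.
by rewrite mxE mo_circle_avg_sqr.
Qed.

End real_average.

Section canonical_pairs.
Context {R : realType} {n : nat}.
Implicit Types h M P : R[i] -> 'M[R[i]]_n.

(* The factor h_- is recorded in the chart 1/z, as [M z = h_- (1/z)]. *)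
Definition canonical_pair h M P : Prop :=
  [/\ holomorphic_mx M, holomorphic_mx P,
      forall z, closed_disk z -> M z \in unitmx,
      forall z, closed_disk z -> P z \in unitmx &
      forall z, circle z -> h z = M z^* *m P z].

Lemma closed_disk_conj (z : R[i]) : closed_disk z -> closed_disk z^*.
Proof. by move=> /closed_diskE z1; apply/closed_diskE; rewrite mo_conj. Qed.

Lemma closed_disk0 : closed_disk (0 : R[i]).
Proof. by apply/closed_diskE; rewrite mo0. Qed.

Lemma canonical_pair_moebius h M P a : mo a < 1 -> canonical_pair h M P ->
  canonical_pair (fun z => h (moebius a z)) (fun z => M (moebius a^* z))
    (fun z => P (moebius a z)).
Proof.
move=> a1 [hM hP uM uP hh]; have a1' : mo a^* < 1 by rewrite mo_conj.
have Dm b z : mo b < 1 -> closed_disk z -> closed_disk (moebius b z).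
  move=> b1 /closed_diskE z1; apply/closed_diskE.
  by have [_ k _] := mo_moebius z b1; exact: k.
split.
- by move=> i j; exact: (holomorphic_comp_moebius a1' (hM i j)).
- by move=> i j; exact: (holomorphic_comp_moebius a1 (hP i j)).
- by move=> z Dz; apply: uM; exact: Dm.
- by move=> z Dz; apply: uP; exact: Dm.
- move=> z /circleE z1; rewrite -conj_moebius; apply: hh; apply/circleE.
  by have [_ _ k] := mo_moebius z a1; exact: k.
Qed.

(* For an analytic matrix and an anti-analytic one with the same constant term
   removed, the mean of their inner product over the circle vanishes; so the
   norms of both are controlled by the norm of the difference. *)
Lemma canonical_lipschitz0 h h0 M P M0 P0 (S0 S1 d2 : R) :
  canonical_pair h M P -> canonical_pair h0 M0 P0 ->
  (forall z, closed_disk z -> nsq (invmx (P0 z)) <= S0) ->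
  (forall z, closed_disk z -> nsq (invmx (M0 z)) <= S1) ->
  (forall z, circle z -> nsq (h z - h0 z) <= d2) -> 0 <= d2 ->
  4 * S0 * S1 * d2 <= 1 ->
  nsq (invmx (P0 0) *m invmx (M0 0) - invmx (P 0) *m invmx (M 0)) <=
  4 * d2 * S0 ^+ 2 * S1 ^+ 2.
Proof.
move=> [hM hP uM uP hh] [hM0 hP0 uM0 uP0 hh0] bS0 bS1 hd d20 small.
have S00 : 0 <= S0 by apply: le_trans (bS0 _ closed_disk0); exact: nsq_ge0.
have S10 : 0 <= S1 by apply: le_trans (bS1 _ closed_disk0); exact: nsq_ge0.
(* The left factor [invmx (P 0)] normalizes A 0 to [invmx (P0 0)]. Then (A 0 - B 0) M0(0)^-1 is the
   matrix to be estimated, while on the circle D = Y (h - h0) P0^-1 contains the small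
   difference. *)
pose A z := invmx (P 0) *m P z *m invmx (P0 z).
pose B z := invmx (P 0) *m invmx (M z) *m M0 z.
pose Y z := invmx (P 0) *m invmx (M z^*).
pose D z := A z - B z^*.
have hA : holomorphic_mx A.
  exact: (holomorphic_mulmx (holomorphic_mulmx (holomorphic_mx_cst _) hP)
    (holomorphic_invmx uP0 hP0)).
have hB : holomorphic_mx B.
  exact: (holomorphic_mulmx (holomorphic_mulmx (holomorphic_mx_cst _)
    (holomorphic_invmx uM hM)) hM0).
have A0 : A 0 = invmx (P0 0).
  by rewrite /A mulVmx ?mul1mx //; apply: uP; exact: closed_disk0.
have DE z : circle z -> D z = Y z *m (h z - h0 z) *m invmx (P0 z).
  move=> Cz; have Dz := circle_closed_disk Cz; have Dz' := closed_disk_conj Dz.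
  have eA : Y z *m (M z^* *m P z) *m invmx (P0 z) = A z.
    by rewrite /Y /A -(mulmxA (invmx (P 0))) (mulKmx (uM _ Dz')).
  have eB : Y z *m (M0 z^* *m P0 z) *m invmx (P0 z) = B z^*.
    by rewrite /Y /B mulmxA (mulmxK (uP0 _ Dz)).
  by rewrite (hh _ Cz) (hh0 _ Cz) mulmxBr mulmxBl eA eB.
(* The mean inner product of A - A 0 and the anti-analytic B - A 0. Conjugation makes the second
   factor analytic and the first one vanishes at 0, so [c] tends to 0. The same constant is
   subtracted from both, which leaves [D] unchanged. *)
pose c N := circle_avg (fun z => \sum_i \sum_j (A z - A 0) i j * ((B z^* - A 0) i j)^*) (2 ^ N).
have c0 : c N @[N --> \oo] --> (0 : R[i]).
  pose e z := \sum_i \sum_j (A z - A 0) i j * ((B z^* - A 0) i j)^*.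
  have he : holomorphic e.
    apply: holomorphic_sum => i _; apply: holomorphic_sum => j _.
    apply: holomorphicM.
      apply: (@holomorphic_eq _ (fun z => A z i j - A 0 i j)).
        by move=> z _; rewrite mx_subE.
      by apply: holomorphicB; [exact: hA | exact: holomorphic_cst].
    apply: (@holomorphic_conj _ (fun z => (B z - A 0) i j)).
    apply: (@holomorphic_eq _ (fun z => B z i j - A 0 i j)).
      by move=> z _; rewrite mx_subE.
    by apply: holomorphicB; [exact: hB | exact: holomorphic_cst].
  have := mean_value he.
  suff -> : e 0 = 0 by [].
  rewrite /e big1 // => i _; rewrite big1 // => j _.
  by rewrite subrr mxE mul0r.
pose y N := real_avg (fun z => nsq (Y z)) (2 ^ N).
pose x N := real_avg (fun z => nsq (D z)) (2 ^ N).
have y0 N : 0 <= y N.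
  rewrite mulr_ge0 ?invr_ge0 // sumr_ge0 // => k _; exact: nsq_ge0.
have m0 N : (0 < 2 ^ N)%N by rewrite expn_gt0.
have xy N : x N <= d2 * S0 * y N.
  rewrite /y -real_avgZ; apply: le_real_avg => z Cz; rewrite DE //.
  apply: le_trans (nsqM _ _) _; have h1 := bS0 _ (circle_closed_disk Cz).
  apply: le_trans (ler_wpM2l (nsq_ge0 _) h1) _.
  have h2 : nsq (Y z *m (h z - h0 z)) <= nsq (Y z) * d2.
    by apply: le_trans (nsqM _ _) _; rewrite ler_wpM2l ?nsq_ge0 // hd.
  by apply: le_trans (ler_wpM2r S00 h2) _; rewrite le_eqVlt; apply/orP; left; apply/eqP; ring.
have xc N : real_avg (fun z => nsq (B z^* - A 0)) (2 ^ N) <= x N + 2 * mo (c N).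
  have : real_avg (fun z => nsq (B z^* - A 0)) (2 ^ N) + (- 2) * complex.Re (c N) <= x N.
    rewrite /c -real_avg_Re -real_avgZ -real_avgD; apply: le_real_avg => z Cz.
    have -> : D z = (A z - A 0) - (B z^* - A 0) by rewrite /D; rewrite opprB addrA subrK.
    exact: nsq_cross_le.
  by have := ler_norm (complex.Re (c N)); have := mo_Re (c N); lra.
(* [Y] contains the unknown factors, so it is bounded through [B], which means through [D]. The
   inequalities [xy] and [yb] are circular; since 4 S0 S1 d2 <= 1, half of [y] can be absorbed. *)
have yb N : y N <= S1 * (2 * S0 + 2 * (x N + 2 * mo (c N))).
  apply: (@le_trans _ _ (S1 * (2 * S0 +
     2 * real_avg (fun z => nsq (B z^* - A 0)) (2 ^ N)))); last first.
    by rewrite ler_wpM2l // lerD2l ler_wpM2l.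
  rewrite -{1}(@real_avg_cst R (2 * S0) (2 ^ N)) // -real_avgZ -real_avgD -real_avgZ.
  apply: le_real_avg => z Cz; have Dz' := closed_disk_conj (circle_closed_disk Cz).
  have -> : Y z = B z^* *m invmx (M0 z^*) by rewrite /B mulmxK ?uM0.
  apply: le_trans (nsqM _ _) _; rewrite mulrC; apply: ler_pM; rewrite ?nsq_ge0 //.
    exact: bS1.
  rewrite -{1}(subrK (A 0) (B z^*)) addrC; apply: le_trans (nsqD _ _) _.
  by rewrite lerD2r ler_wpM2l // A0 bS0 //; exact: closed_disk0.
have xb N : x N <= d2 * S0 * (4 * S1 * S0 + 8 * S1 * mo (c N)).
  apply: le_trans (xy N) _; rewrite ler_wpM2l ?mulr_ge0 //.
  have h1 := xy N; have h2 := yb N; have h3 := y0 N; have h4 := mo_ge0 (c N).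
  have h5 : 2 * S1 * x N <= y N / 2.
    apply: (@le_trans _ _ (2 * S1 * (d2 * S0 * y N))).
      by rewrite ler_wpM2l ?mulr_ge0.
    by nra.
  by nra.
(* The averages of [D] tend to A 0 - B 0, and by Cauchy-Schwarz their squared norms are at most the
   mean square [x]. *)
pose G N : 'M[R[i]]_n := \matrix_(i, j) circle_avg (fun z => D z i j) (2 ^ N).
have Gcvg i j : G N i j @[N --> \oo] --> (A 0 - B 0) i j.
  have -> : (fun N => G N i j) = (fun N => circle_avg (fun z => A z i j) (2 ^ N)
      - circle_avg (fun z => B z^* i j) (2 ^ N)).
    apply/funext => N; rewrite mxE -avgB; congr (_ * _); apply: eq_bigr => k _.
    by rewrite mx_subE.
  rewrite mx_subE; apply: cvgB; first exact: (mean_value (hA i j)).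
  exact: (mean_value_conj (hB i j)).
have nG : nsq (G N) @[N --> \oo] --> nsq (A 0 - B 0) by exact: (cvg_nsq _ Gcvg).
have rhs : d2 * S0 * (4 * S1 * S0 + 8 * S1 * mo (c N)) @[N --> \oo] -->
   d2 * S0 * (4 * S1 * S0).
  rewrite -[X in _ --> X]/(d2 * S0 * _) -{2}[4 * S1 * S0]addr0 -(mulr0 (8 * S1)).
  apply: cvgM; first exact: cvg_cst.
  apply: cvgD; first exact: cvg_cst.
  apply: cvgM; first exact: cvg_cst.
  rewrite -(@mo0 R); apply: cvg_comp c0 _; exact: continuous_mo.
have AB : nsq (A 0 - B 0) <= d2 * S0 * (4 * S1 * S0).
  apply: ler_cvg_to nG rhs _; apply: nearW => N.
  by apply: le_trans (xb N); exact: nsq_circle_avg.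
have -> : invmx (P0 0) *m invmx (M0 0) - invmx (P 0) *m invmx (M 0) =
   (A 0 - B 0) *m invmx (M0 0).
  by rewrite mulmxBl A0 /B mulmxK // uM0 //; exact: closed_disk0.
apply: le_trans (nsqM _ _) _.
apply: le_trans (ler_wpM2l (nsq_ge0 _) (bS1 _ closed_disk0)) _.
apply: le_trans (ler_wpM2r S10 AB) _.
by rewrite le_eqVlt; apply/orP; left; apply/eqP; ring.
Qed.

Let absorb (g s d : R) : 0 <= g -> 4 * s * d <= 1 ->
  g <= (2 * s + 2 * g) * d * s -> g <= 4 * d * s ^+ 2.
Proof.
move=> g0 small; have : 0 <= g * (1 - 4 * s * d) by rewrite mulr_ge0 // subr_ge0.
lra.
Qed.

(** For [a] inside the disk, the Moebius map preserves all hypotheses, so the constants do not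
    depend on [a]. On the circle it degenerates; there the two products are the inverses of h0 and
    h, with difference V (h - h0) V0, and the same kind of absorption applies. *)
Lemma canonical_lipschitz h h0 M P M0 P0 (S0 S1 d2 : R) :
  canonical_pair h M P -> canonical_pair h0 M0 P0 ->
  (forall z, closed_disk z -> nsq (invmx (P0 z)) <= S0) ->
  (forall z, closed_disk z -> nsq (invmx (M0 z)) <= S1) ->
  (forall z, circle z -> nsq (h z - h0 z) <= d2) -> 0 <= d2 ->
  4 * S0 * S1 * d2 <= 1 -> forall a, closed_disk a ->
  nsq (invmx (P0 a) *m invmx (M0 a^*) - invmx (P a) *m invmx (M a^*)) <=
  4 * d2 * S0 ^+ 2 * S1 ^+ 2.
Proof.
move=> cp cp0 bS0 bS1 hd d20 small a /closed_diskE.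
have S00 : 0 <= S0 by apply: le_trans (bS0 _ closed_disk0); exact: nsq_ge0.
have S10 : 0 <= S1 by apply: le_trans (bS1 _ closed_disk0); exact: nsq_ge0.
rewrite le_eqVlt => /orP[/eqP a1|a1]; last first.
  have a1' : mo a^* < 1 by rewrite mo_conj.
  have Dm b z : mo b < 1 -> closed_disk z -> closed_disk (moebius b z).
    move=> b1 /closed_diskE z1; apply/closed_diskE.
    by have [_ k _] := mo_moebius z b1; exact: k.
  have := @canonical_lipschitz0 _ _ _ _ _ _ S0 S1 d2
    (canonical_pair_moebius a1 cp) (canonical_pair_moebius a1 cp0).
  rewrite !moebius0; apply=> //.
  - by move=> z Dz; apply: bS0; exact: Dm.
  - by move=> z Dz; apply: bS1; exact: Dm.
  - move=> z /circleE z1; apply: hd; apply/circleE.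
    by have [_ _ k] := mo_moebius z a1; exact: k.
have Ca : circle a by exact/circleE.
have Da := circle_closed_disk Ca; have Da' := closed_disk_conj Da.
case: cp cp0 => [_ _ uM uP hh] [_ _ uM0 uP0 hh0].
set G := _ - _.
pose V := invmx (P a) *m invmx (M a^*); pose V0 := invmx (P0 a) *m invmx (M0 a^*).
have GE : G = V *m (h a - h0 a) *m V0.
  rewrite mulmxBr mulmxBl (hh _ Ca) (hh0 _ Ca) /G; congr (_ - _).
    rewrite /V /V0 -(mulmxA (invmx (P a))) (mulmxA (invmx (M _))).
    by rewrite (mulVmx (uM _ Da')) mul1mx (mulVmx (uP _ Da)) mul1mx.
  rewrite -mulmxA /V0 -(mulmxA (M0 _)) (mulmxA (P0 a)) (mulmxV (uP0 _ Da)).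
  by rewrite mul1mx (mulmxV (uM0 _ Da')) mulmx1.
have nV0 : nsq V0 <= S0 * S1.
  by apply: le_trans (nsqM _ _) _; apply: ler_pM; rewrite ?nsq_ge0 ?bS0 ?bS1.
have nV : nsq V <= 2 * (S0 * S1) + 2 * nsq G.
  have -> : V = V0 - G by rewrite /G /V /V0 subKr.
  by apply: le_trans (nsqB _ _) _; rewrite lerD2r ler_wpM2l.
have nG : nsq G <= nsq V * d2 * (S0 * S1).
  rewrite {1}GE; apply: le_trans (nsqM _ _) _; apply: ler_pM; rewrite ?nsq_ge0 //.
  by apply: le_trans (nsqM _ _) _; rewrite ler_wpM2l ?nsq_ge0 // hd.
have g0 := nsq_ge0 G; have SS : 0 <= S0 * S1 by rewrite mulr_ge0.
have : nsq G <= (2 * (S0 * S1) + 2 * nsq G) * d2 * (S0 * S1).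
  by apply: le_trans nG _; rewrite ler_wpM2r // ler_wpM2r.
have -> : 4 * d2 * S0 ^+ 2 * S1 ^+ 2 = 4 * d2 * (S0 * S1) ^+ 2 by ring.
have {}small : 4 * (S0 * S1) * d2 <= 1 by rewrite mulrA.
move: SS small; set s := S0 * S1 => SS small hG.
exact: absorb.
Qed.

Lemma canonical_pair_unique h M P M' P' : canonical_pair h M P ->
  canonical_pair h M' P' ->
  forall a, closed_disk a -> M a^* *m P a = M' a^* *m P' a.
Proof.
move=> [hM hP uM uP hh] [hM' hP' uM' uP' hh'] a Da.
have Da' := closed_disk_conj Da.
have := @reflection_mx _ _ _ (fun z => P' z *m invmx (P z))
  (fun z => invmx (M' z) *m M z).
move=> /(_ (holomorphic_mulmx hP' (holomorphic_invmx uP hP))).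
move=> /(_ (holomorphic_mulmx (holomorphic_invmx uM' hM') hM)).
have E z : circle z -> invmx (M' z^*) *m M z^* = P' z *m invmx (P z).
  move=> Cz; have Dz := circle_closed_disk Cz; have Dz' := closed_disk_conj Dz.
  have eq : M z^* *m P z = M' z^* *m P' z by rewrite -hh // -hh'.
  by rewrite -[M z^*](mulmxK (uP z Dz)) eq !mulmxA mulVmx ?mul1mx ?uM'.
move=> /(_ E) /(_ a Da) eq.
have -> : M a^* = M' a^* *m (P' a *m invmx (P a)) by rewrite -eq mulKVmx ?uM'.
by rewrite -!mulmxA mulVmx ?mulmx1 ?uP.
Qed.

End canonical_pairs.

(** * Birkhoff factorization of polynomial matrices *)

Section elementary_matrices.
Context {A : comNzRingType} {n : nat}.
Implicit Types (N : 'M[A]_n) (i j k : 'I_n).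

(** Any permutation other than the identity moves some index besides [j], and in that row it meets a
    zero of [N]. *)
Lemma det_row_replaced N j :
  (forall i k, i != j -> N i k = (i == k)%:R) -> \det N = N j j.
Proof.
move=> hN; rewrite /determinant (bigD1 (1%g : {perm 'I_n})) //= odd_perm1 expr0 mul1r.
rewrite (bigD1 j) //= perm1 big1 ?mulr1 => [|i ij]; last first.
  by rewrite perm1 hN // eqxx.
rewrite big1 ?addr0 // => s s1.
have [i ij si] : exists2 i, i != j & s i != i.
  apply: contrapT => h; case/negP: s1; apply/eqP/permP => i; rewrite perm1.
  have fix_ i' : i' != j -> s i' = i'.
    by move=> i'j; apply/eqP; apply: contrapT => /negP k; apply: h; exists i'.
  have [->|/fix_//] := eqVneq i j.
  apply/eqP; apply: contrapT => /negP /[dup] k /fix_ /perm_inj; exact/eqP.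
by rewrite (bigD1 i) //= hN // eq_sym (negbTE si) mul0r mulr0.
Qed.

Lemma det_col_replaced N j :
  (forall i k, k != j -> N i k = (i == k)%:R) -> \det N = N j j.
Proof.
move=> hN; rewrite -det_tr (@det_row_replaced _ j) ?mxE // => i k ij.
by rewrite mxE hN // eq_sym.
Qed.

Definition diag_at j (a : A) : 'M[A]_n := diag_mx (\row_k if k == j then a else 1).

Lemma det_diag_at j a : \det (diag_at j a) = a.
Proof.
rewrite (@det_row_replaced _ j) => [|i k ij]; first by rewrite !mxE eqxx mulr1n.
by rewrite !mxE (negbTE ij); case: eqP.
Qed.

Lemma mul_diag_at N j a i k :
  (N *m diag_at j a) i k = N i k * (if k == j then a else 1).
Proof. by rewrite mul_mx_diag !mxE. Qed.

Lemma mul_diag_at_l N j a i k :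
  (diag_at j a *m N) i k = (if i == j then a else 1) * N i k.
Proof. by rewrite mul_diag_mx !mxE. Qed.

End elementary_matrices.

Section birkhoff.
Context {K : closedFieldType} {n : nat}.
Implicit Types (P M B : 'M[{poly K}]_n) (a u w : K).

Definition eval_mx w P : 'M[K]_n := map_mx (horner_eval w) P.

Lemma eval_mxE w P i j : eval_mx w P i j = (P i j).[w].
Proof. by rewrite mxE. Qed.

Lemma eval_mxM w P B : eval_mx w (P *m B) = eval_mx w P *m eval_mx w B.
Proof. exact: map_mxM. Qed.

Lemma eval_mx_cst w (E : 'M[K]_n) : eval_mx w (map_mx polyC E) = E.
Proof. by apply/matrixP => i j; rewrite !mxE horner_evalE hornerC. Qed.

Lemma det_eval_mx w P : \det (eval_mx w P) = (\det P).[w].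
Proof. by rewrite det_map_mx. Qed.

Lemma det_cst_mx (E : 'M[K]_n) : \det (map_mx polyC E) = (\det E)%:P.
Proof. by rewrite det_map_mx. Qed.

(** A null vector v of P(a) with v_j != 0 replaces column j of the identity matrix. Column j of [P]
    times this matrix vanishes at [a], so X - a divides it. *)
Lemma split_column P a : (\det P).[a] = 0 ->
  exists j P1 (E : 'M[K]_n), E \in unitmx /\
    P = P1 *m diag_at j ('X - a%:P) *m map_mx polyC E.
Proof.
move=> dP.
have [v v0 hv] : exists2 v : 'cV[K]_n, v != 0 & eval_mx a P *m v = 0.
  have /det0P[v v0 hv] : \det (eval_mx a P)^T == 0.
    by rewrite det_tr det_eval_mx dP.
  exists v^T; first by rewrite trmx_eq0.
  by apply: trmx_inj; rewrite trmx_mul trmxK trmx0.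
have [j vj] : exists j, v j 0 != 0.
  apply: contrapT => h; case/negP: v0; apply/eqP/matrixP => j k.
  rewrite ord1 mxE; apply/eqP; apply: contrapT => /negP vj; apply: h.
  by exists j.
pose E : 'M[K]_n := \matrix_(i, k) if k == j then v i 0 else (i == k)%:R.
have uE : E \in unitmx.
  rewrite unitmxE unitfE (@det_col_replaced _ _ _ j) ?mxE ?eqxx // => i k kj.
  by rewrite mxE (negbTE kj).
pose Q := P *m map_mx polyC E.
have Qj i : root (Q i j) a.
  rewrite /root -eval_mxE eval_mxM eval_mx_cst.
  have <- : (eval_mx a P *m v) i 0 = (eval_mx a P *m E) i j.
    by rewrite !mxE; apply: eq_bigr => k _; rewrite !mxE eqxx.
  by rewrite hv mxE.
pose P1 : 'M[{poly K}]_n := \matrix_(i, k)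
  if k == j then Q i k %/ ('X - a%:P) else Q i k.
exists j, P1, (invmx E); split; first by rewrite unitmx_inv.
have -> : P1 *m diag_at j ('X - a%:P) = Q.
  apply/matrixP => i k; rewrite mul_diag_at mxE.
  case: eqP => [->|_]; last by rewrite mulr1.
  by rewrite divpK // dvdp_XsubCl.
by rewrite -mulmxA -map_mxM mulmxV // map_mx1 mulmx1.
Qed.

Lemma split_row P (l : 'rV[K]_n) j a : l 0 j != 0 -> l *m eval_mx a P = 0 ->
  let L : 'M[K]_n := \matrix_(i, k) if i == j then l 0 k else (i == k)%:R in
  exists P1, map_mx polyC L *m P = diag_at j ('X - a%:P) *m P1.
Proof.
move=> lj hl L; pose Q := map_mx polyC L *m P.
have Qj k : root (Q j k) a.
  rewrite /root -eval_mxE eval_mxM eval_mx_cst.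
  have <- : (l *m eval_mx a P) 0 k = (L *m eval_mx a P) j k.
    by rewrite !mxE; apply: eq_bigr => i _; rewrite !mxE eqxx.
  by rewrite hl mxE.
exists (\matrix_(i, k) if i == j then Q i k %/ ('X - a%:P) else Q i k).
apply/matrixP => i k; rewrite mul_diag_at_l [in RHS]mxE.
case: eqP => [->|_]; last by rewrite mul1r.
by rewrite mulrC divpK // dvdp_XsubCl.
Qed.

Variable inside : pred K.

(* The zeros of [\det P] are split off one by one, as a factor [w - a] of a column.
   If [a] is to be moved to the left factor, then some combination of the rows of
   the right factor vanishes at [a]; it replaces the row with the smallest exponent
   among those that occur in it, since this keeps the left factor polynomial in
   [w^-1]. *)
Lemma birkhoff P : \det P != 0 ->
  exists (kappa : 'I_n -> nat) M B,
  [/\ forall w, w != 0 -> eval_mx w P =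
        eval_mx w^-1 M *m diag_mx (\row_j w ^+ kappa j) *m eval_mx w B,
      forall u, root (\det M) u ->
        exists a, [/\ root (\det P) a, inside a & a * u = 1] &
      forall w, root (\det B) w -> root (\det P) w /\ ~~ inside w].
Proof.
have [m] := ubnP (size (\det P)); elim: m P => // m IH P szP P0.
have [/eqP sz1|/closed_rootP[a aP]] := boolP (size (\det P) == 1%N).
  have dP := size1_polyC (eq_leq sz1).
  exists (fun=> 0%N), 1%:M, P; split.
  - move=> w w0; rewrite /eval_mx map_mx1 mul1mx.
    suff -> : diag_mx (\row_j w ^+ 0) = 1%:M :> 'M[K]_n by rewrite mul1mx.
    by apply/matrixP => i j; rewrite !mxE expr0.
  - by move=> u; rewrite det1 /root hornerC oner_eq0.
  - move=> w; rewrite dP /root hornerC => /eqP h.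
    by move: P0; rewrite dP h eqxx.
have [j0 [P1 [E [uE PE]]]] := split_column (eqP aP).
have dE : \det E != 0 by rewrite -unitfE -unitmxE.
have dP : \det P = \det E *: (\det P1 * ('X - a%:P)).
  by rewrite PE !det_mulmx det_diag_at det_cst_mx mulrC mul_polyC.
have P10 : \det P1 != 0 by apply: contraNneq P0; rewrite dP => ->; rewrite mul0r scaler0.
have szP1 : (size (\det P1) < m)%N.
  move: szP; rewrite dP size_scale // size_Mmonic ?monicXsubC // size_XsubC.
  by rewrite addn2 /= ltnS.
have rP w : root (\det P1) w -> root (\det P) w.
  by rewrite dP rootZ // rootM => ->.
have [kappa [M [B [PMB rM rB]]]] := IH P1 szP1 P10.
pose B2 := B *m diag_at j0 ('X - a%:P) *m map_mx polyC E.
have dB2 : \det B2 = \det E *: (\det B * ('X - a%:P)).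
  by rewrite !det_mulmx det_diag_at det_cst_mx mulrC mul_polyC.
have PB2 w : w != 0 -> eval_mx w P =
    eval_mx w^-1 M *m diag_mx (\row_j w ^+ kappa j) *m eval_mx w B2.
  move=> w0; rewrite PE !eval_mxM PMB // -!mulmxA //.
(* A zero outside may stay in the right factor. *)
have [ina|outa] := boolP (inside a); last first.
  exists kappa, M, B2; split=> // [u /rM[b [b1 b2 b3]]|w].
    by exists b; split=> //; exact: rP.
  rewrite dB2 rootZ // rootM => /orP[/rB[h1 h2]|]; first by split=> //; exact: rP.
  by rewrite root_XsubC => /eqP ->.
have dBa : \det (eval_mx a B) != 0.
  rewrite det_eval_mx; apply/negP => /rB[_]; by rewrite ina.
have uBa : eval_mx a B \in unitmx by rewrite unitmxE unitfE.
(* B(a) is invertible, as det B has no zero inside. Row j0 of its inverse is taken to row j0 of the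
   diagonal factor, which vanishes at [a]. *)
have [l l0 hl] : exists2 l : 'rV[K]_n, l != 0 & l *m eval_mx a B2 = 0.
  exists (delta_mx 0 j0 *m invmx (eval_mx a B)).
    apply/negP => /eqP h; have : delta_mx 0 j0 = 0 :> 'rV[K]_n.
      by rewrite -[LHS](mulmxKV uBa) h mul0mx.
    by move=> /matrixP /(_ 0 j0) /eqP; rewrite !mxE !eqxx oner_eq0.
  rewrite !eval_mxM !mulmxA mulmxKV // eval_mx_cst.
  suff -> : delta_mx 0 j0 *m eval_mx a (diag_at j0 ('X - a%:P)) = 0 :> 'rV_n.
    by rewrite mul0mx.
  rewrite -rowE; apply/rowP => k; rewrite !mxE horner_evalE eqxx.
  by case: eqP; rewrite ?mulr1n ?mulr0n ?hornerXsubC ?subrr ?hornerC.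
have [j1 lj1] : exists j, l 0 j != 0.
  apply: contrapT => h; case/negP: l0; apply/eqP/matrixP => i j.
  rewrite ord1 [RHS]mxE; apply/eqP; apply: contrapT => /negP lj; apply: h.
  by exists j.
have [j lj minj] := @arg_minnP _ j1 (fun j => l 0 j != 0) kappa lj1.
set L : 'M[K]_n := \matrix_(i, k) if i == j then l 0 k else (i == k)%:R.
have [B3 hB3] : exists B3, map_mx polyC L *m B2 = diag_at j ('X - a%:P) *m B3.
  exact: split_row.
(* In the variable u = 1/w this is D L^-1 D^-1, where D is the diagonal matrix of the powers
   w^kappa. By minimality the exponents kappa_k - kappa_j are nonnegative where l_k != 0; elsewhere
   the coefficient is 0 and the truncated subtraction does no harm. *)
pose N : 'M[{poly K}]_n := \matrix_(i, k)
  if i == j then (if k == j then (l 0 j)^-1%:P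
                  else - (l 0 k / l 0 j) *: 'X^(kappa k - kappa j))
  else (i == k)%:R.
have dN : \det N = (l 0 j)^-1%:P.
  rewrite (@det_row_replaced _ _ _ j) ?mxE ?eqxx // => i k ij.
  by rewrite mxE (negbTE ij).
have dL : \det L = l 0 j.
  rewrite (@det_row_replaced _ _ _ j) ?mxE ?eqxx // => i k ij.
  by rewrite mxE (negbTE ij).
have X0 : 'X - a%:P != 0 by rewrite polyXsubC_eq0.
have dB3 : \det B3 = (l 0 j * \det E) *: \det B.
  apply: (mulfI X0); rewrite -{1}(det_diag_at j ('X - a%:P)) -det_mulmx -hB3.
  by rewrite det_mulmx det_cst_mx dL dB2 -!mul_polyC polyCM; ring.
have lE0 : l 0 j * \det E != 0 by rewrite mulf_neq0.
(* Here w - a = w (1 - a / w): the power of w raises the j-th exponent, and 1 - a u joins the left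
   factor, with its root where a u = 1. *)
exists (fun k => if k == j then (kappa k).+1 else kappa k),
  (M *m N *m diag_at j (1 - a *: 'X)), B3.
split.
- move=> w w0; rewrite (PB2 _ w0) (eval_mxM _ (M *m N)) (eval_mxM _ M).
  have NL : eval_mx w^-1 N *m diag_mx (\row_j w ^+ kappa j) *m L =
      diag_mx (\row_j w ^+ kappa j).
    apply/matrixP => i k; rewrite mul_mx_diag !mxE.
    have [->|ij] := eqVneq i j; last first.
      rewrite (bigD1 i) //= big1 ?addr0 => [|q qi]; last first.
        by rewrite !mxE horner_evalE (negbTE ij) eq_sym (negbTE qi) hornerC !mul0r.
      rewrite !mxE horner_evalE (negbTE ij) eqxx hornerC mul1r.
      by rewrite mulr_natr.
    rewrite (bigD1 j) //= !mxE !eqxx horner_evalE hornerC.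
    have [->|kj] := eqVneq k j.
      rewrite big1 ?addr0 ?mulr1n => [|q qj]; first by rewrite mulrAC mulVf ?mul1r.
      by rewrite !mxE (negbTE qj) mulr0.
    rewrite mulr0n (bigD1 k) //= big1 ?addr0 => [|q /andP[qj qk]]; last first.
      by rewrite !mxE (negbTE qj) (negbTE qk) mulr0.
    rewrite !mxE horner_evalE eqxx (negbTE kj) eqxx mulr1 hornerZ hornerXn.
    have [->|lk] := eqVneq (l 0 k) 0; first by rewrite mulr0 mul0r oppr0 !mul0r addr0.
    have hk := minj _ lk; rewrite -{2}(subnK hk) exprD exprVn !mulNr.
    by field; rewrite lj expf_neq0.
  have LB2 : L *m eval_mx w B2 = eval_mx w (diag_at j ('X - a%:P)) *m eval_mx w B3.
    by rewrite -eval_mxM -hB3 eval_mxM eval_mx_cst.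
  rewrite -{1}NL -!mulmxA LB2.
  congr (_ *m (_ *m _)); rewrite !mulmxA; congr (_ *m _).
  apply/matrixP => i k; rewrite mul_diag_mx mul_mx_diag !mxE !horner_evalE.
  have [->|ik] := eqVneq i k; last by rewrite !mulr0n ?horner0 ?mulr0 ?mul0r.
  rewrite !mulr1n; case: eqP => _; last by rewrite !hornerC mulr1 mul1r.
  rewrite hornerXsubC hornerD hornerC hornerN hornerZ hornerX exprS.
  by field.
- move=> u; rewrite !det_mulmx dN det_diag_at !rootM => /orP[/orP[/rM[b [b1 b2 b3]]|]|].
  + by exists b; split=> //; exact: rP.
  + by rewrite /root hornerC invr_eq0 (negbTE lj).
  + rewrite /root hornerD hornerC hornerN hornerZ hornerX subr_eq0 => /eqP h.
    by exists a; split.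
- move=> w; rewrite dB3 rootZ // => /rB[h1 h2]; split=> //; exact: rP.
Qed.

End birkhoff.

(** * The open mapping theorem on square-summable families *)

Section square_summable_sequences.
Context {R : realType} {n : nat} {I : choiceType}.
Local Notation V := ('cV[R[i]]_n).
Implicit Types (a b : I -> V) (s : seq I).

Lemma sqnormE (v : V) : sqnorm v = nsq v.
Proof.
by apply: eq_bigr => i _; rewrite big_ord_recl big_ord0 addr0 mo_sqr.
Qed.

Lemma sqnorm_ge0 (v : V) : 0 <= sqnorm v.
Proof. by rewrite sqnormE nsq_ge0. Qed.

(** A real bound on all finite partial sums: it contains membership in l^2 and survives
    coordinatewise limits. *)
Definition l2_le a (C : R) : Prop :=
  forall s, uniq s -> \sum_(k <- s) sqnorm (a k) <= C.

Lemma l2_leP a C : (l2_sqnorm a <= C%:E)%E <-> l2_le a C.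
Proof.
split=> [h s us|h].
  rewrite -lee_fin; apply: le_trans h; apply: ereal_sup_ubound => /=.
  exists [set` s]; first by split; [exact: finite_seq | exact: subsetT].
  by rewrite -fsbig_seq // sumEFin.
apply: ge_ereal_sup => _ [A [finA _] <-].
by rewrite fsbig_finite // sumEFin lee_fin; apply: h; exact: finmap.fset_uniq.
Qed.

Lemma l2_sqnorm_ge0 a : (0 <= l2_sqnorm a)%E.
Proof. by apply: esum_ge0 => k _; rewrite lee_fin sqnorm_ge0. Qed.

Definition l2_sq a : R := fine (l2_sqnorm a).

Lemma l2_sq_ge0 a : 0 <= l2_sq a.
Proof. by rewrite fine_ge0 // l2_sqnorm_ge0. Qed.

Lemma l2_sqE a : in_l2 a -> (l2_sq a)%:E = l2_sqnorm a.
Proof. by move=> ha; rewrite fineK // ge0_fin_numE ?l2_sqnorm_ge0. Qed.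

Lemma l2_le_sq a : in_l2 a -> l2_le a (l2_sq a).
Proof. by move=> ha; apply/l2_leP; rewrite l2_sqE. Qed.

Lemma l2_le_in a C : l2_le a C -> in_l2 a.
Proof. by move=> /l2_leP h; rewrite /in_l2 (le_lt_trans h) // ltry. Qed.

Lemma l2_sq_le a C : l2_le a C -> l2_sq a <= C.
Proof. by move=> h; rewrite -lee_fin l2_sqE; [exact/l2_leP | exact: l2_le_in h]. Qed.

Lemma sqnorm_le_sq a k : in_l2 a -> sqnorm (a k) <= l2_sq a.
Proof. by move=> /l2_le_sq /(_ [:: k] isT); rewrite big_seq1. Qed.

Lemma l2_leD a b C D : l2_le a C -> l2_le b D -> l2_le (a + b) (2 * C + 2 * D).
Proof.
move=> ha hb s us.
apply: (@le_trans _ _ (\sum_(k <- s) (2 * sqnorm (a k) + 2 * sqnorm (b k)))).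
  by apply: ler_sum => k _; rewrite !sqnormE; exact: nsqD.
by rewrite big_split -!mulr_sumr /= lerD // ler_wpM2l // ?ha ?hb.
Qed.

Lemma sqnormZ c (v : V) : sqnorm (c *: v) = mo c ^+ 2 * sqnorm v.
Proof.
rewrite !sqnormE /nsq mulr_sumr; apply: eq_bigr => i _.
by rewrite mulr_sumr; apply: eq_bigr => j _; rewrite mxE moM exprMn.
Qed.

Lemma l2_leZ c a C : l2_le a C -> l2_le (c *: a) (mo c ^+ 2 * C).
Proof.
move=> ha s us; under eq_bigr do rewrite /= sqnormZ.
by rewrite -mulr_sumr ler_wpM2l ?sqr_ge0 ?ha.
Qed.

Lemma l2_leW a C D : C <= D -> l2_le a C -> l2_le a D.
Proof. by move=> CD h s us; apply: le_trans (h s us) CD. Qed.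

Lemma l2_sqD a b : in_l2 a -> in_l2 b ->
  in_l2 (a + b) /\ l2_sq (a + b) <= 2 * l2_sq a + 2 * l2_sq b.
Proof.
move=> /l2_le_sq ha /l2_le_sq hb; have h := l2_leD ha hb.
by split; [exact: l2_le_in h | exact: l2_sq_le].
Qed.

Lemma in_l2Z c a : in_l2 a -> in_l2 (c *: a).
Proof. by move=> /l2_le_sq h; exact: l2_le_in (l2_leZ c h). Qed.

Lemma l2_sqZ c a : in_l2 a -> l2_sq (c *: a) <= mo c ^+ 2 * l2_sq a.
Proof. by move=> /l2_le_sq h; exact: l2_sq_le (l2_leZ c h). Qed.

Lemma l2_sqN a : in_l2 a -> in_l2 (- a) /\ l2_sq (- a) <= l2_sq a.
Proof.
move=> ha; rewrite -scaleN1r; split; first exact: in_l2Z.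
by apply: le_trans (l2_sqZ _ ha) _; rewrite moN mo1 expr1n mul1r.
Qed.

Lemma l2_sqB a b : in_l2 a -> in_l2 b ->
  in_l2 (a - b) /\ l2_sq (a - b) <= 2 * l2_sq a + 2 * l2_sq b.
Proof.
move=> ha hb; have [hb' qb] := l2_sqN hb; have [h q] := l2_sqD ha hb'.
by split=> //; apply: le_trans q _; lra.
Qed.

Lemma in_l2_0 : in_l2 (0 : I -> V) /\ l2_sq (0 : I -> V) = 0.
Proof.
have h : l2_le (0 : I -> V) 0.
  move=> s _; rewrite big1 // => k _; rewrite sqnormE /nsq big1 // => i _.
  by rewrite big1 // => j _; rewrite mxE mo0 expr0n.
split; first exact: l2_le_in h.
by apply/eqP; rewrite eq_le l2_sq_ge0 l2_sq_le.
Qed.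

Lemma sqnorm_eq0 (v : V) : sqnorm v <= 0 -> v = 0.
Proof.
rewrite sqnormE => h; apply/matrixP => i j; rewrite mxE.
have := le_trans (le_entry_nsq v i j) h.
by rewrite le_eqVlt ltNge sqr_ge0 orbF sqrf_eq0 mo_eq0 => /eqP.
Qed.

Lemma l2_sq_eq0 a : in_l2 a -> l2_sq a <= 0 -> a = 0.
Proof.
move=> ha h; apply/funext => k; apply: sqnorm_eq0.
by apply: le_trans (sqnorm_le_sq k ha) h.
Qed.

End square_summable_sequences.

Section completeness.
Context {R : realType} {n : nat} {I : choiceType}.
Local Notation V := ('cV[R[i]]_n).

Lemma cvg_complex_series (u : nat -> R[i]) (C : R) :
  (forall k, mo (u k) <= C * 2^-1 ^+ k) ->
  exists l : R[i], (\sum_(0 <= k < m) u k) @[m --> \oo] --> l.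
Proof.
move=> hu; have C0 : 0 <= C.
  by apply: le_trans (mo_ge0 (u 0)) _; apply: le_trans (hu 0) _; rewrite expr0 mulr1.
have key (v : nat -> R) : (forall k, `|v k| <= mo (u k)) -> cvgn (series v).
  move=> hv; apply: normed_cvg.
  apply: (@series_le_cvg _ _ (geometric C 2^-1)).
  - by move=> k; rewrite normr_ge0.
  - by move=> k; rewrite mulr_ge0 // exprn_ge0.
  - by move=> k; apply: le_trans (hv k) (hu k).
  - by apply: is_cvg_geometric_series; rewrite ger0_norm //; lra.
have /cvg_ex[/= x hx] := key (fun k => complex.Re (u k)) (fun k => mo_Re _).
have /cvg_ex[/= y hy] := key (fun k => complex.Im (u k)) (fun k => mo_Im _).
exists (x +i* y).
have -> : (fun m => \sum_(0 <= k < m) u k) =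
   (fun m => (fun q : R * R => q.1 +i* q.2 : R[i])
     (series (fun k => complex.Re (u k)) m, series (fun k => complex.Im (u k)) m)).
  apply/funext => m; rewrite /series /=; elim: m => [|m IH].
    by rewrite !big_geq.
  by rewrite !big_nat_recr //= IH; case: (u m).
apply: (@cvg_comp _ _ _ (fun m => (series (fun k => complex.Re (u k)) m,
    series (fun k => complex.Im (u k)) m)) (fun q : R * R => q.1 +i* q.2 : R[i])
    _ (nbhs (x, y))); last exact: (@continuous_complex R (x, y)).
exact: (cvg_pair hx hy).
Qed.

(** Completeness with an explicit rate. By induction the squared norm of a partial sum from m on is
    at most 2 r_m + 8 r_{m+1} <= 4 r_m; the entries converge geometrically, and the bound passes to
    the limit on each finite list of indices. *)
Lemma l2_series (x : nat -> I -> V) (r : nat -> R) :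
  (forall k, l2_le (x k) (r k)) -> (forall k, 16 * r k.+1 <= r k) ->
  exists s, forall m, l2_le (s - \sum_(0 <= k < m) x k) (4 * r m).
Proof.
move=> hx hr.
have r0 k : 0 <= r k by have := hx k [::] isT; rewrite big_nil.
have part m N : l2_le (\sum_(m <= k < m + N) x k) (4 * r m).
  elim: N m => [|N IH] m.
    rewrite addn0 big_geq //; apply: l2_leW (_ : l2_le _ 0); first by rewrite mulr_ge0.
    by have [h <-] := @in_l2_0 R n I; exact: l2_le_sq.
  rewrite big_ltn ?addnS ?ltnS ?leq_addr // -addSn.
  by apply: l2_leW (l2_leD (hx m) (IH m.+1)); have := hr m; have := r0 m; lra.
have rb k : r k <= r 0 * 4^-1 ^+ k ^+ 2.
  elim: k => [|k IH]; first by rewrite expr0 expr1n mulr1.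
  have := hr k; rewrite [4^-1 ^+ k.+1]exprS exprMn; set q := _ ^+ k ^+ 2 in IH *; lra.
have ent k i j : exists l : R[i], (\sum_(0 <= p < m) x p i j k) @[m --> \oo] --> l.
  apply: (@cvg_complex_series _ (Num.sqrt (r 0))) => p.
  rewrite -(@ler_pXn2r _ 2) ?nnegrE ?mo_ge0 ?mulr_ge0 ?sqrtr_ge0 //.
  rewrite exprMn sqr_sqrtr //; apply: le_trans (le_entry_nsq _ _ _) _.
  rewrite -sqnormE; have := hx p [:: i] isT; rewrite big_seq1 => h.
  apply: le_trans h _; apply: le_trans (rb p) _; rewrite ler_wpM2l //.
  apply: lerXn2r; rewrite ?nnegrE ?exprn_ge0 //; apply: lerXn2r; rewrite ?nnegrE //.
  by rewrite lef_pV2 ?posrE // ler_nat.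
pose lim_ k i j := sval (cid (ent k i j)).
exists (fun i => \col_j lim_ 0 i j) => m s us.
have cv : (\sum_(i <- s) sqnorm ((\sum_(0 <= k < N) x k - \sum_(0 <= k < m) x k) i))
    @[N --> \oo] --> \sum_(i <- s) sqnorm (((fun i => \col_j lim_ 0 i j) -
      \sum_(0 <= k < m) x k) i).
  apply: cvg_sumr => i; rewrite sqnormE; under eq_fun do rewrite sqnormE.
  apply: cvg_nsq => j k; rewrite ord1.
  have fE (f g : I -> V) : (f - g) i j 0 = f i j 0 - g i j 0 by rewrite !mxE.
  under eq_fun do rewrite fE.
  rewrite fE mxE; apply: cvgB; last exact: cvg_cst.
  have -> : (fun N => (\sum_(0 <= p < N) x p) i j 0) =
      (fun N => \sum_(0 <= p < N) x p i j 0).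
    by apply/funext => N; rewrite fct_sumE summxE.
  exact: svalP (cid (ent 0 i j)).
have cc : (fun=> 4 * r m) N @[N --> \oo] --> 4 * r m by exact: cvg_cst.
apply: (ler_cvg_to cv cc).
exists m => // N /= mN.
have -> : \sum_(0 <= k < N) x k - \sum_(0 <= k < m) x k = \sum_(m <= k < N) x k.
  by rewrite (@big_cat_nat _ _ _ m) //= addrAC subrr add0r.
by rewrite -(subnKC mN); exact: part.
Qed.

End completeness.

Section open_mapping.
Context {R : realType} {n : nat} {I J : choiceType}.
Local Notation V := ('cV[R[i]]_n).
Variables (A : (J -> V) -> I -> V) (C : R).
Hypothesis A_lin : forall (c : R[i]) a b, in_l2 a -> in_l2 b ->
  A (c *: a + b) = c *: A a + A b.
Hypothesis A_in : forall a, in_l2 a -> in_l2 (A a).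
Hypothesis A_bnd : forall a, in_l2 a -> l2_sq (A a) <= C * l2_sq a.
Hypothesis A_surj : forall b, in_l2 b -> exists2 a, in_l2 a & A a = b.

Lemma opD a b : in_l2 a -> in_l2 b -> A (a + b) = A a + A b.
Proof. by move=> ha hb; have := A_lin 1 ha hb; rewrite !scale1r. Qed.

Lemma op0 : A 0 = 0.
Proof.
have [h0 _] := @in_l2_0 R n J; have := opD h0 h0; rewrite addr0 => /eqP.
by rewrite -{1}[A 0]addr0 (inj_eq (addrI _)) eq_sym => /eqP.
Qed.

Lemma opZ c a : in_l2 a -> A (c *: a) = c *: A a.
Proof.
by move=> ha; have [h0 _] := @in_l2_0 R n J; have := A_lin c ha h0; rewrite op0 !addr0.
Qed.

Lemma opB a b : in_l2 a -> in_l2 b -> A (a - b) = A a - A b.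
Proof.
by move=> ha hb; rewrite -(scaleN1r b) (opD ha (in_l2Z _ hb)) (opZ _ hb) scaleN1r.
Qed.

Lemma op_sum (x : nat -> J -> V) m : (forall k, in_l2 (x k)) ->
  in_l2 (\sum_(0 <= k < m) x k) /\
  A (\sum_(0 <= k < m) x k) = \sum_(0 <= k < m) A (x k).
Proof.
move=> hx; elim: m => [|m [IH1 IH2]].
  by rewrite !big_geq //; split; [have [] := @in_l2_0 R n J | exact: op0].
by rewrite !big_nat_recr //= opD // IH2; split=> //; have [] := l2_sqD IH1 (hx m).
Qed.

(* Baire's argument: otherwise a limit of suitably nested balls would avoid the
   images of all the balls of radius [sqrt k], hence the range of [A]. *)
Lemma range_dense_ball : exists k b0 (r : R), [/\ in_l2 b0, 0 < r &
  forall b, in_l2 b -> l2_sq (b - b0) <= r -> forall e, 0 < e ->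
  exists a, [/\ in_l2 a, l2_sq a <= k%:R & l2_sq (b - A a) <= e]].
Proof.
apply: contrapT => nex.
have step k (q : (I -> V) * R) : in_l2 q.1 -> 0 < q.2 ->
  exists q' : (I -> V) * R, [/\ in_l2 q'.1, 0 < q'.2, l2_sq (q'.1 - q.1) <= q.2,
    16 * q'.2 <= q.2 & forall a, in_l2 a -> l2_sq a <= k%:R ->
      4 * q'.2 < l2_sq (q'.1 - A a)].
  case: q => b0 r /= hb0 r0; apply: contrapT => h; apply: nex.
  exists k, b0, r; split=> // b hb bb e e0; apply: contrapT => h'; apply: h.
  (* By [l2_series] the limit stays within squared distance 4 times the new radius from the new
     center, hence e / 4; the ratio 16 is the decrease which that lemma asks for. *)
  exists (b, Num.min (e / 4) (r / 16)) => /=; split=> //.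
  - by rewrite lt_min !divr_gt0.
  - have : Num.min (e / 4) (r / 16) <= r / 16 by rewrite ge_min lexx orbT.
    lra.
  - move=> a ha ak; rewrite ltNge; apply/negP => h''; apply: h'; exists a; split=> //.
    have : Num.min (e / 4) (r / 16) <= e / 4 by rewrite ge_min lexx.
    lra.
have [z0 _] := @in_l2_0 R n I.
have : {F : nat -> (I -> V) * R | F 0 = (0, 1) /\ forall k,
    (in_l2 (F k).1 /\ 0 < (F k).2) /\
    [/\ in_l2 (F k.+1).1, 0 < (F k.+1).2, l2_sq ((F k.+1).1 - (F k).1) <= (F k).2,
    16 * (F k.+1).2 <= (F k).2 & forall a, in_l2 a -> l2_sq a <= k%:R ->
      4 * (F k.+1).2 < l2_sq ((F k.+1).1 - A a)]}.
  (* Where the invariant fails the recursion stands still; the invariant is then shown to hold at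
     every stage. *)
  pose nxt k q := if pselect (in_l2 q.1 /\ 0 < q.2) is left h
    then sval (cid (step k q h.1 h.2)) else q.
  pose F := fix F k := if k is k'.+1 then nxt k' (F k') else ((0 : I -> V), (1 : R)).
  exists F; split=> // k.
  have nxtP k' q : in_l2 q.1 /\ 0 < q.2 -> let q' := nxt k' q in
    [/\ in_l2 q'.1, 0 < q'.2, l2_sq (q'.1 - q.1) <= q.2,
    16 * q'.2 <= q.2 & forall a, in_l2 a -> l2_sq a <= k'%:R ->
      4 * q'.2 < l2_sq (q'.1 - A a)].
    by move=> h /=; rewrite /nxt; case: pselect => // h'; case: cid.
  suff h : in_l2 (F k).1 /\ 0 < (F k).2 by split=> //; exact: nxtP.
  by elim: k => [//|k /(nxtP k) []].
move=> [F [F0 hF]].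
have inF k : in_l2 (F k).1 by have [[]] := hF k.
pose x k := (F k.+1).1 - (F k).1.
have hx k : l2_le (x k) (F k).2.
  have [_ [_ _ h _ _]] := hF k; apply: l2_leW h _; apply: l2_le_sq.
  by have [] := l2_sqB (inF k.+1) (inF k).
have [s hs] := l2_series hx (fun k => let: conj _ (And5 _ _ _ h _) := hF k in h).
have sumx m : \sum_(0 <= k < m) x k = (F m).1.
  by rewrite telescope_sumr // F0 subr0.
have ins : in_l2 s by have := hs 0; rewrite big_geq // subr0 => /l2_le_in.
have [a ha Aa] := A_surj ins.
have [k ak] : exists k : nat, l2_sq a <= k%:R.
  exists (Num.truncn (l2_sq a)).+1; apply: ltW; exact: truncnS_gt.
have [_ [_ _ _ _ /(_ a ha ak)]] := hF k; rewrite ltNge => /negP; apply.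
have := hs k.+1; rewrite sumx -Aa => h.
have hin : in_l2 (A a - (F k.+1).1) by exact: l2_le_in h.
rewrite -(opprB (A a)); have [_ h1] := l2_sqN hin.
apply: le_trans h1 _; exact: l2_sq_le.
Qed.

(** Approximate b0 + l b and b0, subtract, and divide by l, where l^2 = r / t brings l b into the
    ball. The squared norms of the two approximate preimages combine to at most 4k, and the division
    turns this into 4k t / r. *)
Lemma range_dense_scaled : exists2 K : R, 0 <= K & forall b t, in_l2 b -> 0 < t ->
  l2_sq b <= t -> forall e, 0 < e ->
  exists a, [/\ in_l2 a, l2_sq a <= K * t & l2_sq (b - A a) <= e].
Proof.
have [k [b0 [r [hb0 r0 hr]]]] := range_dense_ball.
exists (4 * k%:R / r); first by rewrite divr_ge0 ?mulr_ge0 // ltW.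
move=> b t hb t0 bt e e0.
pose l := Num.sqrt (r / t); have l2 : l ^+ 2 = r / t by rewrite sqr_sqrtr // divr_ge0 // ltW.
have l0 : l != 0 by rewrite -sqrf_eq0 l2 gt_eqF // divr_gt0.
have mol : mo (l%:C : R[i]) ^+ 2 = r / t.
  by rewrite mo_real ger0_norm ?sqrtr_ge0.
have molV : mo (l%:C^-1 : R[i]) ^+ 2 = t / r by rewrite moV exprVn mol invf_div.
have lC0 : l%:C != 0 :> R[i] by rewrite -mo_gt0 mo_real normr_gt0.
pose e' := e * (r / t) / 4.
have e'0 : 0 < e' by rewrite divr_gt0 // mulr_gt0 // divr_gt0.
have hlb := in_l2Z l%:C hb.
have h1 : l2_sq (b0 + l%:C *: b - b0) <= r.
  rewrite addrAC subrr add0r; apply: le_trans (l2_sqZ _ hb) _.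
  rewrite mol mulrAC ler_pdivrMr //; rewrite ler_wpM2l // ltW //.
have [hs _] := l2_sqD hb0 hlb.
have [a1 [ha1 qa1 q1]] := hr _ hs h1 _ e'0.
have h2 : l2_sq (b0 - b0) <= r.
  by rewrite subrr; have [_ ->] := @in_l2_0 R n I; exact: ltW.
have [a2 [ha2 qa2 q2]] := hr _ hb0 h2 _ e'0.
have [ha qa] := l2_sqB ha1 ha2.
exists (l%:C^-1 *: (a1 - a2)); split; first exact: in_l2Z.
  apply: le_trans (l2_sqZ _ ha) _; rewrite molV.
  rewrite (_ : 4 * k%:R / r * t = t / r * (4 * k%:R)); last by field; rewrite gt_eqF.
  rewrite ler_wpM2l //; first by rewrite divr_ge0 // ltW.
  by apply: le_trans qa _; lra.
rewrite opZ // opB //.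
have hA1 := A_in ha1; have hA2 := A_in ha2.
have -> : b - l%:C^-1 *: (A a1 - A a2) =
   l%:C^-1 *: ((b0 + l%:C *: b - A a1) - (b0 - A a2)).
  apply/funext => p; rewrite !fctE; apply/matrixP => i' j'; rewrite !mxE.
  by field.
have [in1 _] := l2_sqB hs hA1; have [in2 _] := l2_sqB hb0 hA2.
have [in3 q3] := l2_sqB in1 in2.
apply: le_trans (l2_sqZ _ in3) _; rewrite molV.
apply: (@le_trans _ _ (t / r * (4 * e'))).
  by rewrite ler_wpM2l //; [rewrite divr_ge0 // ltW | lra].
by rewrite /e' le_eqVlt; apply/orP; left; apply/eqP; field; rewrite !gt_eqF.
Qed.

(** Successive approximation: [b] is reached up to a sixteenth of its squared norm, then the
    residual likewise, and so on. The rate 16 suits [l2_series], whose constant 4 reappears in the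
    bound; boundedness of [A] identifies the image of the sum. *)
Lemma open_mapping : exists2 K : R, 0 <= K & forall b, in_l2 b ->
  exists a, [/\ in_l2 a, A a = b & l2_sq a <= K * l2_sq b].
Proof.
have [K K0 hK] := range_dense_scaled.
exists (4 * K); first by rewrite mulr_ge0.
move=> b hb; have [b0|] := leP (l2_sq b) 0.
  rewrite (l2_sq_eq0 hb b0); exists 0; have [h1 ->] := @in_l2_0 R n J.
  by split; rewrite ?op0 // mulr_ge0 ?l2_sq_ge0 // mulr_ge0.
set t := l2_sq b => t0.
pose T k : R := t * 16^-1 ^+ k.
have T0 k : 0 < T k by rewrite mulr_gt0 // exprn_gt0.
have TS k : 16 * T k.+1 = T k by rewrite /T exprS; field.
have step k c : in_l2 c -> l2_sq c <= T k -> exists a,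
    [/\ in_l2 a, l2_sq a <= K * T k & l2_sq (c - A a) <= T k.+1].
  by move=> hc hck; exact: hK.
pose F := fix F k := if k is k'.+1 then
   if pselect (in_l2 (F k') /\ l2_sq (F k') <= T k') is left h then
     F k' - A (sval (cid (step k' _ h.1 h.2))) else F k' else b.
pose x k : J -> V := if pselect (in_l2 (F k) /\ l2_sq (F k) <= T k) is left h then
     sval (cid (step k _ h.1 h.2)) else 0.
have FP k : (in_l2 (F k) /\ l2_sq (F k) <= T k) /\
    [/\ in_l2 (x k), l2_sq (x k) <= K * T k & F k.+1 = F k - A (x k)].
  have h k' : in_l2 (F k') /\ l2_sq (F k') <= T k' ->
     [/\ in_l2 (x k'), l2_sq (x k') <= K * T k', F k'.+1 = F k' - A (x k') &
         l2_sq (F k'.+1) <= T k'.+1].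
    by move=> h; rewrite /x /=; case: pselect => // h'; case: cid => a [].
  suff hk : in_l2 (F k) /\ l2_sq (F k) <= T k by split=> //; have [] := h k hk.
  elim: k => [|k IH]; first by rewrite /T expr0 mulr1.
  have [h1 h2 h3 h4] := h k IH; split=> //; rewrite h3.
  by have [] := l2_sqB IH.1 (A_in h1).
have inx k : in_l2 (x k) by have [_ []] := FP k.
have hx k : l2_le (x k) (K * T k).
  by have [_ [h1 h2 _]] := FP k; apply: l2_leW h2 _; exact: l2_le_sq.
have h16 k : 16 * (K * T k.+1) <= K * T k by rewrite mulrCA TS.
have [s hs] := l2_series hx h16.
have ins : in_l2 s by have := hs 0; rewrite big_geq // subr0 => /l2_le_in.
exists s; split=> //; last first.
  have := hs 0; rewrite big_geq // subr0 /T expr0 mulr1 mulrA; exact: l2_sq_le.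
have hAs := A_in ins; have [inD _] := l2_sqB hb hAs.
suff : b - A s = 0 by move=> /eqP; rewrite subr_eq0 eq_sym => /eqP.
apply: l2_sq_eq0 => //; rewrite leNgt; apply/negP => d0.
have Fm m : F m = b - A (\sum_(0 <= k < m) x k).
  have [_ ->] := op_sum m inx; elim: m => [|m IH]; first by rewrite big_geq // subr0.
  by have [_ [_ _ ->]] := FP m; rewrite big_nat_recr //= IH opprD addrA.
have C0 : 0 <= `|C| by [].
have bound m : l2_sq (b - A s) <= (2 + 8 * `|C| * K) * T m.
  have [insum _] := op_sum m inx.
  have [inB _] := l2_sqB ins insum.
  have -> : b - A s = F m - A (s - \sum_(0 <= k < m) x k).
    by rewrite opB // Fm opprB addrA subrK.
  have [[inF qF] _] := FP m.
  have [_ h] := l2_sqB inF (A_in inB); apply: le_trans h _.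
  have h2 : l2_sq (A (s - \sum_(0 <= k < m) x k)) <= `|C| * (4 * (K * T m)).
    apply: le_trans (A_bnd inB) _.
    apply: (@le_trans _ _ (`|C| * l2_sq (s - \sum_(0 <= k < m) x k))).
      by rewrite ler_wpM2r ?l2_sq_ge0 // ler_norm.
    by rewrite ler_wpM2l // l2_sq_le.
  lra.
have : T m @[m --> \oo] --> t * 0.
  by apply: cvgM; [exact: cvg_cst | apply: cvg_expr; rewrite ger0_norm; lra].
rewrite mulr0 => /cvgrPdist_lt.
have M0 : 0 < 2 + 8 * `|C| * K by rewrite ltr_pwDl // mulr_ge0 // mulr_ge0.
move=> /(_ (l2_sq (b - A s) / (2 + 8 * `|C| * K))) [|m _ hm]; first by rewrite divr_gt0.
have := hm m (leqnn m); rewrite /= sub0r normrN gtr0_norm // ltr_pdivlMr //.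
by have := bound m; rewrite mulrC; lra.
Qed.

End open_mapping.

(** * Fourier coefficients on the torus *)

Section torus_mean.
Context {R : realType}.
Implicit Types (F G : R * R -> R[i]) (H : R * R -> R).

Local Notation mu := (@angle_measure R).

Lemma measurable_angles : measurable (@angles R).
Proof. by apply: measurableX; exact: measurable_itv. Qed.

Lemma two_pi_gt0 : 0 < 2 * pi :> R.
Proof. by rewrite mulr_gt0 // pi_gt0. Qed.

Lemma angle_measureE : mu angles = ((2 * pi) ^+ 2)%:E.
Proof.
have L : @lebesgue_measure R `[0, 2 * pi]%classic = (2 * pi)%:E.
  by rewrite lebesgue_measure_itv /= lte_fin two_pi_gt0 -EFinB subr0.
rewrite /angle_measure /angles product_measure1E; try exact: measurable_itv.
rewrite expr2 EFinM; congr (_ * _)%E; exact: L.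
Qed.

Definition bounded_measurable H : Prop :=
  measurable_fun angles H /\ exists M : R, forall t, angles t -> `|H t| <= M.

Lemma bounded_measurable_integrable H :
  bounded_measurable H -> mu.-integrable angles (EFin \o H).
Proof.
move=> [mH [M bH]]; apply: measurable_bounded_integrable => //.
- exact: measurable_angles.
- rewrite [X in (X < _)%E](_ : _ = ((2 * pi) ^+ 2)%:E) ?ltry //.
  exact: angle_measureE.
- by exists M; split; [exact: num_real | move=> N MN t /bH h; exact: le_trans h (ltW MN)].
Qed.

Lemma bounded_measurableZ (r : R) H :
  bounded_measurable H -> bounded_measurable (fun t => r * H t).
Proof.
move=> [mH [M hM]]; split.
  by apply: (measurable_funM (f := cst r)) => //; exact: measurable_cst.
by exists (`|r| * M) => t /hM; rewrite normrM; apply: ler_wpM2l.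
Qed.

Definition torus_bounded F : Prop :=
  [/\ measurable_fun angles (fun t => complex.Re (F t)),
      measurable_fun angles (fun t => complex.Im (F t)) &
      exists M : R, forall t, angles t -> mo (F t) <= M].

Lemma torus_bounded_Re F : torus_bounded F ->
  bounded_measurable (fun t => complex.Re (F t)).
Proof.
move=> [mr _ [M hM]]; split=> //; exists M => t /hM; apply: le_trans.
exact: mo_Re.
Qed.

Lemma torus_bounded_Im F : torus_bounded F ->
  bounded_measurable (fun t => complex.Im (F t)).
Proof.
move=> [_ mi [M hM]]; split=> //; exists M => t /hM; apply: le_trans.
exact: mo_Im.
Qed.

Lemma torus_bounded_eq F G : (forall t, angles t -> F t = G t) ->
  torus_bounded F -> torus_bounded G.
Proof.
move=> FG [mr mi [M hM]]; split.
- by apply: eq_measurable_fun mr => t; rewrite inE => /FG ->.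
- by apply: eq_measurable_fun mi => t; rewrite inE => /FG ->.
- by exists M => t At; rewrite -FG // hM.
Qed.

Lemma torus_bounded_cst (c : R[i]) : torus_bounded (fun=> c).
Proof.
by split; [exact: measurable_cst | exact: measurable_cst | exists (mo c)].
Qed.

Lemma torus_boundedD F G : torus_bounded F -> torus_bounded G ->
  torus_bounded (fun t => F t + G t).
Proof.
move=> [mr mi [M hM]] [mr' mi' [M' hM']]; split.
- have -> : (fun t => complex.Re (F t + G t)) =
    (fun t => complex.Re (F t)) \+ (fun t => complex.Re (G t)).
    by apply/funext => t /=; case: (F t); case: (G t).
  exact: measurable_funD.
- have -> : (fun t => complex.Im (F t + G t)) =
    (fun t => complex.Im (F t)) \+ (fun t => complex.Im (G t)).
    by apply/funext => t /=; case: (F t); case: (G t).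
  exact: measurable_funD.
- exists (M + M') => t At; apply: le_trans (moD _ _) _.
  by rewrite lerD ?hM ?hM'.
Qed.

Lemma torus_boundedM F G : torus_bounded F -> torus_bounded G ->
  torus_bounded (fun t => F t * G t).
Proof.
move=> [mr mi [M hM]] [mr' mi' [M' hM']]; split.
- have -> : (fun t => complex.Re (F t * G t)) =
    ((fun t => complex.Re (F t)) \* (fun t => complex.Re (G t))) \-
    ((fun t => complex.Im (F t)) \* (fun t => complex.Im (G t))).
    by apply/funext => t /=; case: (F t); case: (G t).
  by apply: measurable_funB; exact: measurable_funM.
- have -> : (fun t => complex.Im (F t * G t)) =
    ((fun t => complex.Re (F t)) \* (fun t => complex.Im (G t))) \+
    ((fun t => complex.Im (F t)) \* (fun t => complex.Re (G t))).
    by apply/funext => t /=; case: (F t) => a b; case: (G t) => c d /=.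
  by apply: measurable_funD; exact: measurable_funM.
- exists (M * M') => t At; rewrite moM.
  by rewrite ler_pM ?mo_ge0 ?hM ?hM'.
Qed.

Lemma torus_bounded_conj F : torus_bounded F -> torus_bounded (fun t => (F t)^*).
Proof.
move=> [mr mi [M hM]]; split.
- have -> // : (fun t => complex.Re (F t)^*) = (fun t => complex.Re (F t)).
  by apply/funext => t; rewrite -conjcE; case: (F t).
- have -> : (fun t => complex.Im (F t)^*) = \- (fun t => complex.Im (F t)).
    by apply/funext => t; rewrite -conjcE /=; case: (F t).
  exact: measurable_funN.
- by exists M => t /hM; rewrite mo_conj.
Qed.

Lemma torus_boundedN F : torus_bounded F -> torus_bounded (fun t => - F t).
Proof.
move=> hF; apply: torus_bounded_eq (torus_boundedM (torus_bounded_cst (-1)) hF).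
by move=> t _; rewrite mulN1r.
Qed.

Lemma torus_boundedB F G : torus_bounded F -> torus_bounded G ->
  torus_bounded (fun t => F t - G t).
Proof. by move=> hF hG; exact: (torus_boundedD hF (torus_boundedN hG)). Qed.

Lemma torus_bounded_sum (I : Type) (r : seq I) (F : I -> R * R -> R[i]) :
  (forall i, torus_bounded (F i)) -> torus_bounded (fun t => \sum_(i <- r) F i t).
Proof.
move=> hF; elim: r => [|i r IH].
  by under eq_fun do rewrite big_nil; exact: torus_bounded_cst.
by under eq_fun do rewrite big_cons; exact: (torus_boundedD (hF i) IH).
Qed.

Lemma torus_boundedX F k : torus_bounded F -> torus_bounded (fun t => F t ^+ k).
Proof.
move=> hF; elim: k => [|k IH].
  by under eq_fun do rewrite expr0; exact: torus_bounded_cst.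
by under eq_fun do rewrite exprS; exact: (torus_boundedM hF IH).
Qed.

Lemma torus_bounded_real H : bounded_measurable H -> torus_bounded (fun t => (H t)%:C).
Proof.
move=> [mH [M hM]]; split; [exact: mH | exact: (measurable_cst (0 : R)) | ].
by exists M => t /hM; rewrite mo_real.
Qed.

Lemma torus_boundedV F (c : R) : 0 < c -> (forall t, angles t -> c <= mo (F t)) ->
  torus_bounded F -> torus_bounded (fun t => (F t)^-1).
Proof.
move=> c0 hc hF.
(* As 1 / F = conj F / |F|^2, only a positive real function has to be inverted measurably. *)
pose H t := (complex.Re (F t) ^+ 2 + complex.Im (F t) ^+ 2)^-1.
have HE t : angles t -> H t = (mo (F t) ^+ 2)^-1 by rewrite /H mo_sqr.
have hH : bounded_measurable H.
  split.
    apply: (@measurable_comp _ _ _ _ _ _ (`]0, +oo[%classic : set R) (fun x : R => x^-1)).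
    - exact: measurable_itv.
    - move=> _ [t At <-] /=; rewrite in_itv /= andbT -mo_sqr exprn_gt0 //.
      exact: lt_le_trans (hc t At).
    - apply: open_continuous_measurable_fun; first exact: interval_open.
      by move=> x; rewrite inE /= in_itv /= andbT => x0; apply: inv_continuous; rewrite gt_eqF.
    - have [mr mi _] := hF; apply: measurable_funD; apply: measurable_funX; exact: mr || exact: mi.
  exists (c ^+ 2)^-1 => t At; rewrite HE // ger0_norm ?invr_ge0 ?sqr_ge0 //.
  have mF : 0 < mo (F t) by exact: lt_le_trans (hc t At).
  by rewrite lef_pV2 ?posrE ?exprn_gt0 // ler_pXn2r ?nnegrE ?hc // ltW.
apply: torus_bounded_eq (torus_boundedM (torus_bounded_conj hF) (torus_bounded_real hH)).
move=> t At; rewrite (HE _ At).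
have -> : (mo (F t) ^- 2)%:C = ((mo (F t) ^+ 2)%:C)^-1 :> R[i] by exact: fmorphV.
rewrite -mulzJ.
have F0 : F t != 0 by rewrite -mo_gt0; exact: lt_le_trans (hc t At).
by rewrite invfM mulrCA mulfV ?mulr1 // conjC_eq0.
Qed.

Lemma measurable_angle_comp (f : R -> R) : continuous f ->
  measurable_fun angles (fun t : R * R => f t.1) /\
  measurable_fun angles (fun t : R * R => f t.2).
Proof.
move=> cf; have mf : measurable_fun setT f by exact: continuous_measurable_fun.
split; apply: (@measurable_funTS).
- by apply: (measurableT_comp mf); exact: measurable_fst.
- by apply: (measurableT_comp mf); exact: measurable_snd.
Qed.

Lemma torus_bounded_expi1 : torus_bounded (fun t => expi t.1).
Proof.
split.
- exact: (measurable_angle_comp (@continuous_cos R)).1.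
- exact: (measurable_angle_comp (@continuous_sin R)).1.
- by exists 1 => t _; rewrite mo_expi.
Qed.

Lemma torus_bounded_expi2 : torus_bounded (fun t => expi t.2).
Proof.
split.
- exact: (measurable_angle_comp (@continuous_cos R)).2.
- exact: (measurable_angle_comp (@continuous_sin R)).2.
- by exists 1 => t _; rewrite mo_expi.
Qed.

Definition torus_mean F : R[i] := ((2 * pi) ^- 2)%:C * cintegral F.

Lemma torus_mean_eq F G : (forall t, angles t -> F t = G t) ->
  torus_mean F = torus_mean G.
Proof.
move=> FG; congr (_ * (_ +i* _)); apply: eq_Rintegral => t; rewrite inE => At.
  by rewrite FG.
by rewrite FG.
Qed.

Lemma torus_meanD F G : torus_bounded F -> torus_bounded G ->
  torus_mean (fun t => F t + G t) = torus_mean F + torus_mean G.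
Proof.
move=> hF hG; rewrite /torus_mean -mulrDr; congr (_ * _).
rewrite /cintegral [RHS]/GRing.add /=; congr (_ +i* _).
- rewrite -RintegralD; [|exact: measurable_angles|
    exact/bounded_measurable_integrable/torus_bounded_Re|
    exact/bounded_measurable_integrable/torus_bounded_Re].
  by apply: eq_Rintegral => t _; case: (F t); case: (G t).
- rewrite -RintegralD; [|exact: measurable_angles|
    exact/bounded_measurable_integrable/torus_bounded_Im|
    exact/bounded_measurable_integrable/torus_bounded_Im].
  by apply: eq_Rintegral => t _; case: (F t); case: (G t).
Qed.

Lemma torus_meanZ (c : R[i]) F : torus_bounded F ->
  torus_mean (fun t => c * F t) = c * torus_mean F.
Proof.
move=> hF; rewrite /torus_mean mulrCA; congr (_ * _).
have iR := bounded_measurable_integrable (torus_bounded_Re hF).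
have iI := bounded_measurable_integrable (torus_bounded_Im hF).
have mA := measurable_angles.
have iRZ r : mu.-integrable angles (EFin \o (fun t => r * complex.Re (F t))).
  exact/bounded_measurable_integrable/bounded_measurableZ/torus_bounded_Re.
have iIZ r : mu.-integrable angles (EFin \o (fun t => r * complex.Im (F t))).
  exact/bounded_measurable_integrable/bounded_measurableZ/torus_bounded_Im.
case: c => a b; rewrite /cintegral [RHS]/GRing.mul /=; congr (_ +i* _).
- rewrite -!RintegralZl // -RintegralB //.
  by apply: eq_Rintegral => t _; case: (F t).
- rewrite -!RintegralZl // -RintegralD //.
  by apply: eq_Rintegral => t _; case: (F t).
Qed.

Lemma torus_mean_conj F : torus_bounded F ->
  torus_mean (fun t => (F t)^*) = (torus_mean F)^*.
Proof.
move=> hF; rewrite /torus_mean conjM; congr (_ * _).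
  by rewrite -conjcE conjc_real.
have mA := measurable_angles.
have iI := bounded_measurable_integrable (torus_bounded_Im hF).
rewrite -conjcE /cintegral /=; congr (_ +i* _).
- by apply: eq_Rintegral => t _; rewrite -conjcE; case: (F t).
- rewrite -mulN1r -RintegralZl //.
  by apply: eq_Rintegral => t _; rewrite -conjcE /= mulN1r; case: (F t).
Qed.

Lemma torus_mean_sum (I : Type) (r : seq I) (F : I -> R * R -> R[i]) :
  (forall i, torus_bounded (F i)) ->
  torus_mean (fun t => \sum_(i <- r) F i t) = \sum_(i <- r) torus_mean (F i).
Proof.
move=> hF; elim: r => [|i r IH].
  rewrite big_nil; under eq_fun do rewrite big_nil.
  have Z := torus_meanZ 0 (torus_bounded_cst 0).
  rewrite [LHS](_ : _ = torus_mean (fun t : R * R => 0 * 0)).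
    exact: etrans Z (mul0r _).
  by congr torus_mean; apply/funext => t; rewrite mul0r.
rewrite big_cons -IH -torus_meanD //; last exact: torus_bounded_sum.
by congr torus_mean; apply/funext => t; rewrite big_cons.
Qed.

Lemma torus_mean1 : torus_mean (fun=> 1) = 1.
Proof.
rewrite /torus_mean /cintegral !Rintegral_cst; try exact: measurable_angles.
have E : fine (mu angles) = (2 * pi) ^+ 2 by rewrite angle_measureE.
rewrite -/mu E /= mul1r mul0r -[_ +i* 0]/(_%:C) -rmorphM mulVf //.
by rewrite expf_neq0 // gt_eqF // two_pi_gt0.
Qed.

Lemma torus_mean_real H (M : R) : bounded_measurable H ->
  (forall t, angles t -> 0 <= H t <= M) ->
  exists2 r : R, 0 <= r <= M & torus_mean (fun t => (H t)%:C) = r%:C.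
Proof.
move=> hH b; have mA := measurable_angles.
have iH := bounded_measurable_integrable hH.
exists ((2 * pi) ^- 2 * Rintegral mu angles H); last first.
  rewrite /torus_mean /cintegral /= Rintegral_cst // mul0r -[_ +i* 0]/(_%:C).
  by rewrite -rmorphM.
have p0 : 0 < (2 * pi) ^- 2 :> R by rewrite invr_gt0 exprn_gt0 // two_pi_gt0.
rewrite mulr_ge0 /=; first last.
- by apply: Rintegral_ge0 => t /b /andP[].
- exact: ltW.
rewrite -ler_pdivlMl // invrK mulrC.
have E : fine (mu angles) = (2 * pi) ^+ 2 by rewrite angle_measureE.
rewrite -E -Rintegral_cst //; apply: le_Rintegral => //.
  apply: (@bounded_measurable_integrable (fun=> M)); split; first exact: measurable_cst.
  by exists `|M|.
by move=> t /b /andP[].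
Qed.

End torus_mean.

(** * Orthogonality of monomials and Bessel's inequality *)

Section orthogonality.
Context {R : realType}.
Local Notation mu := (@angle_measure R).
Local Notation leb := (@lebesgue_measure R).
Local Notation itv := (`[0, 2 * pi]%classic : set R).

Lemma expi_int (a : int) (t : R) : expi t ^ a = expi (a%:~R * t).
Proof.
have E (k : nat) : expi t ^+ k = expi (k%:R * t).
  elim: k => [|k IH]; first by rewrite expr0 mul0r expi0.
  by rewrite exprS IH -expiD -{1}(mul1r t) -mulrDl nat1r.
case: a => k; first by rewrite -exprnP E.
by rewrite NegzE -exprnN E -expiN rmorphN mulNr.
Qed.

Lemma integral_cos_period (k c : R) : k != 0 -> sin (c + k * (2 * pi)) = sin c ->
  (\int[leb]_(t in itv) (cos (c + k * t))%:E = 0)%E.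
Proof.
move=> k0 per; pose F t := sin (c + k * t) / k.
have dF (t : R) : is_derive t (1 : R) F (cos (c + k * t)).
  rewrite /F; apply: is_derive_eq.
  by rewrite !scaler0 !add0r mul1r [k *: 1]mulr1 /GRing.scale /=; field.
have cF : continuous F.
  move=> t; apply: differentiable_continuous; apply/derivable1_diffP.
  by have [] := dF t.
rewrite (@continuous_FTC2 _ (fun t => cos (c + k * t)) F 0 (2 * pi)).
- by rewrite /F per mulr0 addr0 -EFinB subrr.
- exact: two_pi_gt0.
- apply: continuous_subspaceT => t; apply: differentiable_continuous.
  apply/derivable1_diffP; apply: ex_derive.
- split.
  + by move=> t _; have [] := dF t.
  + by apply: cvg_at_right_filter; exact: cF.
  + by apply: cvg_at_left_filter; exact: cF.
- by move=> t _; rewrite derive1E; apply: derive_val.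
Qed.

Lemma Rintegral_angles12_eq0 (G : R * R -> R) : bounded_measurable G ->
  (forall s, itv s -> (\int[leb]_(t in itv) (G (s, t))%:E = 0)%E) ->
  Rintegral mu angles G = 0.
Proof.
move=> hG hz; rewrite /Rintegral integral_mkcond.
have iG : mu.-integrable setT ((EFin \o G) \_ angles).
  apply/(@integrable_mkcond _ _ _ mu angles); first exact: measurable_angles.
  exact: bounded_measurable_integrable.
rewrite -(@integral12_prod_meas1 _ _ _ _ _ leb leb _ iG) integral0_eq // => s _.
rewrite /fubini_F; have [hs|ns] := pselect (itv s).
  rewrite -[RHS](hz s hs) [RHS]integral_mkcond; apply: eq_integral => t _.
  rewrite /patch; case: ifPn => h1; case: ifPn => h2 //.
    by move: h1 h2; rewrite inE notin_setE => -[_ h] /(_ h).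
  by move: h1 h2; rewrite notin_setE inE => h1 h2; case: h1; split.
apply: integral0_eq => t _; rewrite /patch; case: ifPn => //.
by rewrite inE => -[].
Qed.

Lemma Rintegral_angles21_eq0 (G : R * R -> R) : bounded_measurable G ->
  (forall t, itv t -> (\int[leb]_(s in itv) (G (s, t))%:E = 0)%E) ->
  Rintegral mu angles G = 0.
Proof.
move=> hG hz; rewrite /Rintegral integral_mkcond.
have iG : mu.-integrable setT ((EFin \o G) \_ angles).
  apply/(@integrable_mkcond _ _ _ mu angles); first exact: measurable_angles.
  exact: bounded_measurable_integrable.
rewrite -(@integral21_prod_meas1 _ _ _ _ _ leb leb _ iG) integral0_eq // => t _.
rewrite /fubini_G; have [ht|nt] := pselect (itv t).
  rewrite -[RHS](hz t ht) [RHS]integral_mkcond; apply: eq_integral => s _.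
  rewrite /patch; case: ifPn => h1; case: ifPn => h2 //.
    by move: h1 h2; rewrite inE notin_setE => -[h _] /(_ h).
  by move: h1 h2; rewrite notin_setE inE => h1 h2; case: h1; split.
apply: integral0_eq => s _; rewrite /patch; case: ifPn => //.
by rewrite inE => -[].
Qed.

Definition monomial (k : int * int) (t : R * R) : R[i] :=
  expi t.1 ^ k.1 * expi t.2 ^ k.2.

Lemma monomialE k t : monomial k t = expi (k.1%:~R * t.1 + k.2%:~R * t.2).
Proof. by rewrite /monomial !expi_int expiD. Qed.


Lemma monomialD k l t : monomial k t * monomial l t = monomial (k.1 + l.1, k.2 + l.2) t.
Proof. by rewrite !monomialE -expiD /= !rmorphD /=; congr expi; ring. Qed.

Lemma monomial_conj k t : (monomial k t)^* = monomial (- k.1, - k.2) t.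
Proof. by rewrite !monomialE expi_conj /= !rmorphN /=; congr expi; ring. Qed.

Lemma torus_bounded_monomial k : torus_bounded (monomial k).
Proof.
have h1 (F : R * R -> R) (a : int) : torus_bounded (fun t => expi (F t)) ->
    torus_bounded (fun t => expi (F t) ^ a).
  case: a => m hF; first exact: torus_boundedX.
  apply: torus_bounded_eq (torus_boundedX m.+1 (torus_bounded_conj hF)) => t _.
  by rewrite NegzE -exprnN expi_conj expiN exprVn.
exact: (torus_boundedM (h1 _ _ torus_bounded_expi1) (h1 _ _ torus_bounded_expi2)).
Qed.

Lemma torus_mean_monomial k : torus_mean (monomial k) = (k == (0, 0))%:R.
Proof.
have [->|k0] := eqVneq k (0, 0).
  rewrite -torus_mean1; apply: torus_mean_eq => t _.
  by rewrite /monomial /= !expr0z mulr1.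
have hk := torus_bounded_monomial k.
have per (c : R) (a : int) : sin (c + a%:~R * (2 * pi)) = sin c.
  have E : expi (c + a%:~R * (2 * pi)) = expi c :> R[i].
    by rewrite expiD -expi_int expi2pi exp1rz mulr1.
  by move: E => [_].
(* A phase shift turns imaginary parts into cosines, so that [integral_cos_period] covers both
   parts. *)
have sinE (x : R) : sin x = cos (- (pi / 2) + x).
  by rewrite cosD cosN sinN cos_pihalf sin_pihalf; ring.
suff [h1 h2] : Rintegral mu angles (fun t => complex.Re (monomial k t)) = 0 /\
    Rintegral mu angles (fun t => complex.Im (monomial k t)) = 0.
  by rewrite /torus_mean /cintegral h1 h2 mulr0.
(* The inner integral of Fubini's theorem is taken over an angle with nonzero exponent. *)
have [k2|k2] := eqVneq k.2 0.
  have k1 : k.1%:~R != 0 :> R.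
    rewrite intr_eq0; apply: contraNneq k0 => k1.
    by rewrite [k]surjective_pairing k1 k2.
  split; apply: Rintegral_angles21_eq0.
  - exact: torus_bounded_Re.
  - move=> t _; under eq_integral do rewrite monomialE /= addrC.
    exact: integral_cos_period.
  - exact: torus_bounded_Im.
  - move=> t _; under eq_integral do rewrite monomialE /= [X in sin X]addrC sinE addrA.
    exact: integral_cos_period.
have {}k2 : k.2%:~R != 0 :> R by rewrite intr_eq0.
split; apply: Rintegral_angles12_eq0.
- exact: torus_bounded_Re.
- move=> s _; under eq_integral do rewrite monomialE /=.
  exact: integral_cos_period.
- exact: torus_bounded_Im.
- move=> s _; under eq_integral do rewrite monomialE /= sinE addrA.
  exact: integral_cos_period.
Qed.

Definition coefficient (F : R * R -> R[i]) (k : int * int) : R[i] :=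
  torus_mean (fun t => monomial (- k.1, - k.2) t * F t).

Lemma coefficient_monomial k l : coefficient (monomial l) k = (k == l)%:R.
Proof.
rewrite /coefficient; under eq_fun do rewrite monomialD /=.
rewrite torus_mean_monomial; congr (_%:R); case: k l => a b [c d].
by rewrite !xpair_eqE ![- _ + _]addrC !subr_eq0 eq_sym (eq_sym d).
Qed.

Lemma coefficientD F G k : torus_bounded F -> torus_bounded G ->
  coefficient (fun t => F t + G t) k = coefficient F k + coefficient G k.
Proof.
move=> hF hG; rewrite /coefficient -torus_meanD.
- by under eq_fun do rewrite mulrDr.
- by apply: torus_boundedM => //; exact: torus_bounded_monomial.
- by apply: torus_boundedM => //; exact: torus_bounded_monomial.
Qed.

Lemma coefficientZ c F k : torus_bounded F ->
  coefficient (fun t => c * F t) k = c * coefficient F k.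
Proof.
move=> hF; rewrite /coefficient -torus_meanZ.
  by under eq_fun do rewrite mulrCA.
by apply: torus_boundedM => //; exact: torus_bounded_monomial.
Qed.

Lemma coefficient_sum (I : Type) (r : seq I) (F : I -> R * R -> R[i]) k :
  (forall i, torus_bounded (F i)) ->
  coefficient (fun t => \sum_(i <- r) F i t) k = \sum_(i <- r) coefficient (F i) k.
Proof.
move=> hF; rewrite /coefficient -torus_mean_sum.
  by under eq_fun do rewrite mulr_sumr.
by move=> i; apply: torus_boundedM => //; exact: torus_bounded_monomial.
Qed.

Lemma bounded_measurable_sqr (F : R * R -> R[i]) : torus_bounded F ->
  bounded_measurable (fun t => mo (F t) ^+ 2).
Proof.
move=> hF; have [h _ [M hM]] := torus_boundedM hF (torus_bounded_conj hF).
have E t : complex.Re (F t * (F t)^*) = mo (F t) ^+ 2 by rewrite mulzJ.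
split; first by apply: eq_measurable_fun h => t _; rewrite E.
exists M => t /hM; rewrite mulzJ mo_real; exact.
Qed.

Lemma conj_sum (I : Type) (r : seq I) (f : I -> R[i]) :
  (\sum_(i <- r) f i)^* = \sum_(i <- r) (f i)^*.
Proof. exact: rmorph_sum. Qed.

(** With P the partial Fourier sum over [s], the mean of |F - P|^2 is nonnegative and expands to the
    difference of the two sides. *)
Lemma bessel F (s : seq (int * int)) : torus_bounded F -> uniq s ->
  ((\sum_(k <- s) mo (coefficient F k) ^+ 2)%:C <=
   torus_mean (fun t => (mo (F t) ^+ 2)%:C))%R.
Proof.
move=> hF us; pose c k := coefficient F k.
pose P t := \sum_(k <- s) c k * monomial k t.
have hm k : torus_bounded (fun t => c k * monomial k t).
  exact: torus_boundedM (torus_bounded_cst _) (torus_bounded_monomial _).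
have hP : torus_bounded P by exact: torus_bounded_sum.
have hD := torus_boundedB hF hP.
have hFc := torus_bounded_conj hF; have hPc := torus_bounded_conj hP.
have [r /andP[r0 _] rE] : exists2 r : R, 0 <= r <= (sval (cid (let: And3 _ _ h := hD in h))) ^+ 2 &
    torus_mean (fun t => (mo (F t - P t) ^+ 2)%:C) = r%:C.
  apply: torus_mean_real; first exact: bounded_measurable_sqr.
  move=> t At; rewrite sqr_ge0 /=; case: cid => M hM /=.
  by rewrite lerXn2r ?nnegrE ?mo_ge0 ?hM // (le_trans (mo_ge0 _) (hM t At)).
have cPF : torus_mean (fun t => (P t)^* * F t) = (\sum_(k <- s) mo (c k) ^+ 2)%:C.
  have -> : (fun t => (P t)^* * F t) = fun t =>
      \sum_(k <- s) (c k)^* * (monomial (- k.1, - k.2) t * F t).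
    apply/funext => t; rewrite /P conj_sum mulr_suml; apply: eq_bigr => k _.
    by rewrite conjM monomial_conj [RHS]mulrA.
  rewrite torus_mean_sum => [|k]; last first.
    apply: torus_boundedM (torus_bounded_cst _) _.
    exact: torus_boundedM (torus_bounded_monomial _) hF.
  rewrite rmorph_sum; apply: eq_bigr => k _ /=.
  rewrite torus_meanZ; last exact: torus_boundedM (torus_bounded_monomial _) hF.
  by rewrite -/(coefficient F k) -/(c k) mulrC mulzJ.
have cPP : torus_mean (fun t => (P t)^* * P t) = (\sum_(k <- s) mo (c k) ^+ 2)%:C.
  have -> : (fun t => (P t)^* * P t) = fun t =>
      \sum_(k <- s) (c k)^* * (monomial (- k.1, - k.2) t * P t).
    apply/funext => t; rewrite {1}/P conj_sum mulr_suml; apply: eq_bigr => k _.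
    by rewrite conjM monomial_conj [RHS]mulrA.
  rewrite torus_mean_sum => [|k]; last first.
    apply: torus_boundedM (torus_bounded_cst _) _.
    exact: torus_boundedM (torus_bounded_monomial _) hP.
  rewrite rmorph_sum big_seq [RHS]big_seq; apply: eq_bigr => k ks /=.
  rewrite torus_meanZ; last exact: torus_boundedM (torus_bounded_monomial _) hP.
  rewrite -/(coefficient P k) /P coefficient_sum //.
  rewrite (bigD1_seq k) //= big1 ?addr0 => [|l lk]; last first.
    rewrite coefficientZ ?coefficient_monomial; last exact: torus_bounded_monomial.
    by rewrite eq_sym (negbTE lk) mulr0.
  rewrite coefficientZ ?coefficient_monomial ?eqxx; last exact: torus_bounded_monomial.
  by rewrite mulr1 mulrC mulzJ.
have cFP : torus_mean (fun t => (F t)^* * P t) = (\sum_(k <- s) mo (c k) ^+ 2)%:C.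
  have -> : (fun t => (F t)^* * P t) = fun t => ((P t)^* * F t)^*.
    by apply/funext => t; rewrite conjM conjK mulrC.
  by rewrite torus_mean_conj ?cPF -?conjcE ?conjc_real //; exact: torus_boundedM.
have eqn : r%:C = torus_mean (fun t => (mo (F t) ^+ 2)%:C) -
    (\sum_(k <- s) mo (c k) ^+ 2)%:C.
  rewrite -rE.
  have -> : (fun t => (mo (F t - P t) ^+ 2)%:C) = fun t : R * R => ((mo (F t) ^+ 2)%:C
     + (-1) * ((P t)^* * F t)) + ((-1) * ((F t)^* * P t) + (P t)^* * P t).
    apply/funext => t; rewrite -!mulzJ conjB; ring.
  have bR : torus_bounded (fun t => (mo (F t) ^+ 2)%:C).
    by apply: torus_bounded_real; exact: bounded_measurable_sqr.
  have b1 := torus_boundedM hPc hF; have b2 := torus_boundedM hFc hP.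
  have b3 := torus_boundedM hPc hP.
  have b1' := torus_boundedM (torus_bounded_cst (-1)) b1.
  have b2' := torus_boundedM (torus_bounded_cst (-1)) b2.
  rewrite (torus_meanD (torus_boundedD bR b1') (torus_boundedD b2' b3)).
  rewrite (torus_meanD bR b1') (torus_meanD b2' b3) !torus_meanZ // cPF cFP cPP.
  by ring.
by rewrite -subr_ge0 -eqn (lecR 0).
Qed.

End orthogonality.

(** * Toeplitz operators on trigonometric polynomials *)

Section laurent_functions.
Context {R : realType} {n : nat}.
Local Notation V := ('cV[R[i]]_n).
Local Notation laurent_list := (seq ((int * int) * V)).
Implicit Types (f : R[i] -> R[i] -> 'M[R[i]]_n) (g E : R[i] -> R[i] -> V)
  (L : laurent_list).

(** Trigonometric polynomials are lists of exponents with vector coefficients. An exponent may occur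
    repeatedly; its coefficients then add up. *)
Definition laurent L (z w : R[i]) : V := \sum_(x <- L) (z ^ x.1.1 * w ^ x.1.2) *: x.2.

Definition torus_bounded_col g : Prop :=
  forall i, torus_bounded (fun t => g (expi t.1) (expi t.2) i 0).

Lemma fourierE g k i : fourier g k i 0 =
  coefficient (fun t => g (expi t.1) (expi t.2) i 0) k.
Proof. by rewrite mxE. Qed.

Lemma bounded_measurable_nsq g : torus_bounded_col g ->
  bounded_measurable (fun t => nsq (g (expi t.1) (expi t.2))).
Proof.
move=> hg; pose F t : R[i] := \sum_i g (expi t.1) (expi t.2) i 0 *
  (g (expi t.1) (expi t.2) i 0)^*.
have hF : torus_bounded F.
  apply: torus_bounded_sum => i.
  exact: (torus_boundedM (hg i) (torus_bounded_conj (hg i))).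
have E t : F t = (nsq (g (expi t.1) (expi t.2)))%:C.
  rewrite /F /nsq rmorph_sum; apply: eq_bigr => i _.
  by rewrite mulzJ big_ord_recl big_ord0 addr0.
have [h1 h2] := torus_bounded_Re hF.
split; first by apply: eq_measurable_fun h1 => t _; rewrite E.
by case: h2 => M h2; exists M => t /h2; rewrite E.
Qed.

Lemma fourier_small E (eta : R) : torus_bounded_col E ->
  (forall z w, circle z -> circle w -> nsq (E z w) <= eta) ->
  l2_le (fourier E) eta.
Proof.
move=> hE bE s us; rewrite -lecR.
have [r /andP[r0 re] rE] : exists2 r : R, 0 <= r <= eta &
    torus_mean (fun t => (nsq (E (expi t.1) (expi t.2)))%:C) = r%:C.
  apply: torus_mean_real; first exact: bounded_measurable_nsq.
  by move=> t _; rewrite nsq_ge0 bE //; exact: circle_expi.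
apply: (@le_trans _ _ r%:C); last by rewrite lecR.
have -> : \sum_(k <- s) sqnorm (fourier E k) =
   \sum_i \sum_(k <- s) mo (coefficient (fun t => E (expi t.1) (expi t.2) i 0) k) ^+ 2.
  rewrite [RHS]exchange_big /=; apply: eq_bigr => k _; rewrite sqnormE /nsq.
  by apply: eq_bigr => i _; rewrite big_ord_recl big_ord0 addr0 fourierE.
rewrite -rE.
have -> : (fun t => (nsq (E (expi t.1) (expi t.2)))%:C) =
   (fun t => \sum_i (mo (E (expi t.1) (expi t.2) i 0) ^+ 2)%:C : R[i]).
  apply/funext => t; rewrite /nsq rmorph_sum; apply: eq_bigr => i _.
  by rewrite big_ord_recl big_ord0 addr0.
rewrite torus_mean_sum => [|i]; last first.
  by apply: torus_bounded_real; exact: (bounded_measurable_sqr (hE i)).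
rewrite rmorph_sum; apply: ler_sum => i _; exact: bessel.
Qed.

Lemma laurent_entry L z w i : laurent L z w i 0 =
  \sum_(x <- L) x.2 i 0 * (z ^ x.1.1 * w ^ x.1.2).
Proof. by rewrite summxE; apply: eq_bigr => x _; rewrite mxE mulrC. Qed.

Lemma torus_bounded_laurent L : torus_bounded_col (laurent L).
Proof.
move=> i; under eq_fun do rewrite laurent_entry.
apply: torus_bounded_sum => x.
exact: torus_boundedM (torus_bounded_cst _) (torus_bounded_monomial x.1).
Qed.

Lemma fourier_laurent L k : fourier (laurent L) k = \sum_(x <- L | x.1 == k) x.2.
Proof.
apply/matrixP => i j; rewrite ord1 fourierE summxE.
under [X in coefficient X]eq_fun do rewrite laurent_entry.
rewrite coefficient_sum => [|x]; last first.
  exact: torus_boundedM (torus_bounded_cst _) (torus_bounded_monomial x.1).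
rewrite [RHS]big_mkcond; apply: eq_bigr => x _.
rewrite (coefficientZ _ _ (torus_bounded_monomial x.1)) coefficient_monomial eq_sym.
by case: eqP; rewrite ?mulr1 ?mulr0.
Qed.

Lemma torus_bounded_L2 g : torus_bounded_col g -> L2_torus g.
Proof.
move=> hg; split; first by move=> i; have [h1 h2 _] := hg i.
have hb := bounded_measurable_integrable (bounded_measurable_nsq hg).
case/integrableP: hb => _.
by under eq_integral do rewrite /= ger0_norm ?nsq_ge0 // -sqnormE.
Qed.

Lemma fourierD g E k : torus_bounded_col g -> torus_bounded_col E ->
  fourier (fun z w => g z w + E z w) k = fourier g k + fourier E k.
Proof.
move=> hg hE; apply/matrixP => i j; rewrite ord1 [RHS]mxE !fourierE.
by under [X in coefficient X]eq_fun do rewrite mxE; rewrite coefficientD.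
Qed.

Definition torus_bounded_mx f : Prop :=
  forall i j, torus_bounded (fun t => f (expi t.1) (expi t.2) i j).

Lemma torus_bounded_mulmx f g : torus_bounded_mx f -> torus_bounded_col g ->
  torus_bounded_col (fun z w => f z w *m g z w).
Proof.
move=> hf hg i; under eq_fun do rewrite mxE.
by apply: torus_bounded_sum => j; exact: (torus_boundedM (hf i j) (hg j)).
Qed.

Lemma torus_bounded_colB g E : torus_bounded_col g -> torus_bounded_col E ->
  torus_bounded_col (fun z w => g z w - E z w).
Proof.
move=> hg hE i; under eq_fun do rewrite mx_subE.
exact: (torus_boundedB (hg i) (hE i)).
Qed.

Lemma eq_fourier g E k : (forall z w, circle z -> circle w -> g z w = E z w) ->
  fourier g k = fourier E k.
Proof.
move=> gE; apply/matrixP => i j; rewrite ord1 !fourierE.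
by apply: torus_mean_eq => t _; rewrite gE //; exact: circle_expi.
Qed.

Definition embed (k : nat * nat) : int * int := (k.1%:Z, k.2%:Z).

Lemma embed_inj : injective embed.
Proof. by move=> [a b] [c d] [-> ->]. Qed.

Definition laurent_of (s : seq (nat * nat)) (y : nat * nat -> V) : laurent_list :=
  [seq (embed k, y k) | k <- s].

Definition quarter (k : int * int) := (0 <= k.1) && (0 <= k.2).

Lemma quarter_embed k : quarter (embed k).
Proof. by case: k. Qed.

Lemma fourier_laurent_of s y : uniq s -> (forall k, k \notin s -> y k = 0) ->
  fourier (laurent (laurent_of s y)) = extend_by_zero y.
Proof.
move=> us ys; apply/funext => k; rewrite fourier_laurent /laurent_of big_map /=.
rewrite /extend_by_zero; case: ifPn => [/andP[k1 k2]|nk]; last first.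
  apply: big1 => l /eqP lk; case/negP: nk; rewrite -lk.
  exact: quarter_embed.
have -> : k = embed (`|k.1|%N, `|k.2|%N).
  by rewrite /embed /= !gez0_abs // -surjective_pairing.
set l := (_, _); under eq_bigl do rewrite (inj_eq embed_inj).
have [ls|ls] := boolP (l \in s); first by rewrite -big_filter filter_pred1_uniq // big_seq1.
rewrite ys // big_seq_cond big1 // => m /andP[ms /eqP ml].
by case/negP: ls; rewrite -ml.
Qed.

(** A finitely supported sequence consists of the Fourier coefficients of a trigonometric
    polynomial, to which the defining property of the multiplication operator applies directly. *)
Lemma toeplitz_finite f T s y : is_quarter_plane_toeplitz f T -> uniq s ->
  (forall k, k \notin s -> y k = 0) ->
  T y = fun k => fourier (fun z w => f z w *m laurent (laurent_of s y) z w) (embed k).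
Proof.
move=> [M [[_ hM] ->]] us ys; apply/funext => k; rewrite /compression.
rewrite -(fourier_laurent_of us ys) hM //.
exact: torus_bounded_L2 (torus_bounded_laurent _).
Qed.

(** Subtracting [L] does not affect the coefficients kept by the compression, as its frequencies lie
    outside the quarter plane. The rest is uniformly small on the torus, and Bessel's inequality
    applies. *)
Lemma toeplitz_small f T s y L (eta : R) : torus_bounded_mx f ->
  is_quarter_plane_toeplitz f T -> uniq s -> (forall k, k \notin s -> y k = 0) ->
  (forall x, x \in L -> ~~ quarter x.1) ->
  (forall z w, circle z -> circle w ->
    nsq (f z w *m laurent (laurent_of s y) z w - laurent L z w) <= eta) ->
  l2_le (T y) eta.
Proof.
move=> hf hT us ys hL bE; rewrite (toeplitz_finite hT us ys).
set g := laurent (laurent_of s y).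
have gg : torus_bounded_col g := torus_bounded_laurent _.
have gL := torus_bounded_laurent L.
have gE := torus_bounded_colB (torus_bounded_mulmx hf gg) gL.
have hE := fourier_small gE bE.
move=> r ur.
have -> : \sum_(k <- r) sqnorm (fourier (fun z w => f z w *m g z w) (embed k)) =
  \sum_(k <- [seq embed k | k <- r])
    sqnorm (fourier (fun z w => f z w *m g z w - laurent L z w) k).
  rewrite big_map; apply: eq_bigr => k _; congr sqnorm.
  rewrite (@eq_fourier _ (fun z w => (f z w *m g z w - laurent L z w) + laurent L z w)).
    rewrite (fourierD _ gE gL) fourier_laurent big_seq_cond big1 ?addr0 // => x.
    by move=> /andP[/hL xL /eqP xk]; case/negP: xL; rewrite xk; exact: quarter_embed.
  by move=> z w _ _; rewrite subrK.
by apply: hE; rewrite map_inj_uniq //; exact: embed_inj.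
Qed.

(** Bilinear, without conjugation, so that moving the operator to the other argument produces the
    transposed symbol and not the adjoint one. *)
Definition pairing (s : seq (nat * nat)) (r a : nat * nat -> V) : R[i] :=
  \sum_(k <- s) \sum_i r k i 0 * a k i 0.

Lemma pairing_le s r a (C D : R) : \sum_(k <- s) sqnorm (r k) <= C ->
  \sum_(k <- s) sqnorm (a k) <= D -> mo (pairing s r a) ^+ 2 <= C * D.
Proof.
move=> hr ha; rewrite /pairing.
have E (u : nat * nat -> V) : \sum_(k <- s) sqnorm (u k) =
    \sum_(j : 'I_(size s)) \sum_i mo (u (nth (0%N, 0%N) s j) i 0) ^+ 2.
  rewrite (big_nth (0%N, 0%N)) big_mkord; apply: eq_bigr => j _.
  by rewrite sqnormE; apply: eq_bigr => i _; rewrite big_ord_recl big_ord0 addr0.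
rewrite (big_nth (0%N, 0%N)) big_mkord pair_big /=.
apply: le_trans (_ : (\sum_(p : 'I_(size s) * 'I_n)
   mo (r (nth (0%N, 0%N) s p.1) p.2 0) * mo (a (nth (0%N, 0%N) s p.1) p.2 0)) ^+ 2 <= _).
  apply: lerXn2r; rewrite ?nnegrE ?mo_ge0 ?sumr_ge0 //.
    by move=> p _; rewrite mulr_ge0 ?mo_ge0.
  by apply: le_trans (mo_sum _ _ _) _; apply: ler_sum => p _; rewrite moM.
apply: le_trans (cauchy_schwarz_sum _ _) _.
have P (u : nat * nat -> V) : \sum_(p : 'I_(size s) * 'I_n)
    mo (u (nth (0%N, 0%N) s p.1) p.2 0) ^+ 2 = \sum_(k <- s) sqnorm (u k).
  by rewrite E pair_big.
by rewrite !P; apply: ler_pM => //; apply: sumr_ge0 => k _; exact: sqnorm_ge0.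
Qed.

End laurent_functions.

(** * Pairings with the range of a Toeplitz operator *)

Section dual_estimate.
Context {R : realType} {n : nat}.
Local Notation V := ('cV[R[i]]_n).
Implicit Types (f : R[i] -> R[i] -> 'M[R[i]]_n) (s : seq (nat * nat)).

Definition laurent_inv (L : seq ((int * int) * V)) : seq ((int * int) * V) :=
  [seq ((- x.1.1, - x.1.2), x.2) | x <- L].

Lemma laurent_invE L z w : laurent (laurent_inv L) z w = laurent L z^-1 w^-1.
Proof.
by rewrite /laurent big_map; apply: eq_bigr => x _; rewrite /= !exprz_inv.
Qed.

Lemma circleV (z : R[i]) : circle z -> circle z^-1.
Proof. by move=> /circleE h; apply/circleE; rewrite moV h invr1. Qed.

(* The Toeplitz operator of [reflect_tr f] is the transpose of that of [f]. *)
Definition reflect_tr f : R[i] -> R[i] -> 'M[R[i]]_n :=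
  fun z w => (f z^-1 w^-1)^T.

Lemma coefficient_mul_laurent f s (y : nat * nat -> V) k i : torus_bounded_mx f ->
  fourier (fun z w => f z w *m laurent (laurent_of s y) z w) k i 0 =
  \sum_j \sum_(l <- s) y l j 0 *
    torus_mean (fun t => monomial (- k.1, - k.2) t *
      (f (expi t.1) (expi t.2) i j * monomial (embed l) t)).
Proof.
move=> hf; rewrite fourierE.
have hm l : @torus_bounded R (monomial l) := torus_bounded_monomial l.
have hb j l : torus_bounded (fun t => f (expi t.1) (expi t.2) i j * monomial l t).
  exact: torus_boundedM (hf i j) (hm l).
have -> : (fun t => (f (expi t.1) (expi t.2) *m
    laurent (laurent_of s y) (expi t.1) (expi t.2)) i 0) = (fun t =>
    \sum_j \sum_(l <- s) y l j 0 *
      (f (expi t.1) (expi t.2) i j * monomial (embed l) t)).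
  apply/funext => t; rewrite mxE; apply: eq_bigr => j _.
  rewrite laurent_entry big_map mulr_sumr; apply: eq_bigr => l _ /=.
  by rewrite mulrCA.
rewrite coefficient_sum => [|j]; last first.
  apply: torus_bounded_sum => l.
  exact: torus_boundedM (torus_bounded_cst _) (hb _ _).
apply: eq_bigr => j _; rewrite coefficient_sum => [|l]; last first.
  exact: torus_boundedM (torus_bounded_cst _) (hb _ _).
by apply: eq_bigr => l _; rewrite coefficientZ.
Qed.


(** Pairing [r] with T a amounts to pairing [a] with the coefficients of D = f^T g at negated
    indices, where g is the polynomial of [r] at (1/z, 1/w). The reflected [L] has no coefficients
    there, so these are coefficients of a small function. *)
Lemma pairing_finite f T s s' r a L (eta : R) : torus_bounded_mx f ->
  is_quarter_plane_toeplitz f T -> uniq s' -> (forall k, k \notin s' -> a k = 0) ->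
  (forall x, x \in L -> ~~ quarter x.1) ->
  (forall z w, circle z -> circle w ->
    nsq (reflect_tr f z w *m laurent (laurent_of s r) z w - laurent L z w) <= eta) ->
  mo (pairing s r (T a)) ^+ 2 <= eta * \sum_(k <- s') sqnorm (a k).
Proof.
move=> hf hT us' as' hL bE.
pose g z w := laurent (laurent_inv (laurent_of s r)) z w.
pose D z w := (f z w)^T *m g z w.
have hft : torus_bounded_mx (fun z w => (f z w)^T).
  by move=> i j; under eq_fun do rewrite mxE; exact: hf.
have gD : torus_bounded_col D by exact: torus_bounded_mulmx hft (torus_bounded_laurent _).
have gL := torus_bounded_laurent (laurent_inv L).
have gE := torus_bounded_colB gD gL.
have /(fourier_small gE) hE : forall z w, circle z -> circle w ->
    nsq (D z w - laurent (laurent_inv L) z w) <= eta.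
  move=> z w cz cw; rewrite /D /g !laurent_invE.
  have := bE _ _ (circleV cz) (circleV cw).
  by rewrite /reflect_tr !invrK.
have hm l : @torus_bounded R (monomial l) := torus_bounded_monomial l.
pose op (k : nat * nat) : int * int := (- (k.1%:Z), - (k.2%:Z)).
have FD l j : fourier D (op l) j 0 = \sum_i \sum_(k <- s) r k i 0 *
    torus_mean (fun t => monomial (embed l) t *
      (f (expi t.1) (expi t.2) i j * monomial (op k) t)).
  rewrite fourierE.
  have hb i k : torus_bounded (fun t => f (expi t.1) (expi t.2) i j * monomial k t).
    exact: torus_boundedM (hf i j) (hm k).
  have -> : (fun t => D (expi t.1) (expi t.2) j 0) = (fun t =>
    \sum_i \sum_(k <- s) r k i 0 * (f (expi t.1) (expi t.2) i j * monomial (op k) t)).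
    apply/funext => t; rewrite mxE; apply: eq_bigr => i _.
    rewrite /g mxE laurent_entry !big_map mulr_sumr; apply: eq_bigr => k _ /=.
    by rewrite mulrCA.
  rewrite coefficient_sum => [|i]; last first.
    apply: torus_bounded_sum => k.
    exact: torus_boundedM (torus_bounded_cst _) (hb _ _).
  apply: eq_bigr => i _; rewrite coefficient_sum => [|k]; last first.
    exact: torus_boundedM (torus_bounded_cst _) (hb _ _).
  apply: eq_bigr => k _; rewrite coefficientZ // /coefficient /op /= !opprK.
  by case: l.
have FE l : fourier D (op l) =
    fourier (fun z w => D z w - laurent (laurent_inv L) z w) (op l).
  rewrite (@eq_fourier _ _ _ (fun z w => (D z w - laurent (laurent_inv L) z w) +
    laurent (laurent_inv L) z w)) => [|z w _ _]; last by rewrite subrK.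
  rewrite (fourierD _ gE gL) fourier_laurent big_map big_seq_cond big1 ?addr0 //.
  move=> x /andP[/hL xL]; rewrite xpair_eqE !eqr_opp => /andP[/eqP x1 /eqP x2].
  by case/negP: xL; rewrite /quarter x1 x2.
have -> : pairing s r (T a) = pairing s' a (fun l => fourier D (op l)).
  rewrite (toeplitz_finite hT us' as') /pairing.
  under eq_bigr do under eq_bigr do rewrite coefficient_mul_laurent // mulr_sumr.
  under [RHS]eq_bigr do under eq_bigr do rewrite FD mulr_sumr.
  under eq_bigr do rewrite exchange_big /=.
  rewrite exchange_big /=.
  under [RHS]eq_bigr do under eq_bigr do under eq_bigr do rewrite mulr_sumr.
  under [RHS]eq_bigr do under eq_bigr do rewrite exchange_big.
  under [RHS]eq_bigr do rewrite exchange_big.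
  rewrite [RHS]exchange_big /=.
  rewrite exchange_big /=; apply: eq_bigr => k _.
  under eq_bigr do under eq_bigr do rewrite mulr_sumr.
  under eq_bigr do rewrite exchange_big /=.
  rewrite exchange_big /=; apply: eq_bigr => l _.
  apply: eq_bigr => j _; apply: eq_bigr => i _.
  rewrite mulrCA; congr (_ * (_ * torus_mean _)).
  by apply/funext => t; rewrite [LHS]mulrCA [RHS]mulrCA [monomial (embed l) t * _]mulrC.
rewrite mulrC; apply: (@pairing_le _ _ s' a _ _ _ (lexx _)).
under eq_bigr do rewrite FE.
have -> : \sum_(k <- s') sqnorm (fourier (fun z w => D z w -
    laurent (laurent_inv L) z w) (op k)) = \sum_(k <- [seq op k | k <- s'])
    sqnorm (fourier (fun z w => D z w - laurent (laurent_inv L) z w) k).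
  by rewrite big_map.
apply: hE; rewrite map_inj_uniq //.
by move=> [k1 k2] [l1 l2] [/oppr_inj [->] /oppr_inj [->]].
Qed.

Lemma l2_truncate (I : choiceType) (a : I -> V) (d : R) : in_l2 a -> 0 < d ->
  exists s : seq I, uniq s /\ l2_le (fun k => if k \in s then 0 else a k) d.
Proof.
move=> ha d0.
have [s us hs] : exists2 s, uniq s & l2_sq a - d < \sum_(k <- s) sqnorm (a k).
  apply: contrapT => h; have : l2_le a (l2_sq a - d).
    move=> s us; rewrite leNgt; apply/negP => h'; apply: h; exists s => //.
  by move=> /l2_sq_le; rewrite lerBrDr gerDl leNgt d0.
exists s; split=> // r ur.
have -> : \sum_(k <- r) sqnorm (if k \in s then 0 else a k) =
    \sum_(k <- [seq k <- r | k \notin s]) sqnorm (a k).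
  rewrite big_filter [RHS]big_mkcond; apply: eq_bigr => k _; case: ifP => // _.
  by rewrite sqnormE /nsq big1 // => i _; rewrite big1 // => j _; rewrite mxE mo0 expr0n.
have /(l2_le_sq ha) : uniq (s ++ [seq k <- r | k \notin s]).
  rewrite cat_uniq us filter_uniq // andbT; apply/hasPn => k.
  by rewrite mem_filter => /andP[].
by rewrite big_cat /=; lra.
Qed.

Lemma bounded_operatorP (T : (nat * nat -> V) -> nat * nat -> V) :
  bounded_operator T -> exists2 C : R, 0 <= C & forall a, in_l2 a ->
    in_l2 (T a) /\ l2_sq (T a) <= C * l2_sq a.
Proof.
move=> [_ [C hC]]; exists `|C| => // a ha.
have h : l2_le (T a) (`|C| * l2_sq a).
  apply/l2_leP; apply: le_trans (hC a ha) _; rewrite -(l2_sqE ha) -EFinM lee_fin.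
  by rewrite ler_wpM2r ?l2_sq_ge0 // ler_norm.
by split; [exact: l2_le_in h | exact: l2_sq_le].
Qed.

(** The explicit formula holds for finitely supported [a], so a general one is cut off: [b] is the
    finite part and [c] a tail of squared norm at most [d], whose contribution is controlled by the
    bound of [T] and tends to 0 with [d]. The factor 2 comes from splitting the square. *)
Lemma pairing_toeplitz f T s r a L (eta : R) : torus_bounded_mx f ->
  is_quarter_plane_toeplitz f T -> bounded_operator T -> uniq s -> in_l2 a ->
  (forall x, x \in L -> ~~ quarter x.1) ->
  (forall z w, circle z -> circle w ->
    nsq (reflect_tr f z w *m laurent (laurent_of s r) z w - laurent L z w) <= eta) ->
  mo (pairing s r (T a)) ^+ 2 <= 2 * eta * l2_sq a.
Proof.
move=> hf hT bT us ha hL bE.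
have eta0 : 0 <= eta by apply: le_trans (nsq_ge0 _) (bE 1 1 _ _); apply/circleE; rewrite mo1.
have [C C0 hC] := bounded_operatorP bT.
pose Nr := \sum_(k <- s) sqnorm (r k).
have Nr0 : 0 <= Nr by apply: sumr_ge0 => k _; exact: sqnorm_ge0.
suff key d : 0 < d -> mo (pairing s r (T a)) ^+ 2 <= 2 * eta * l2_sq a + 2 * Nr * C * d.
  apply/ler_addgt0Pr => e e0; have Q : 0 < 2 * Nr * C + 1 by rewrite ltr_wpDl // !mulr_ge0.
  apply: le_trans (key (e / (2 * Nr * C + 1)) (divr_gt0 e0 Q)) _.
  rewrite lerD2l mulrA ler_pdivrMr // [_ * e]mulrC ler_wpM2l ?ltW //.
  by rewrite ltrDl.
move=> d0; have [s' [us' hs']] := l2_truncate ha d0.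
pose c : nat * nat -> V := fun k => if k \in s' then 0 else a k.
pose b : nat * nat -> V := fun k => if k \in s' then a k else 0.
have hc : in_l2 c := l2_le_in hs'.
have bE' : b = -1 *: c + a.
  apply/funext => k; rewrite /b /c -[RHS]/(-1 *: (if k \in s' then 0 else a k) + a k).
  by case: ifP; rewrite ?scaler0 ?add0r // scaleN1r addNr.
have hb : in_l2 b by rewrite bE'; have [] := l2_sqD (in_l2Z (-1) hc) ha.
have TE : T a = fun k => 1 *: T c k + T b k.
  rewrite -bT.1 //; congr T; apply/funext => k; rewrite scale1r /b /c.
  by case: ifP; rewrite ?add0r ?addr0.
have -> : pairing s r (T a) = pairing s r (T c) + pairing s r (T b).
  rewrite /pairing -big_split; apply: eq_bigr => k _ /=.
  rewrite -big_split; apply: eq_bigr => i _ /=.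
  by rewrite TE scale1r mxE mulrDr.
apply: le_trans (mo_sqrD _ _) _; rewrite addrC; apply: lerD.
  rewrite -mulrA ler_wpM2l //.
  have bs k : k \notin s' -> b k = 0 by move=> /negPf h; rewrite /b h.
  apply: le_trans (pairing_finite hf hT us' bs hL bE) _; rewrite ler_wpM2l //.
  apply: le_trans (l2_le_sq ha us'); apply: ler_sum => k _; rewrite /b; case: ifP => // _.
  rewrite sqnormE /nsq big1 ?sqnorm_ge0 // => i _.
  by rewrite big1 // => j _; rewrite mxE mo0 expr0n.
rewrite -!mulrA ler_wpM2l // mulrA mulrC.
have [h1 h2] := hC c hc.
have h3 := le_trans h2 (ler_wpM2l C0 (l2_sq_le hs')).
have := pairing_le (lexx Nr) (le_trans (l2_le_sq h1 us) h3).
by rewrite mulrA mulrC.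
Qed.

End dual_estimate.

(** * Singular sequences of Fredholm operators *)

Section fredholm_operators.
Context {R : realType} {n : nat}.
Local Notation V := ('cV[R[i]]_n).
Implicit Types (T : (nat * nat -> V) -> nat * nat -> V).

Lemma sqnorm0 : sqnorm (0 : V) = 0.
Proof.
by rewrite sqnormE /nsq big1 // => i _; rewrite big1 // => j _; rewrite mxE mo0 expr0n.
Qed.

Lemma l2_le_finite (I : choiceType) (y : I -> V) (s : seq I) : uniq s ->
  (forall k, k \notin s -> y k = 0) -> l2_le y (\sum_(k <- s) sqnorm (y k)).
Proof.
move=> us ys r ur; rewrite (bigID (mem s)) /= [X in _ + X]big1 ?addr0; last first.
  by move=> k ks; rewrite ys // sqnorm0.
rewrite -big_filter [leRHS](bigID (mem r)) /= -[leLHS]addr0 lerD //; last first.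
  by apply: sumr_ge0 => k _; exact: sqnorm_ge0.
rewrite -[leRHS]big_filter le_eqVlt; apply/orP; left; apply/eqP.
apply: perm_big; apply: uniq_perm; rewrite ?filter_uniq // => k.
by rewrite !mem_filter andbC.
Qed.

Lemma sqnorm_comb m (c : 'I_m -> R[i]) (u : 'I_m -> V) :
  sqnorm (\sum_i c i *: u i) <= (\sum_i mo (c i) ^+ 2) * \sum_i sqnorm (u i).
Proof.
pose U : 'M[R[i]]_(n, m) := \matrix_(p, i) u i p 0.
pose C : 'cV[R[i]]_m := \col_i c i.
have -> : \sum_i c i *: u i = U *m C.
  apply/matrixP => p q; rewrite ord1 summxE mxE; apply: eq_bigr => i _.
  by rewrite !mxE mulrC.
rewrite sqnormE; apply: le_trans (nsqM _ _) _; rewrite mulrC.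
rewrite le_eqVlt; apply/orP; left; apply/eqP; congr (_ * _).
  by apply: eq_bigr => i _; rewrite big_ord_recl big_ord0 addr0 mxE.
rewrite /nsq exchange_big; apply: eq_bigr => i _; rewrite sqnormE.
by apply: eq_bigr => p _; rewrite big_ord_recl big_ord0 addr0 mxE.
Qed.

Lemma l2_le_comb (I : choiceType) m (c : 'I_m -> R[i]) (u : 'I_m -> I -> V)
    (B : 'I_m -> R) : (forall i, l2_le (u i) (B i)) ->
  l2_le (fun k => \sum_i c i *: u i k) ((\sum_i mo (c i) ^+ 2) * \sum_i B i).
Proof.
move=> hu s us.
apply: le_trans (_ : \sum_(k <- s) (\sum_i mo (c i) ^+ 2) * \sum_i sqnorm (u i k) <= _).
  by apply: ler_sum => k _; exact: sqnorm_comb.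
rewrite -mulr_sumr ler_wpM2l ?sumr_ge0 // => [i _|]; first exact: sqr_ge0.
by rewrite exchange_big; apply: ler_sum => i _; exact: hu.
Qed.

(** The map (a, d) -> T a + sum of d_i v_i is onto, and the open mapping theorem bounds a preimage.
    To make its domain an l^2 space of vectors, the scalars d_i are stored in coordinate [o] at [m]
    additional indices. *)
Lemma fredholm_right_inverse T : (0 < n)%N -> fredholm T ->
  exists m (v : 'I_m -> nat * nat -> V), (forall i, in_l2 (v i)) /\
  exists2 K : R, 0 <= K & forall b, in_l2 b -> exists a (d : 'I_m -> R[i]),
    [/\ in_l2 a, b = (fun k => T a k + \sum_i d i *: v i k), l2_sq a <= K * l2_sq b &
        \sum_i mo (d i) ^+ 2 <= K * l2_sq b].
Proof.
move=> n0 [bT _ [m [v [hv surj]]]]; exists m, v; split=> //.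
have [C C0 hC] := bounded_operatorP bT.
pose o := Ordinal n0; pose J := (nat * nat + 'I_m)%type.
pose A (a : J -> V) : nat * nat -> V :=
  fun k => T (a \o inl) k + \sum_i a (inr i) o 0 *: v i k.
have lel (a : J -> V) : in_l2 a -> l2_le (a \o inl) (l2_sq a).
  move=> ha s us; rewrite -(big_map inl xpredT (fun k => sqnorm (a k))).
  by apply: (l2_le_sq ha); rewrite map_inj_uniq // => x y [].
have inl' (a : J -> V) : in_l2 a -> in_l2 (a \o inl) by move=> /lel /l2_le_in.
have ler_ (a : J -> V) : in_l2 a -> \sum_i mo (a (inr i) o 0) ^+ 2 <= l2_sq a.
  move=> ha; apply: (@le_trans _ _ (\sum_(k <- [seq inr i | i <- index_enum 'I_m]) sqnorm (a k))).
    rewrite big_map; apply: ler_sum => i _; rewrite sqnormE.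
    exact: (le_entry_nsq (a (inr i)) o 0).
  apply: (l2_le_sq ha); rewrite map_inj_uniq ?index_enum_uniq //.
  by move=> x y [].
pose W := \sum_i l2_sq (v i).
have W0 : 0 <= W by apply: sumr_ge0 => i _; exact: l2_sq_ge0.
have Abd (a : J -> V) : in_l2 a -> l2_le (A a) ((2 * C + 2 * W) * l2_sq a).
  move=> ha; have [h1 h2] := hC _ (inl' a ha).
  have h3 : l2_le (fun k => \sum_i a (inr i) o 0 *: v i k) (l2_sq a * W).
    apply: l2_leW (l2_le_comb _ (fun i => l2_le_sq (hv i))).
    by rewrite ler_wpM2r // ler_.
  apply: l2_leW (l2_leD (l2_le_sq h1) h3).
  have h4 : l2_sq (T (a \o inl)) <= C * l2_sq a.
    by apply: le_trans h2 _; rewrite ler_wpM2l //; apply: l2_sq_le; exact: lel.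
  by lra.
have Alin (c : R[i]) (a b : J -> V) : in_l2 a -> in_l2 b ->
    A (c *: a + b) = c *: A a + A b.
  move=> ha hb; apply/funext => k; rewrite /A.
  have -> : (c *: a + b) \o inl = (fun k => c *: (a \o inl) k + (b \o inl) k) by [].
  rewrite bT.1; [|exact: inl'|exact: inl'].
  have E (x y : nat * nat -> V) : (c *: x + y) k = c *: x k + y k by [].
  rewrite E scalerDr addrACA; congr (_ + _).
  rewrite scaler_sumr -big_split; apply: eq_bigr => i _ /=.
  have -> : (c *: a + b) (inr i) = c *: a (inr i) + b (inr i) by [].
  by rewrite !mxE scalerDl scalerA.
have Asurj b : in_l2 b -> exists2 a, in_l2 a & A a = b.
  move=> /surj[a [c [ha bE]]].
  pose e : J -> V := fun k => match k with inl p => a p | inr i => const_mx (c i) end.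
  exists e.
    pose e1 : J -> V := fun k => if k is inl p then a p else 0.
    pose e2 : J -> V := fun k => if k is inr i then const_mx (c i) else 0.
    have -> : e = e1 + e2.
      by apply/funext => -[p|i]; rewrite -[RHS]/(e1 _ + e2 _) /= ?addr0 ?add0r.
    have h1 : in_l2 e1.
      apply: (@l2_le_in _ _ _ _ (l2_sq a)) => s us.
      pose s' := pmap (fun k : J => if k is inl p then Some p else None) s.
      have -> : \sum_(k <- s) sqnorm (e1 k) = \sum_(p <- s') sqnorm (a p).
        rewrite /s'; elim: (s) => [|[p|i] r IH]; rewrite ?big_nil // big_cons /= IH.
          by rewrite big_cons.
        by rewrite sqnorm0 add0r.
      apply: (l2_le_sq ha); apply: (@pmap_uniq _ _ _ (fun p => inl p)) us => -[p|i] //.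
    have h2 : in_l2 e2.
      apply: (@l2_le_in _ _ _ _ (\sum_(k <- [seq inr i | i <- index_enum 'I_m]) sqnorm (e2 k))).
      apply: l2_le_finite.
        by rewrite map_inj_uniq ?index_enum_uniq // => x y [].
      by move=> -[p|i] //; rewrite map_f // mem_index_enum.
    by have [] := l2_sqD h1 h2.
  rewrite bE; apply/funext => k; rewrite /A; congr (T _ k + _).
  by apply: eq_bigr => i _; rewrite mxE.
have [K K0 hK] := @open_mapping R n _ J A _ Alin (fun a ha => l2_le_in (Abd a ha))
  (fun a ha => l2_sq_le (Abd a ha)) Asurj.
exists K => // b /hK[a [ha <- ab]].
exists (a \o inl), (fun i => a (inr i) o 0); split=> //.
- exact: inl'.
- by apply: le_trans ab; apply: l2_sq_le; exact: lel.
- by apply: le_trans ab; exact: ler_.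
Qed.

(* A singular sequence for the Toeplitz operator of [f], described by the symbol
   alone: on the torus, the product of [f] with the trigonometric polynomial of
   [y i] is close to one with no frequency in the quarter plane. *)
Definition near_kernel (f : R[i] -> R[i] -> 'M[R[i]]_n) : Prop :=
  exists2 nu : R, 0 < nu & forall eta : R, 0 < eta ->
  exists (y : nat -> nat * nat -> V) (S : nat -> seq (nat * nat)),
    [/\ forall i, uniq (S i),
        forall i j k, k \in S i -> k \in S j -> i = j,
        forall i k, k \notin S i -> y i k = 0,
        forall i, nu <= \sum_(k <- S i) sqnorm (y i k) &
        forall i, exists L : seq ((int * int) * V),
          (forall x, x \in L -> ~~ quarter x.1) /\
          forall z w, circle z -> circle w ->
          nsq (f z w *m laurent (laurent_of (S i) (y i)) z w - laurent L z w) <= eta].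

Lemma disjoint_flatten m (S : nat -> seq (nat * nat)) : (forall i, uniq (S i)) ->
  (forall i j k, k \in S i -> k \in S j -> i = j) ->
  uniq (flatten [seq S i | i <- iota 0 m]).
Proof.
move=> uS dS; elim: m => // m IH.
rewrite -addn1 iotaD map_cat flatten_cat cat_uniq IH /= cats0 uS andbT.
apply/hasPn => k km; apply/negP => h.
have /flatten_mapP := h; case=> i.
by rewrite mem_iota add0n => /andP[_ im] ki; move: im; rewrite (dS _ _ _ ki km) ltnn.
Qed.

Lemma kernel_row p q (A : 'M[R[i]]_(p, q)) : (q < p)%N ->
  exists2 t : 'rV[R[i]]_p, t != 0 & t *m A = 0.
Proof.
move=> qp; have /rowV0Pn[t /sub_kermxP tA t0] : kermx A != 0.
  by rewrite -mxrank_eq0 mxrank_ker subn_eq0 -ltnNge (leq_ltn_trans (rank_leq_col A)).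
by exists t.
Qed.

(* More vectors [y i] than the dimensions of kernel and cokernel together have a
   nontrivial combination that equals the same combination of small vectors. *)
Lemma fredholm_not_near_kernel f T : (0 < n)%N -> torus_bounded_mx f ->
  is_quarter_plane_toeplitz f T -> fredholm T -> ~ near_kernel f.
Proof.
move=> n0 hf hT FT [nu nu0 h].
have [m' [v [hv [K K0 hK]]]] := fredholm_right_inverse n0 FT.
have [bT [m [u hu]] _] := FT.
pose L := (m' + m).+1.
(* This choice gives L K eta < nu, against the final comparison nu Q <= Q L K eta. *)
have [|y [S [uS dS yS ynu yL]]] := h (nu / (L%:R * K + 1)).
  by rewrite divr_gt0 // ltr_wpDl // mulr_ge0.
set eta := nu / _ in yL.
have eta_lt : L%:R * K * eta < nu.
  rewrite /eta mulrCA -{2}[nu]mulr1 ltr_pM2l // ltr_pdivrMr ?mul1r ?ltrDl //.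
  by rewrite ltr_wpDl // mulr_ge0.
have hy i : in_l2 (y i) := l2_le_in (l2_le_finite (uS i) (yS i)).
have Ty i : l2_le (T (y i)) eta.
  have [L' [hL1 hL2]] := yL i.
  exact: toeplitz_small hf hT (uS i) (yS i) hL1 hL2.
have /choice[a ha] : forall i, exists q : (nat * nat -> V) * ('I_m' -> R[i]),
    [/\ in_l2 q.1, T (y i) = (fun k => T q.1 k + \sum_p q.2 p *: v p k) &
     l2_sq q.1 <= K * eta].
  move=> i; have [a [d [h1 h2 h3 _]]] := hK _ (l2_le_in (Ty i)).
  exists (a, d); split=> //; apply: le_trans h3 _.
  by rewrite ler_wpM2l // l2_sq_le.
(* T maps [e i] into the span of the [v p], so that combinations in the kernel of T are found by
   linear algebra. *)
pose e i : nat * nat -> V := fun k => -1 *: (a i).1 k + y i k.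
have he i : in_l2 (e i).
  have [h1 _ _] := ha i; have h2 : in_l2 (-1 *: (a i).1) by exact: in_l2Z.
  by have [] := l2_sqD h2 (hy i).
have Te i : T (e i) = fun k => \sum_p (a i).2 p *: v p k.
  have [h1 h2 _] := ha i; rewrite /e bT.1 // h2; apply/funext => k.
  by rewrite scaleN1r addrA addNr add0r.
have T0 : T (fun=> 0) = fun=> 0.
  have [z0 _] := @in_l2_0 R n (nat * nat)%type.
  have := bT.1 (-1) _ _ z0 z0.
  have -> : (fun k : nat * nat => -1 *: (0 : nat * nat -> V) k + (0 : nat * nat -> V) k) = fun=> 0.
    by apply/funext => k; rewrite scaler0 addr0.
  by move=> ->; apply/funext => k; rewrite scaleN1r addNr.
have Tcomb q (c : 'I_q -> R[i]) (x : 'I_q -> nat * nat -> V) : (forall i, in_l2 (x i)) ->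
    in_l2 (fun k => \sum_i c i *: x i k) /\
    T (fun k => \sum_i c i *: x i k) = fun k => \sum_i c i *: T (x i) k.
  move=> hx; elim: q c x hx => [|q IH] c x hx.
    have [z0 _] := @in_l2_0 R n (nat * nat)%type.
    have E (z : nat * nat -> 'I_0 -> V) : (fun k => \sum_i c i *: z k i) = fun=> 0.
      by apply/funext => k; rewrite big_ord0.
    by rewrite !E T0.
  have [h1 h2] := IH (fun i => c (lift ord0 i)) (fun i => x (lift ord0 i)) (fun i => hx _).
  have E (z : 'I_q.+1 -> nat * nat -> V) : (fun k => \sum_i c i *: z i k) =
      fun k => c ord0 *: z ord0 k + \sum_i c (lift ord0 i) *: z (lift ord0 i) k.
    by apply/funext => k; rewrite big_ord_recl.
  rewrite !E bT.1 // h2; split=> //.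
  by have [] := l2_sqD (in_l2Z (c ord0) (hx ord0)) h1.
(* The rows of [B] are combinations of the [e i] annihilated by T. There are at least L - m' > m of
   them, and they lie in the span of the m vectors [u p], so a further nontrivial combination [t] of
   them vanishes. *)
pose D : 'M[R[i]]_(L, m') := \matrix_(i, p) (a i).2 p.
pose B := row_base (kermx D).
have kerE (q : 'I_(\rank (kermx D))) : exists c : 'I_m -> R[i],
    (fun k => \sum_(i < L) B q i *: e i k) = (fun k => \sum_(p < m) c p *: u p k).
  have [h1 h2] := Tcomb L (fun i => B q i) (fun i => e i) (fun i => he i).
  apply: hu => //; rewrite h2; apply/funext => k.
  under eq_bigr do rewrite Te scaler_sumr.
  rewrite exchange_big big1 // => p _ /=.
  under eq_bigr do rewrite scalerA; rewrite -scaler_suml.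
  have : (row q B *m D) 0 p = 0.
    have /sub_kermxP -> : (row q B <= kermx D)%MS.
      by apply: submx_trans (row_sub _ _) _; rewrite eq_row_base.
    by rewrite mxE.
  rewrite mxE => E; rewrite (_ : \sum_i _ = 0) ?scale0r // -[RHS]E.
  by apply: eq_bigr => i _; rewrite !mxE.
have /choice[c hc] := kerE.
have [|t t0 tC] := @kernel_row _ _ (\matrix_(q, p) c q p : 'M[R[i]]_(\rank (kermx D), m)).
  rewrite mxrank_ker /L; have := rank_leq_col D; rewrite /L => ?; lia.
pose x := t *m B.
have x0 : x != 0.
  apply: contra t0 => /eqP xz; have := row_base_free (kermx D) => /row_free_inj E.
  by apply/eqP; apply: (E _ t 0); rewrite mul0mx.
have xe k : \sum_(i < L) x 0 i *: e i k = 0.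
  under eq_bigr do rewrite mxE scaler_suml.
  rewrite exchange_big /=.
  transitivity (\sum_q t 0 q *: \sum_p c q p *: u p k).
    apply: eq_bigr => q _; have /(congr1 (fun g => g k)) <- := hc q.
    by rewrite scaler_sumr; apply: eq_bigr => i _; rewrite scalerA.
  under eq_bigr do rewrite scaler_sumr; rewrite exchange_big big1 // => p _ /=.
  under eq_bigr do rewrite scalerA; rewrite -scaler_suml.
  have := congr1 (fun M : 'rV_m => M 0 p) tC; rewrite !mxE => E.
  rewrite (_ : \sum_i _ = 0) ?scale0r // -[RHS]E.
  by apply: eq_bigr => q _; rewrite !mxE.
have xy k : \sum_(i < L) x 0 i *: y i k = \sum_(i < L) x 0 i *: (a i).1 k.
  apply/eqP; rewrite -subr_eq0 -sumrB; apply/eqP; rewrite -[RHS](xe k).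
  by apply: eq_bigr => i _; rewrite /e scalerDr scaleN1r scalerN addrC.
pose Q := \sum_(i < L) mo (x 0 i) ^+ 2.
have Q0 : 0 < Q.
  have [i xi] : exists i, x 0 i != 0.
    apply: contrapT => nx; case/negP: x0; apply/eqP/rowP => i; rewrite [RHS]mxE.
    by apply: contrapT => xi; apply: nx; exists i; apply/eqP.
  rewrite /Q (bigD1 i) //= ltr_pwDl ?exprn_gt0 ?mo_gt0 //.
  by apply: sumr_ge0 => j _; exact: sqr_ge0.
pose s := flatten [seq S i | i <- iota 0 L].
have us : uniq s by exact: disjoint_flatten.
have up : \sum_(k <- s) sqnorm (\sum_(i < L) x 0 i *: y i k) <= Q * (L%:R * (K * eta)).
  under eq_bigr do rewrite xy.
  have hb (i : 'I_L) : l2_le (a i).1 (K * eta).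
    by have [h1 _ h3] := ha i; apply: l2_leW h3 _; exact: l2_le_sq.
  apply: le_trans (l2_le_comb _ hb us) _.
  by rewrite sumr_const card_ord -[(K * eta) *+ _]mulr_natl.
(* On [S i] only the i-th vector is nonzero, so the squared norms add. *)
have low : nu * Q <= \sum_(k <- s) sqnorm (\sum_(i < L) x 0 i *: y i k).
  rewrite /s big_flatten big_map -[iota 0 L]/(index_iota 0 L) big_mkord mulr_sumr.
  apply: ler_sum => i _.
  apply: (@le_trans _ _ (\sum_(k <- S i) mo (x 0 i) ^+ 2 * sqnorm (y i k))).
    by rewrite -mulr_sumr mulrC ler_wpM2l ?sqr_ge0.
  rewrite big_seq [leRHS]big_seq; apply: ler_sum => k ki.
  rewrite (bigD1 i) //= big1 ?addr0 ?sqnormZ // => j ji.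
  rewrite yS ?scaler0 //; apply/negP => kj; case/negP: ji; apply/eqP/val_inj.
  exact: dS kj ki.
have := le_trans low up; rewrite mulrC ler_pM2l // leNgt mulrA eta_lt.
by [].
Qed.

(* The range is almost orthogonal to [y i], and so is the complement spanned by the
   finitely many [v p] when [i] is large, because the supports are disjoint. *)
Lemma fredholm_not_near_cokernel f T : (0 < n)%N -> torus_bounded_mx f ->
  is_quarter_plane_toeplitz f T -> fredholm T -> ~ near_kernel (reflect_tr f).
Proof.
move=> n0 hf hT FT [nu nu0 h].
have [m [v [hv [K K0 hK]]]] := fredholm_right_inverse n0 FT.
have [bT _ _] := FT.
have K8 : 0 < 8 * K + 8 by rewrite ltr_wpDl // mulr_ge0.
(* Below, the range part contributes at most 4 K eta N to N^2 and the complement at most N^2 / 2,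
   whence N <= 8 K eta < nu <= N. *)
have [|y [S [uS dS yS ynu yL]]] := h (nu / (8 * K + 8)); first by rewrite divr_gt0.
set eta := nu / _ in yL.
have eta_lt : 8 * K * eta < nu.
  rewrite /eta mulrCA -{2}[nu]mulr1 ltr_pM2l // ltr_pdivrMr // mul1r ltrDl.
  by [].
pose tau i := \sum_p \sum_(k <- S i) sqnorm (v p k).
have tau0 i : 0 <= tau i.
  by apply: sumr_ge0 => p _; apply: sumr_ge0 => k _; exact: sqnorm_ge0.
(* By disjointness all partial sums of [tau] stay below the total squared norm of the [v p], so 4 K
   tau cannot exceed 1 for every index. *)
have [i hi] : exists i, 4 * K * tau i <= 1.
  apply: contrapT => nex.
  pose W := \sum_p l2_sq (v p).
  have W0 : 0 <= W by apply: sumr_ge0 => p _; exact: l2_sq_ge0.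
  have big M : \sum_(i < M) tau i <= W.
    rewrite exchange_big; apply: ler_sum => p _.
    rewrite -(big_mkord xpredT (fun i => \sum_(k <- S i) sqnorm (v p k))).
    have := l2_le_sq (hv p) (disjoint_flatten M uS dS).
    by rewrite big_flatten big_map /index_iota subn0.
  have gt i : 1 < 4 * K * tau i by rewrite ltNge; apply/negP => hi; apply: nex; exists i.
  pose M := Num.bound (4 * K * W).
  have : (M%:R : R) <= 4 * K * W.
    apply: le_trans (_ : \sum_(i < M) 4 * K * tau i <= _).
      by rewrite -[M in M%:R]card_ord -sumr_const; apply: ler_sum => i _; exact: ltW.
    by rewrite -mulr_sumr ler_wpM2l // mulr_ge0.
  by rewrite leNgt; have := archi_boundP (mulr_ge0 (mulr_ge0 (ler0n R 4) K0) W0) => ->.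
(* Conjugation turns the bilinear pairing with [y i] into the squared norm N. *)
pose b : nat * nat -> V := fun k => map_mx (@Num.conj _) (y i k).
pose N := \sum_(k <- S i) sqnorm (y i k).
have nN : nu <= N by exact: ynu.
have sqb k : sqnorm (b k) = sqnorm (y i k).
  rewrite !sqnormE; apply: eq_bigr => p _; apply: eq_bigr => q _.
  by rewrite mxE mo_conj.
have bz k : k \notin S i -> b k = 0.
  by move=> ki; apply/matrixP => p q; rewrite mxE yS // mxE conjC0.
have lb : l2_le b N.
  by have := l2_le_finite (uS i) bz; under eq_bigr do rewrite sqb.
have [a [d [ha bE aK dK]]] := hK b (l2_le_in lb).
have KN : K * l2_sq b <= K * N by rewrite ler_wpM2l // l2_sq_le.
have N0 : 0 < N by exact: lt_le_trans nN.
have [L [hL1 hL2]] := yL i.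
have p1 := pairing_toeplitz hf hT bT (uS i) ha hL1 hL2.
have eta0 : 0 <= eta := divr_ge0 (ltW nu0) (ltW K8).
have p1' : mo (pairing (S i) (y i) (T a)) ^+ 2 <= 2 * eta * (K * N).
  apply: le_trans p1 _; apply: ler_wpM2l (le_trans aK KN).
  exact: mulr_ge0 (ler0n R 2) eta0.
pose w : nat * nat -> V := fun k => \sum_p d p *: v p k.
have hw : \sum_(k <- S i) sqnorm (w k) <= K * N * tau i.
  apply: (@le_trans _ _ (\sum_(k <- S i) (\sum_p mo (d p) ^+ 2) * \sum_p sqnorm (v p k))).
    by apply: ler_sum => k _; exact: sqnorm_comb.
  rewrite -mulr_sumr exchange_big; apply: ler_pM; rewrite ?sumr_ge0 //.
  - by move=> p _; exact: sqr_ge0.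
  - by move=> p _; apply: sumr_ge0 => k _; exact: sqnorm_ge0.
  - exact: le_trans dK KN.
have p2 := pairing_le (lexx N) hw.
have pb : pairing (S i) (y i) b = N%:C.
  rewrite /pairing /N rmorph_sum; apply: eq_bigr => k _; rewrite sqnormE /nsq rmorph_sum.
  by apply: eq_bigr => p _; rewrite big_ord_recl big_ord0 addr0 mxE mulzJ.
have psum : pairing (S i) (y i) b = pairing (S i) (y i) (T a) + pairing (S i) (y i) w.
  rewrite bE /pairing -big_split; apply: eq_bigr => k _ /=.
  by rewrite -big_split; apply: eq_bigr => p _ /=; rewrite mxE mulrDr.
have := mo_sqrD (pairing (S i) (y i) (T a)) (pairing (S i) (y i) w).
rewrite -psum pb mo_real (ger0_norm (ltW N0)) => hN.
have h3 : N * (K * N * tau i) <= N * N * 4^-1.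
  by have : N * N * (4 * K * tau i) <= N * N * 1; [rewrite ler_wpM2l ?mulr_ge0 // ltW | lra].
have h4 : N * N <= 8 * K * eta * N by lra.
by move: h4; rewrite ler_pM2r // leNgt (lt_le_trans eta_lt nN).
Qed.

End fredholm_operators.

(** * Singular sequences from nonzero partial indices *)

Section disk_approximation.
Context {R : realType}.
Implicit Types (e g : R[i] -> R[i]) (p q : {poly R[i]}).

(** Rational factors enter the singular vectors only through such polynomials, since these vectors
    must have finite support. *)
Definition disk_approx e : Prop := forall d : R, 0 < d ->
  exists p, forall z, closed_disk z -> mo (e z - p.[z]) <= d.

Lemma poly_disk_bounded p : exists2 M : R, 0 < M &
  forall z, closed_disk z -> mo p.[z] <= M.
Proof.
have M0 : 0 <= \sum_(i < size p) mo p`_i by apply: sumr_ge0 => i _; exact: mo_ge0.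
exists (\sum_(i < size p) mo p`_i + 1); first by rewrite ltr_wpDl.
move=> z /closed_diskE z1.
apply: (@le_trans _ _ (\sum_(i < size p) mo p`_i)); last by rewrite lerDl.
rewrite horner_coef; apply: le_trans (mo_sum _ _ _) _; apply: ler_sum => i _.
by rewrite moM moX ler_piMr ?mo_ge0 // exprn_ile1 ?mo_ge0.
Qed.

Lemma disk_approx_poly p : disk_approx (fun z => p.[z]).
Proof. by move=> d d0; exists p => z _; rewrite subrr mo0 ltW. Qed.

Lemma disk_approxM e g : disk_approx e -> disk_approx g ->
  disk_approx (fun z => e z * g z).
Proof.
move=> he hg d d0; have [p1 hp1] := he 1 ltr01.
have [M M0 hM] := poly_disk_bounded p1.
have [p2 hp2] := hg (d / (2 * (M + 1))) (divr_gt0 d0 (mulr_gt0 (ltr0n R 2) (addr_gt0 M0 ltr01))).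
have [M' M'0 hM'] := poly_disk_bounded p2.
have [p3 hp3] := he (d / (2 * M')) (divr_gt0 d0 (mulr_gt0 (ltr0n R 2) M'0)).
exists (p3 * p2) => z Dz; rewrite hornerM.
have -> : e z * g z - p3.[z] * p2.[z] = e z * (g z - p2.[z]) + (e z - p3.[z]) * p2.[z].
  by ring.
have ez : mo (e z) <= M + 1.
  have -> : e z = p1.[z] + (e z - p1.[z]) by rewrite addrC subrK.
  by apply: le_trans (moD _ _) _; apply: lerD; [exact: hM | exact: hp1].
apply: le_trans (moD _ _) _; rewrite !moM.
have h1 : mo (e z) * mo (g z - p2.[z]) <= (M + 1) * (d / (2 * (M + 1))).
  by apply: ler_pM; rewrite ?mo_ge0 // hp2.
have h2 : mo (e z - p3.[z]) * mo p2.[z] <= d / (2 * M') * M'.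
  by apply: ler_pM; rewrite ?mo_ge0 ?hp3 ?hM'.
apply: le_trans (lerD h1 h2) _; rewrite le_eqVlt; apply/orP; left; apply/eqP.
by field; rewrite !gt_eqF //= addr_gt0.
Qed.

Lemma disk_approx_eq e g : (forall z, closed_disk z -> e z = g z) ->
  disk_approx e -> disk_approx g.
Proof. by move=> eg he d /he[p hp]; exists p => z Dz; rewrite -eg // hp. Qed.

(** Partial sums of the geometric series in z / a leave the remainder (z / a)^N / (z - a), uniformly
    small because |z| <= 1 < |a|. *)
Lemma disk_approx_pole (a : R[i]) : 1 < mo a -> disk_approx (fun z => (z - a)^-1).
Proof.
move=> a1 d d0; have a0 : a != 0 by rewrite -mo_gt0 (lt_trans ltr01).
have am : 0 < mo a - 1 by rewrite subr_gt0.
have : (mo a)^-1 ^+ N @[N --> \oo] --> (0 : R).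
  apply: cvg_expr; rewrite ger0_norm ?invr_ge0 ?mo_ge0 // invf_lt1 //.
  by rewrite (lt_trans ltr01).
move=> /cvgrPdist_lt/(_ (d * (mo a - 1)))[|N _ /(_ N (leqnn N))]; first by rewrite mulr_gt0.
rewrite /= sub0r normrN ger0_norm ?exprn_ge0 ?invr_ge0 ?mo_ge0 // => hN.
exists (- \sum_(k < N) (a^-1 ^+ k.+1) *: 'X^k) => z Dz.
have za : z - a != 0.
  rewrite subr_eq0; apply: contraTneq a1 => <-; rewrite -leNgt; exact/closed_diskE.
have -> : (z - a)^-1 - (- \sum_(k < N) (a^-1 ^+ k.+1) *: 'X^k).[z] =
    (z / a) ^+ N / (z - a).
  apply: (mulIf za); rewrite divfK // mulrBl mulVf // hornerN horner_sum.
  have -> : \sum_(i < N) (a^-1 ^+ i.+1 *: 'X^i).[z] = a^-1 * \sum_(i < N) (z / a) ^+ i.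
    rewrite mulr_sumr; apply: eq_bigr => k _.
    by rewrite hornerZ hornerXn exprS exprMn -mulrA [_ * z ^+ k]mulrC.
  have E := subrX1 (z / a) N; rewrite -[LHS]/(_ + _) in E.
  have -> : z - a = a * (z / a - 1) by rewrite mulrBr mulr1 mulrCA divff ?mulr1.
  rewrite mulNr opprK mulrACA mulVf // mul1r [X in _ + X]mulrC -E.
  by rewrite addrC subrK.
rewrite moM moV ler_pdivrMr ?mo_gt0 // moX moM moV.
have h1 : mo a - 1 <= mo (z - a).
  have := moD (a - z) z; rewrite subrK mo_distC; move/closed_diskE: Dz; lra.
apply: (@le_trans _ _ ((mo a)^-1 ^+ N)).
  rewrite lerXn2r ?nnegrE ?mulr_ge0 ?invr_ge0 ?mo_ge0 // ler_piMl ?invr_ge0 ?mo_ge0 //.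
  exact/closed_diskE.
by apply: le_trans (ltW hN) _; rewrite ler_wpM2l // ltW.
Qed.

Lemma disk_approx_ratio p q : (forall z, closed_disk z -> q.[z] != 0) ->
  disk_approx (fun z => p.[z] / q.[z]).
Proof.
move=> hq; apply: disk_approxM (disk_approx_poly p) _.
have q0 : q != 0.
  apply/negP => /eqP qz; have := hq 0 closed_disk0; by rewrite qz horner0 eqxx.
have [s qE] := closed_field_poly_normal q.
have lc0 : lead_coef q != 0 by rewrite lead_coef_eq0.
have : forall a, a \in s -> 1 < mo a.
  move=> a sa; rewrite ltNge; apply/negP => /closed_diskE /hq /negP; apply.
  rewrite qE hornerZ horner_prod; apply/eqP.
  rewrite (big_rem a) //= hornerXsubC subrr mul0r mulr0.
  by [].
move: qE; set c := lead_coef q => -> {hq q0} hs.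
elim: s hs => [|a s IH] hs.
  apply: disk_approx_eq (disk_approx_poly c^-1%:P) => z _.
  by rewrite big_nil hornerZ !hornerC mulr1.
apply: disk_approx_eq (disk_approxM (disk_approx_pole (hs a (mem_head _ _))) (IH _)).
  move=> z _; rewrite big_cons !hornerZ hornerM hornerXsubC -invfM.
  by congr (_^-1); rewrite mulrCA.
by move=> b sb; apply: hs; rewrite inE sb orbT.
Qed.

End disk_approximation.

Section test_vectors.
Context {R : realType} {n : nat}.
Local Notation V := ('cV[R[i]]_n).

(** The i-th block has first coordinates from iN to iN + N - 1. Passing to another block multiplies
    the polynomial by a power of z, of modulus 1 on the circle, so one estimate serves all i. *)
Definition block (N D i : nat) : seq (nat * nat) :=
  [seq ((i * N + j)%N, k) | j <- iota 0 N, k <- iota 0 D].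

Definition tensor (N D i : nat) (c : nat -> R[i]) (b : nat -> V) (k : nat * nat) : V :=
  if k \in block N D i then c (k.1 - i * N)%N *: b k.2 else 0.

Lemma block_uniq N D i : uniq (block N D i).
Proof.
apply: allpairs_uniq; rewrite ?iota_uniq // => -[j k] [j' k'] _ _ /= [].
by move=> /addnI -> ->.
Qed.

Lemma block_disjoint N D i i' k :
  k \in block N D i -> k \in block N D i' -> i = i'.
Proof.
move=> /allpairsP[[j l] /= []]; rewrite !mem_iota => /andP[_ jN] _ ->.
move=> /allpairsP[[j' l'] /= []]; rewrite !mem_iota => /andP[_ jN'] _ [E _].
have := congr1 (divn^~ N) E; rewrite /= !divnMDl ?divn_small ?addn0 //; lia.
Qed.

Lemma tensorE N D i c b j k : (j < N)%N -> (k < D)%N ->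
  tensor N D i c b ((i * N + j)%N, k) = c j *: b k.
Proof.
move=> jN kD; rewrite /tensor ifT /= ?addKn //.
by apply/allpairsP; exists (j, k); rewrite /= !mem_iota.
Qed.

Lemma big_iota (A : nmodType) N (F : nat -> A) :
  \sum_(j <- iota 0 N) F j = \sum_(j < N) F j.
Proof. by rewrite -(big_mkord xpredT F) /index_iota subn0. Qed.

Lemma big_block (A : nmodType) N D i (F : nat * nat -> A) :
  \sum_(k <- block N D i) F k = \sum_(j < N) \sum_(k < D) F ((i * N + j)%N, k : nat).
Proof.
rewrite /block big_allpairs_dep big_iota.
by apply: eq_bigr => j _; rewrite big_iota.
Qed.

Lemma tensor_sqnorm N D i c b : \sum_(k <- block N D i) sqnorm (tensor N D i c b k) =
  (\sum_(j < N) mo (c j) ^+ 2) * \sum_(k < D) sqnorm (b k).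
Proof.
rewrite big_block mulr_suml; apply: eq_bigr => j _; rewrite mulr_sumr.
by apply: eq_bigr => k _; rewrite tensorE // sqnormZ.
Qed.

Lemma tensor_laurent N D i c b z w :
  laurent (laurent_of (block N D i) (tensor N D i c b)) z w =
  (\sum_(j < N) c j * z ^+ (i * N + j)) *: \sum_(k < D) w ^+ k *: b k.
Proof.
rewrite /laurent big_map big_block scaler_suml; apply: eq_bigr => j _.
rewrite scaler_sumr; apply: eq_bigr => k _ /=; rewrite tensorE // !scalerA.
by congr (_ *: _); rewrite -!exprnP; ring.
Qed.

(* Coefficients of the normalized Dirichlet kernel with its peak at [z0]. *)
Definition peak (z0 : R[i]) (N : nat) (j : nat) : R[i] :=
  ((Num.sqrt N%:R)^-1)%:C * z0^-1 ^+ j.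

Lemma peak_sqnorm z0 N : circle z0 -> (0 < N)%N ->
  \sum_(j < N) mo (peak z0 N j) ^+ 2 = 1.
Proof.
move=> /circleE z01 N0; under eq_bigr do rewrite moM moX moV z01 invr1 expr1n mulr1
  mo_real real_normK ?num_real // exprVn sqr_sqrtr //.
by rewrite sumr_const card_ord -[_ *+ _]mulr_natl divff // pnatr_eq0 -lt0n.
Qed.

(** Multiplication by z - z0 collapses the geometric sum to a term of modulus at most 2. Although
    its coefficients have squared norm 1, the kernel squared times |z - z0|^2 is O(1 / N), which
    defeats the Lipschitz variation of the symbol in z. *)
Lemma peak_bounds z0 N i z : circle z0 -> circle z -> (0 < N)%N ->
  mo (\sum_(j < N) peak z0 N j * z ^+ (i * N + j)) ^+ 2 <= N%:R /\
  mo (\sum_(j < N) peak z0 N j * z ^+ (i * N + j)) ^+ 2 * mo (z - z0) ^+ 2 <= 4 / N%:R.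
Proof.
move=> /circleE z01 /circleE z1 N0; have N0' : (0 : R) < N%:R by rewrite ltr0n.
have z00 : z0 != 0 by rewrite -mo_gt0 z01.
pose s : R := Num.sqrt N%:R; have s0 : 0 < s by rewrite sqrtr_gt0.
have s2 : s ^+ 2 = N%:R by rewrite sqr_sqrtr // ltW.
have E : mo (\sum_(j < N) peak z0 N j * z ^+ (i * N + j)) =
    s^-1 * mo (\sum_(j < N) (z / z0) ^+ j).
  transitivity (mo (z ^+ (i * N)) * (mo s^-1%:C * mo (\sum_(j < N) (z / z0) ^+ j))).
    rewrite -!moM; congr (mo _); rewrite !mulr_sumr; apply: eq_bigr => j _.
    by rewrite /peak -/s exprD exprMn; ring.
  by rewrite moX z1 expr1n mul1r mo_real ger0_norm // invr_ge0 ltW.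
rewrite E !exprMn exprVn s2; split.
  apply: (@le_trans _ _ (N%:R^-1 * N%:R ^+ 2)); last by rewrite expr2 mulKf ?gt_eqF.
  apply: ler_wpM2l; first by rewrite invr_ge0 ltW.
  apply: lerXn2r; rewrite ?nnegrE ?mo_ge0 ?(ltW N0') //.
  apply: le_trans (mo_sum _ _ _) _.
  under eq_bigr do rewrite moX moM moV z1 z01 invr1 mulr1 expr1n.
  by rewrite sumr_const card_ord.
rewrite -mulrA mulrC; apply: ler_wpM2r; first by rewrite invr_ge0 ltW.
rewrite -exprMn -moM.
have -> : (\sum_(j < N) (z / z0) ^+ j) * (z - z0) = z0 * ((z / z0) ^+ N - 1).
  rewrite subrX1 mulrC mulrA mulrBr mulr1 mulrCA divff ?mulr1 //.
rewrite moM z01 mul1r.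
have : mo ((z / z0) ^+ N - 1) <= 2.
  apply: le_trans (moB _ _) _.
  by rewrite mo1 moX moM moV z1 z01 invr1 mulr1 expr1n -natr1.
by move=> h; have := @lerXn2r _ 2 _ _ (mo_ge0 ((z / z0) ^+ N - 1)) (ler0n R 2) h; rewrite -natrX.
Qed.

Definition lipschitz1 (f : R[i] -> R[i] -> 'M[R[i]]_n) (K : R) : Prop :=
  forall z z' w, circle z -> circle z' -> circle w ->
    nsq (f z w) <= K /\ nsq (f z w - f z' w) <= K * mo (z - z') ^+ 2.

Lemma near_kernel_intro f (K : R) z0 (v m : R[i] -> V) (kappa : int) :
  lipschitz1 f K -> circle z0 -> kappa < 0 -> v 0 != 0 ->
  (forall i, disk_approx (fun w => v w i 0)) ->
  (forall i, disk_approx (fun w => m w i 0)) ->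
  (forall w, circle w -> f z0 w *m v w = w ^ kappa *: m w^-1) ->
  near_kernel f.
Proof.
move=> fK cz0 k0 v0 av am fvm.
have nv0 : 0 < nsq (v 0).
  rewrite lt_def nsq_ge0 andbT; apply: contra v0 => /eqP h; apply/eqP.
  by apply: sqnorm_eq0; rewrite sqnormE h.
have approx (g : R[i] -> V) (d : R) : 0 < d -> (forall i, disk_approx (fun w => g w i 0)) ->
    exists D (b : nat -> V), forall w, closed_disk w ->
      nsq (g w - \sum_(k < D) w ^+ k *: b k) <= d.
  move=> d0 ag; pose d' := Num.sqrt (d / n.+1%:R).
  have d'0 : 0 < d' by rewrite sqrtr_gt0 divr_gt0.
  have /choice[p hp] : forall i, exists p : {poly R[i]}, forall z, closed_disk z ->
     mo (g z i 0 - p.[z]) <= d' by move=> i; exact: ag.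
  exists (\max_i size (p i)), (fun k => \col_i (p i)`_k) => w Dw.
  have E i : (\sum_(k < \max_i size (p i)) w ^+ k *: \col_i (p i)`_k : V) i 0 = (p i).[w].
    rewrite summxE (horner_coef_wide _ (@leq_bigmax _ (fun i => size (p i)) i)).
    apply: eq_bigr => k _.
    by rewrite !mxE mulrC.
  apply: (@le_trans _ _ (\sum_(i < n) d / n.+1%:R)).
    apply: ler_sum => i _; rewrite big_ord_recl big_ord0 addr0 mx_subE E.
    have <- : d' ^+ 2 = d / n.+1%:R by rewrite sqr_sqrtr // divr_ge0 // ltW.
    apply: lerXn2r; rewrite ?nnegrE ?mo_ge0 ?(ltW d'0) //.
    exact: hp.
  rewrite sumr_const card_ord -[_ *+ n]mulr_natl mulrCA ler_piMr ?ltW //.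
  by rewrite ltr_pdivrMr // mul1r ltr_nat.
have [Mv Mv0 hMv] : exists2 Mv : R, 0 < Mv & forall w, closed_disk w -> nsq (v w) <= Mv.
  have [D [b hb]] := approx v 1 ltr01 av.
  have /choice[M hM] : forall i, exists M : R, forall w, closed_disk w ->
      mo ((\sum_(k < D) w ^+ k *: b k) i 0) ^+ 2 <= M.
    move=> i; have [M M0 hM] := poly_disk_bounded (\poly_(k < D) b k i 0).
    exists (M ^+ 2) => w /hM; rewrite horner_poly => h.
    apply: lerXn2r; rewrite ?nnegrE ?mo_ge0 ?(ltW M0) //; apply: le_trans h.
    rewrite summxE le_eqVlt; apply/orP; left; apply/eqP; congr mo.
    by apply: eq_bigr => k _; rewrite mxE mulrC.
  exists (2 + 2 * \sum_i `|M i|); first by rewrite ltr_pwDl // mulr_ge0 // sumr_ge0.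
  move=> w Dw; have -> : v w = (v w - \sum_(k < D) w ^+ k *: b k) + \sum_(k < D) w ^+ k *: b k.
    by rewrite subrK.
  apply: le_trans (nsqD _ _) _; apply: lerD.
    by rewrite ler_piMr // hb.
  rewrite ler_wpM2l //; apply: ler_sum => i _; rewrite big_ord_recl big_ord0 addr0.
  exact: le_trans (hM i w Dw) (ler_norm _).
have K0 : 0 <= K by have [h _] := fK _ _ _ cz0 cz0 cz0; apply: le_trans (nsq_ge0 _) h.
(* The squared norm of each vector is at least that of [b 0], the value at 0 of a polynomial within
   squared distance d of v. From |v 0|^2 <= 2d + 2|b 0|^2 and d <= |v 0|^2 / 4 it is at least |v
   0|^2 / 4, whatever eta is. *)
exists (nsq (v 0) / 4); first by rewrite divr_gt0.
move=> eta eta0; pose B := 2 * Mv + 2.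
have B0 : 0 < B by rewrite addr_gt0 // mulr_gt0.
(* [N] controls the variation of f in z: 16 is 4 from two splittings of a square times 4 from
   [peak_bounds]. Then [d] is chosen depending on [N], since the kernel itself is bounded only by
   the square root of N. *)
pose N := (Num.bound (32 * K * B / eta)).+1.
have N0 : (0 : R) < N%:R by rewrite ltr0n.
have hN : 16 * K * B / N%:R <= eta / 2.
  have h : 32 * K * B / eta < N%:R.
    apply: lt_le_trans (_ : (Num.bound (32 * K * B / eta))%:R <= _); last by rewrite ler_nat.
    apply: archi_boundP; apply: divr_ge0 (ltW eta0).
    by rewrite !mulr_ge0 // ltW.
  rewrite ler_pdivrMr //; move: h; rewrite ltr_pdivrMr // mulrC => h; lra.
pose d := Num.min (Num.min 1 (nsq (v 0) / 4)) (eta / (2 * N%:R * (4 * K + 2))).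
have K2 : 0 < 4 * K + 2 by rewrite ltr_wpDl // mulr_ge0.
have d0 : 0 < d.
  by rewrite !lt_min ltr01 /= !divr_gt0 // !mulr_gt0.
have d1 : d <= 1 by rewrite !ge_min lexx.
have dv : d <= nsq (v 0) / 4 by rewrite !ge_min lexx !orbT.
have dN : N%:R * (4 * K + 2) * d <= eta / 2.
  have h : d <= eta / (2 * N%:R * (4 * K + 2)) by rewrite !ge_min lexx !orbT.
  have := ler_wpM2l (ltW (mulr_gt0 N0 K2)) h; set x := _ / (_ * _) => h'.
  apply: le_trans h' _; rewrite le_eqVlt /x; apply/orP; left; apply/eqP.
  by field; rewrite !gt_eqF.
have [D [b hb]] := approx v d d0 av.
have [D' [b' hb']] := approx m d d0 am.
exists (fun i => tensor N D i (peak z0 N) b), (block N D); split.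
- exact: block_uniq.
- move=> i j k; exact: block_disjoint.
- by move=> i k /negPf h; rewrite /tensor h.
- move=> i; rewrite tensor_sqnorm peak_sqnorm // mul1r.
  have := hb 0 closed_disk0; case: (D) => [|D0].
    rewrite !big_ord0 subr0 => h; have := le_trans h dv; have := nv0.
    by move: (nsq (v 0)) => x; lra.
  rewrite [X in v 0 - X]big_ord_recl [X in _ -> _ <= X]big_ord_recl expr0 scale1r.
  rewrite [X in v 0 - (_ + X)]big1 ?addr0 => [h|k _]; last by rewrite expr0n scale0r.
  apply: (@le_trans _ _ (sqnorm (b 0))); last first.
    by rewrite lerDl sumr_ge0 // => k _; exact: sqnorm_ge0.
  have := nsqD (v 0 - b 0) (b 0); rewrite subrK sqnormE => h'.
  by have := le_trans h dv; move: h'; move: (nsq _) (nsq _) (nsq _) => x y z; lra.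
- move=> i.
  (* The second exponents kappa - k are negative, so every frequency is outside the quarter
     plane. *)
  pose L : seq ((int * int) * V) :=
    [seq (((i * N + j)%N%:Z, kappa - k%:Z), peak z0 N j *: b' k) |
      j <- iota 0 N, k <- iota 0 D'].
  exists L; split=> [x /allpairsP[[j k] [_ _ ->]]|z w cz cw].
    by rewrite /quarter /= -ltNge ltrBlDr (lt_le_trans k0).
  rewrite tensor_laurent.
  set phi := \sum_(j < N) _; have [h1 h2] := peak_bounds i cz0 cz (ltn0Sn _ : (0 < N)%N).
  rewrite -/phi in h1 h2.
  have w0 : w != 0 by rewrite -mo_gt0; move/circleE: cw => ->.
  have -> : laurent L z w = phi *: (w ^ kappa *: \sum_(k < D') w^-1 ^+ k *: b' k).
    rewrite /laurent /L big_allpairs_dep /phi scaler_suml.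
    rewrite big_iota; apply: eq_bigr => j _; rewrite big_iota !scaler_sumr; apply: eq_bigr => k _.
    rewrite /= !scalerA; congr (_ *: _).
    by rewrite expfzDr // -exprz_inv -!exprnP mulrC !mulrA.
  set vt := \sum_(k < D) _; set mt := \sum_(k < D') _.
  have Dw : closed_disk w by apply/closed_diskE; move/circleE: cw => ->.
  have cw' := circleV cw.
  have Dw' : closed_disk w^-1 by apply/closed_diskE; move/circleE: cw' => ->.
  have hvt : nsq (v w - vt) <= d by exact: hb.
  have hmt : nsq (m w^-1 - mt) <= d by exact: hb'.
  have nZ (c : R[i]) (u : V) : nsq (c *: u) = mo c ^+ 2 * nsq u.
    by rewrite -!sqnormE sqnormZ.
  (* Three errors remain: from moving z to z0 and from replacing v and m by polynomials. The main
     terms cancel by the identity at z0. *)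
  have -> : f z w *m (phi *: vt) - phi *: (w ^ kappa *: mt) =
     phi *: (((f z w - f z0 w) *m vt - f z0 w *m (v w - vt)) +
       w ^ kappa *: (m w^-1 - mt)).
    rewrite -scalemxAr -scalerBr; congr (_ *: _).
    rewrite mulmxBl mulmxBr fvm // scalerBr.
    move: (f z w *m vt) (f z0 w *m vt) (w ^ kappa *: m _) (_ *: mt) => A B1 C E.
    by rewrite opprB !addrA !subrK.
  rewrite nZ; set E := _ + _.
  have wk : mo (w ^ kappa) = 1.
    case: (kappa) => p; first by rewrite -exprnP moX (circleE w).1 // expr1n.
    by rewrite NegzE -exprnN moV moX (circleE w).1 // expr1n invr1.
  have [fb _] := fK _ _ _ cz0 cz0 cw; have [_ fl] := fK _ _ _ cz cz0 cw.
  have vtB : nsq vt <= B.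
    have -> : vt = v w - (v w - vt) by rewrite opprB addrC subrK.
    apply: le_trans (nsqB _ _) _; rewrite /B; apply: lerD; first by rewrite ler_wpM2l // hMv.
    by rewrite ler_piMr // (le_trans hvt d1).
  have e1 : nsq ((f z w - f z0 w) *m vt) <= K * mo (z - z0) ^+ 2 * B.
    by apply: le_trans (nsqM _ _) _; apply: ler_pM; rewrite ?nsq_ge0.
  have e2 : nsq (f z0 w *m (v w - vt)) <= K * d.
    by apply: le_trans (nsqM _ _) _; apply: ler_pM; rewrite ?nsq_ge0.
  have e3 : nsq (w ^ kappa *: (m w^-1 - mt)) <= d by rewrite nZ wk expr1n mul1r.
  have hE : nsq E <= 4 * (K * B) * mo (z - z0) ^+ 2 + (4 * K + 2) * d.
    apply: le_trans (nsqD _ _) _.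
    have aux (k e a x1 x2 x3 x4 t : R) : x1 <= 2 * x2 + 2 * x3 -> x2 <= k * t * a ->
        x3 <= k * e -> x4 <= e -> 2 * x1 + 2 * x4 <= 4 * (k * a) * t + (4 * k + 2) * e.
      by clear; lra.
    exact: aux (nsqB _ _) e1 e2 e3.
  apply: le_trans (ler_wpM2l (sqr_ge0 _) hE) _; rewrite mulrDr.
  have -> : eta = eta / 2 + eta / 2 by lra.
  apply: lerD.
    apply: le_trans hN; rewrite mulrCA -/phi.
    have -> : 16 * K * B / N%:R = 4 * (K * B) * (4 / N%:R) by ring.
    by rewrite ler_wpM2l // !mulr_ge0 // ltW.
  apply: le_trans dN; rewrite -mulrA ler_wpM2r //.
  by rewrite mulr_ge0 // ltW.
Qed.

End test_vectors.

(** * Regularity of rational symbols on the torus *)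

Section torus_regularity.
Context {R : realType}.
Implicit Types (F G : R[i] -> R[i] -> R[i]) (p q : {poly {poly R[i]}}).

(** Measurability and boundedness serve the Fourier coefficients, the Lipschitz bound in the first
    variable serves the peak argument; both pass together through sums, products and inverses. *)
Definition torus_regular F : Prop :=
  torus_bounded (fun t => F (expi t.1) (expi t.2)) /\
  exists2 K : R, 0 < K & forall z z' w, circle z -> circle z' -> circle w ->
    mo (F z w) <= K /\ mo (F z w - F z' w) <= K * mo (z - z').

Lemma torus_regular_cst c : torus_regular (fun _ _ => c).
Proof.
split; first exact: torus_bounded_cst.
exists (mo c + 1); first by rewrite ltr_wpDl ?mo_ge0.
move=> z z' w _ _ _; rewrite subrr mo0 lerDl ler01 mulr_ge0 ?mo_ge0 //.
by rewrite addr_ge0 ?mo_ge0.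
Qed.

Lemma torus_regular1 : torus_regular (fun z _ => z).
Proof.
split; first exact: torus_bounded_expi1.
by exists 1 => // z z' w /circleE -> _ _; rewrite mul1r.
Qed.

Lemma torus_regular2 : torus_regular (fun _ w => w).
Proof.
split; first exact: torus_bounded_expi2.
by exists 1 => // z z' w _ _ /circleE ->; rewrite subrr mo0 mul1r mo_ge0.
Qed.

Lemma torus_regularD F G : torus_regular F -> torus_regular G ->
  torus_regular (fun z w => F z w + G z w).
Proof.
move=> [bF [K K0 hK]] [bG [K' K'0 hK']]; split; first exact: torus_boundedD bF bG.
exists (K + K'); first exact: addr_gt0.
move=> z z' w cz cz' cw; have [h1 h2] := hK _ _ _ cz cz' cw.
have [h3 h4] := hK' _ _ _ cz cz' cw; split.
  exact: le_trans (moD _ _) (lerD h1 h3).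
by rewrite opprD addrACA mulrDl; exact: le_trans (moD _ _) (lerD h2 h4).
Qed.

Lemma torus_regularM F G : torus_regular F -> torus_regular G ->
  torus_regular (fun z w => F z w * G z w).
Proof.
move=> [bF [K K0 hK]] [bG [K' K'0 hK']]; split; first exact: torus_boundedM bF bG.
exists (2 * (K * K')); first by rewrite !mulr_gt0.
move=> z z' w cz cz' cw; have [h1 h2] := hK _ _ _ cz cz' cw.
have [h3 h4] := hK' _ _ _ cz cz' cw; have [h5 _] := hK _ _ _ cz' cz' cw; split.
  rewrite moM; apply: le_trans (ler_pM _ _ h1 h3) _; rewrite ?mo_ge0 //.
  by rewrite mulr_natl mulr2n lerDl mulr_ge0 // ltW.
have -> : F z w * G z w - F z' w * G z' w =
    (F z w - F z' w) * G z w + F z' w * (G z w - G z' w) by ring.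
apply: le_trans (moD _ _) _; rewrite !moM.
have h6 : mo (F z w - F z' w) * mo (G z w) <= K * mo (z - z') * K'.
  by apply: ler_pM; rewrite ?mo_ge0.
have h7 : mo (F z' w) * mo (G z w - G z' w) <= K * (K' * mo (z - z')).
  by apply: ler_pM; rewrite ?mo_ge0.
by apply: le_trans (lerD h6 h7) _; rewrite le_eqVlt; apply/orP; left; apply/eqP; ring.
Qed.

Lemma torus_regular_sum (I : Type) (r : seq I) (F : I -> R[i] -> R[i] -> R[i]) :
  (forall i, torus_regular (F i)) -> torus_regular (fun z w => \sum_(i <- r) F i z w).
Proof.
move=> hF; elim: r => [|i r IH].
  have -> : (fun z w => \sum_(i <- [::]) F i z w) = fun _ _ => 0.
    by apply/funext => z; apply/funext => w; rewrite big_nil.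
  exact: torus_regular_cst.
have -> : (fun z w => \sum_(i <- i :: r) F i z w) =
    fun z w => F i z w + \sum_(i <- r) F i z w.
  by apply/funext => z; apply/funext => w; rewrite big_cons.
exact: torus_regularD.
Qed.

Lemma torus_regularX F k : torus_regular F -> torus_regular (fun z w => F z w ^+ k).
Proof.
move=> hF; elim: k => [|k IH].
  have -> : (fun z w => F z w ^+ 0) = fun _ _ => 1.
    by apply/funext => z; apply/funext => w; rewrite expr0.
  exact: torus_regular_cst.
have -> : (fun z w => F z w ^+ k.+1) = fun z w => F z w * F z w ^+ k.
  by apply/funext => z; apply/funext => w; rewrite exprS.
exact: torus_regularM.
Qed.

Lemma horner2E p z w :
  p.[z, w] = \sum_(i < size p) (\sum_(j < size p`_i) (p`_i)`_j * w ^+ j) * z ^+ i.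
Proof.
rewrite [p.[_]]horner_coef horner_sum; apply: eq_bigr => i _.
by rewrite hornerM -rmorphXn /= hornerC horner_coef.
Qed.

Lemma torus_regular_horner2 p : torus_regular (fun z w => p.[z, w]).
Proof.
have -> : (fun z w => p.[z, w]) = fun z w => \sum_(i < size p)
    (\sum_(j < size p`_i) (p`_i)`_j * w ^+ j) * z ^+ i.
  by apply/funext => z; apply/funext => w; rewrite horner2E.
apply: torus_regular_sum => i; apply: torus_regularM; last exact: torus_regularX torus_regular1.
apply: torus_regular_sum => j; apply: torus_regularM; first exact: torus_regular_cst.
exact: torus_regularX torus_regular2.
Qed.

Lemma continuous_horner2 q : continuous (fun u : R[i] * R[i] => q.[u.1, u.2]).
Proof.
under eq_fun do rewrite horner2E.
have cX (f : R[i] * R[i] -> R[i]) k : continuous f -> continuous (fun u => f u ^+ k).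
  move=> cf; elim: k => [|k IH] u; first by under eq_fun do rewrite expr0; exact: cvg_cst.
  under eq_fun do rewrite exprS.
  exact: (cvgM (cf u) (IH u)).
have cS (I : Type) (r : seq I) (f : I -> R[i] * R[i] -> R[i]) :
    (forall i, continuous (f i)) -> continuous (fun u => \sum_(i <- r) f i u).
  by move=> cf u; apply: cvg_sumr => i; exact: cf.
apply: cS => i u; apply: cvgM; last by apply: cX => {}u; exact: cvg_fst.
apply: cvg_sumr => j; apply: cvgM; first exact: cvg_cst.
by apply: cX => v; exact: cvg_snd.
Qed.

Lemma horner2_lower_bound q : (forall z w, circle z -> circle w -> q.[z, w] != 0) ->
  exists2 c : R, 0 < c & forall z w, circle z -> circle w -> c <= mo q.[z, w].
Proof.
move=> q0; pose e (u : R[i] * R[i]) := q.[u.1, u.2]^-1.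
have ec : {within circle `*` circle, continuous e}.
  apply/subspace_continuousP => u [c1 c2]; apply: cvgV; first exact: q0.
  by apply: cvg_within_filter; exact: continuous_horner2.
have [M M0 hM] := compact_mo_bounded (compact_setX (@compact_circle R) (@compact_circle R)) ec.
exists M^-1; first by rewrite invr_gt0.
move=> z w cz cw; have := hM (z, w) (conj cz cw); rewrite /e moV /= => h.
by rewrite invf_ple ?posrE ?mo_gt0 ?q0.
Qed.

Lemma torus_regularV F (c : R) : 0 < c ->
  (forall z w, circle z -> circle w -> c <= mo (F z w)) ->
  torus_regular F -> torus_regular (fun z w => (F z w)^-1).
Proof.
move=> c0 hc [bF [K K0 hK]]; split.
  by apply: torus_boundedV c0 _ bF => t _; apply: hc; exact: circle_expi.
have F0 z w : circle z -> circle w -> F z w != 0.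
  by move=> cz cw; rewrite -mo_gt0 (lt_le_trans c0) ?hc.
exists (c^-1 + K / c ^+ 2); first by rewrite addr_gt0 ?divr_gt0 ?invr_gt0 ?exprn_gt0.
move=> z z' w cz cz' cw; split.
  rewrite moV ler_wpDr ?divr_ge0 ?exprn_ge0 ?(ltW c0) ?(ltW K0) //.
  by rewrite lef_pV2 ?posrE ?hc // (lt_le_trans c0) ?hc.
have -> : (F z w)^-1 - (F z' w)^-1 = (F z' w - F z w) / (F z w * F z' w).
  by field; rewrite !F0.
have [_ h] := hK _ _ _ cz' cz cw.
rewrite moM moV moM mulrDl ler_wpDl ?mulr_ge0 ?mo_ge0 ?invr_ge0 ?(ltW c0) //.
rewrite [K / _ * _]mulrAC [mo (z - z')]mo_distC.
apply: ler_pM; rewrite ?mo_ge0 ?invr_ge0 ?mulr_ge0 ?mo_ge0 //.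
rewrite lef_pV2 ?posrE ?exprn_gt0 ?mulr_gt0 ?mo_gt0 ?F0 //.
by apply: ler_pM; rewrite ?hc ?ltW.
Qed.

Lemma torus_regular_eq F G : (forall z w, circle z -> circle w -> F z w = G z w) ->
  torus_regular F -> torus_regular G.
Proof.
move=> FG [bF [K K0 hK]]; split.
  by apply: torus_bounded_eq bF => t _; apply: FG; exact: circle_expi.
by exists K => // z z' w cz cz' cw; rewrite -!FG //; exact: hK.
Qed.

End torus_regularity.

Section rational_symbols.
Context {R : realType} {n : nat}.
Implicit Types f : R[i] -> R[i] -> 'M[R[i]]_n.

Lemma rational2_regular f i j : rational2_mx f -> torus_regular (fun z w => f z w i j).
Proof.
move=> /(_ i j)[p [q h]].
have [c c0 hc] := @horner2_lower_bound R q (fun z w cz cw => (h z w cz cw).1).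
apply: torus_regular_eq (torus_regularM (torus_regular_horner2 p)
  (torus_regularV c0 hc (torus_regular_horner2 q))) => z w cz cw.
by rewrite (h z w cz cw).2.
Qed.

Lemma rational2_bounded f : rational2_mx f -> torus_bounded_mx f.
Proof. by move=> hf i j; have [] := rational2_regular i j hf. Qed.

Lemma rational2_lipschitz f : rational2_mx f -> exists K, lipschitz1 f K.
Proof.
move=> hf.
have /choice[K hK] : forall p : 'I_n * 'I_n, exists K : R, 0 < K /\
    forall z z' w, circle z -> circle z' -> circle w ->
    mo (f z w p.1 p.2) <= K /\ mo (f z w p.1 p.2 - f z' w p.1 p.2) <= K * mo (z - z').
  by move=> [i j]; have [_ [K K0 h]] := rational2_regular i j hf; exists K.
exists (\sum_i \sum_j K (i, j) ^+ 2) => z z' w cz cz' cw; split.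
  apply: ler_sum => i _; apply: ler_sum => j _.
  have [K0 h] := hK (i, j); have [h1 _] := h _ _ _ cz cz' cw.
  by apply: lerXn2r; rewrite ?nnegrE ?mo_ge0 ?(ltW K0).
rewrite mulr_suml; apply: ler_sum => i _; rewrite mulr_suml; apply: ler_sum => j _.
have [K0 h] := hK (i, j); have [_ h1] := h _ _ _ cz cz' cw.
rewrite mx_subE -exprMn; apply: lerXn2r; rewrite ?nnegrE ?mo_ge0 //.
by rewrite mulr_ge0 ?mo_ge0 ?(ltW K0).
Qed.

Lemma nsq_tr p q (A : 'M[R[i]]_(p, q)) : nsq A^T = nsq A.
Proof.
rewrite /nsq exchange_big; apply: eq_bigr => i _; apply: eq_bigr => j _.
by rewrite mxE.
Qed.

Lemma reflect_tr_lipschitz f (K : R) : lipschitz1 f K -> lipschitz1 (reflect_tr f) K.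
Proof.
move=> hf z z' w cz cz' cw.
have [h1 h2] := hf _ _ _ (circleV cz) (circleV cz') (circleV cw).
rewrite /reflect_tr -linearB /= !nsq_tr; split=> //; apply: le_trans h2 _.
have z0 : z != 0 by rewrite -mo_gt0 (circleE z).1.
have z'0 : z' != 0 by rewrite -mo_gt0 (circleE z').1.
have -> : z^-1 - z'^-1 = (z' - z) * (z^-1 * z'^-1) by field; rewrite z0 z'0.
by rewrite !moM !moV (circleE z).1 // (circleE z').1 // invr1 !mulr1 mo_distC.
Qed.

Lemma rational2_swap f : rational2_mx f -> rational2_mx (fun z w => f w z).
Proof.
move=> hf i j; have [p [q h]] := hf i j; exists (swapXY p), (swapXY q) => z w cz cw.
by rewrite !horner2_swapXY; exact: h.
Qed.

Definition swap_pair {T : Type} (k : T * T) := (k.2, k.1).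

Lemma swap_pairK (T : Type) : involutive (@swap_pair T).
Proof. by move=> []. Qed.

(** The quarter plane is symmetric, so exchanging the coordinates of all indices carries the
    singular sequence over. Hence the operator of the given symbol also settles the other
    variable. *)
Lemma near_kernel_swap f : near_kernel (fun z w => f w z) -> near_kernel f.
Proof.
move=> [nu nu0 h]; exists nu; first exact: nu0.
move=> eta /h[y [S [uS dS yS ynu yL]]].
have swK := inv_inj (@swap_pairK nat).
have memS i k : (k \in [seq swap_pair l | l <- S i]) = (swap_pair k \in S i).
  by rewrite -{1}[k]swap_pairK (mem_map swK).
exists (fun i k => y i (swap_pair k)), (fun i => [seq swap_pair k | k <- S i]); split.
- by move=> i; rewrite (map_inj_uniq swK).
- by move=> i j k; rewrite !memS; exact: dS.
- by move=> i k; rewrite memS; exact: yS.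
- by move=> i; rewrite big_map; under eq_bigr do rewrite swap_pairK; exact: ynu.
move=> i; have [L [hL1 hL2]] := yL i.
exists [seq (swap_pair x.1, x.2) | x <- L]; split=> [x|z w cz cw].
  by move=> /seq.mapP[{}x /hL1 + ->]; rewrite /quarter /= andbC.
have -> : laurent (laurent_of [seq swap_pair k | k <- S i]
    (fun k => y i (swap_pair k))) z w = laurent (laurent_of (S i) (y i)) w z.
  rewrite /laurent !big_map; apply: eq_bigr => k _ /=.
  by rewrite mulrC; case: k.
have -> : laurent [seq (swap_pair x.1, x.2) | x <- L] z w = laurent L w z.
  by rewrite /laurent big_map; apply: eq_bigr => k _ /=; rewrite mulrC.
exact: hL2.
Qed.

End rational_symbols.

(** * Wiener-Hopf factorization of rational matrices *)

Section rational_units.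
Context {R : realType} {n : nat}.
Implicit Types (H h : R[i] -> 'M[R[i]]_n) (p q : {poly R[i]}).

(** A common denominator and a determinant, both without zeros on the closed disk, yield
    analyticity, invertibility, rationality and polynomial approximability, the last also for the
    inverse. *)
Definition rational_unit H : Prop :=
  exists (B : 'M[{poly R[i]}]_n) q,
    [/\ forall z, closed_disk z -> q.[z] != 0,
        forall z, closed_disk z -> (\det B).[z] != 0 &
        forall z, H z = q.[z]^-1 *: eval_mx z B].

Lemma rational_unit_tr H : rational_unit H -> rational_unit (fun z => (H z)^T).
Proof.
move=> [B [q [q0 B0 HE]]]; exists B^T, q; split=> // z.
  by rewrite det_tr; exact: B0.
by rewrite HE linearZ /=; congr (_ *: _); apply/matrixP => i j; rewrite !mxE.
Qed.

Lemma rational_unit_unitmx H z : rational_unit H -> closed_disk z -> H z \in unitmx.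
Proof.
move=> [B [q [q0 B0 HE]]] Dz; rewrite HE unitmxE detZ unitfE mulf_neq0 //.
  by rewrite expf_neq0 // invr_neq0 // q0.
by rewrite det_eval_mx B0.
Qed.

Lemma holomorphic_horner p : holomorphic (fun z : R[i] => p.[z]).
Proof.
under eq_fun do rewrite horner_coef.
apply: holomorphic_sum => i _; apply: holomorphicM; first exact: holomorphic_cst.
elim: (nat_of_ord i) => [|k IH]; first by under eq_fun do rewrite expr0; exact: holomorphic_cst.
by under eq_fun do rewrite exprS; exact: (holomorphicM (@holomorphic_id R) IH).
Qed.

Lemma rational_unit_holomorphic H : rational_unit H -> holomorphic_mx H.
Proof.
move=> [B [q [q0 _ HE]]] i j.
apply: (@holomorphic_eq _ (fun z => q.[z]^-1 * (B i j).[z])).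
  by move=> z _; rewrite HE mxE eval_mxE.
exact: holomorphicM (holomorphicV q0 (holomorphic_horner q)) (holomorphic_horner _).
Qed.

Lemma rational_unit_approx H i j : rational_unit H -> disk_approx (fun z => H z i j).
Proof.
move=> [B [q [q0 _ HE]]].
apply: disk_approx_eq (disk_approx_ratio (B i j) q0) => z _.
by rewrite HE mxE eval_mxE mulrC.
Qed.

Lemma rational_unit_approx_inv H i j : rational_unit H ->
  disk_approx (fun z => invmx (H z) i j).
Proof.
move=> [B [q [q0 B0 HE]]].
apply: disk_approx_eq (disk_approx_ratio (q * (\adj B) i j) B0) => z Dz.
have HX : H z *m ((q.[z] / (\det B).[z]) *: eval_mx z (\adj B)) = 1%:M.
  rewrite HE -scalemxAl -scalemxAr scalerA -eval_mxM mul_mx_adj.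
  apply/matrixP => k l; rewrite [LHS]mxE eval_mxE [RHS]mxE mxE hornerMn mulrnAr.
  by rewrite mulrA mulVf ?q0 // mul1r mulVf ?B0.
have [uH _] := mulmx1_unit HX.
have -> : invmx (H z) = (q.[z] / (\det B).[z]) *: eval_mx z (\adj B).
  by rewrite -[LHS]mulmx1 -HX mulKmx.
by rewrite [RHS]mxE eval_mxE hornerM mulrAC.
Qed.

Lemma rational_unit_rational H : rational_unit H -> rational_mx H.
Proof.
move=> [B [q [q0 _ HE]]] i j; exists (B i j), q => z /circle_closed_disk Dz.
by split; [exact: q0 | rewrite HE mxE eval_mxE mulrC].
Qed.

Definition reverse_poly p : {poly R[i]} := \poly_(k < size p) p`_((size p).-1 - k).

Lemma horner_reverse_poly p z : z != 0 -> (reverse_poly p).[z] = z ^+ (size p).-1 * p.[z^-1].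
Proof.
move=> z0; rewrite horner_poly horner_coef mulr_sumr (reindex_inj rev_ord_inj) /=.
apply: eq_bigr => k _; rewrite mulrCA.
move: (nat_of_ord k) (ltn_ord k) => m; move: (size p) => s ms.
have -> : (s.-1 - (s - m.+1) = m)%N by lia.
have -> : (s - m.+1 = s.-1 - m)%N by lia.
by congr (_ * _); rewrite exprVn -exprB ?unitfE //; lia.
Qed.

Lemma rational_unit_rational_inv H : rational_unit H -> rational_mx (fun z => H z^-1).
Proof.
move=> [B [q [q0 _ HE]]] i j.
exists ('X ^+ (size q).-1 * reverse_poly (B i j)), ('X ^+ (size (B i j)).-1 * reverse_poly q).
move=> z cz; have z0 : z != 0 by rewrite -mo_gt0 (circleE z).1.
have Dz := circle_closed_disk (circleV cz).
rewrite !hornerM !hornerXn !horner_reverse_poly // HE mxE eval_mxE.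
have h := q0 _ Dz; have e k : z ^+ k != 0 by exact: expf_neq0.
split; first by rewrite !mulf_neq0.
by rewrite [X in _ = X / _]mulrCA -!mulf_div !divff ?e // !mul1r mulrC.
Qed.

(* The minus factor is recorded in the chart 1/z. *)
Definition wiener_hopf h (kappa : 'I_n -> int) Hm Hp : Prop :=
  [/\ rational_unit Hm, rational_unit Hp &
      forall z, circle z ->
        h z = Hm z^-1 *m diag_mx (\row_j z ^ kappa j) *m Hp z].

(** A zero inside is written as z - a = z (1 - a / z), so [d] counts the zeros inside; the zeros
    outside stay in [q2]. *)
Lemma split_poly q : (forall z, circle z -> q.[z] != 0) ->
  exists (q1 q2 : {poly R[i]}) (d : nat), [/\
    forall z, closed_disk z -> q1.[z] != 0, forall z, closed_disk z -> q2.[z] != 0 &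
    forall z, z != 0 -> q.[z] = z ^+ d * q1.[z^-1] * q2.[z]].
Proof.
move=> q0; have [r qE] := closed_field_poly_normal q.
have lq : lead_coef q != 0.
  rewrite lead_coef_eq0; apply: contraTneq (q0 1 _) => [->|].
    by rewrite horner0 eqxx.
  by apply/circleE; rewrite mo1.
have hr a : a \in r -> mo a != 1.
  move=> ar; apply/eqP => /circleE /q0; rewrite qE hornerZ horner_prod.
  by rewrite (big_rem a) //= hornerXsubC subrr mul0r mulr0 eqxx.
pose r1 := [seq a <- r | mo a < 1]; pose r2 := [seq a <- r | ~~ (mo a < 1)].
exists (\prod_(a <- r1) (1 - a *: 'X)), (lead_coef q *: \prod_(a <- r2) ('X - a%:P)), (size r1).
have nz (s : seq R[i]) (F : R[i] -> {poly R[i]}) z :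
    (forall a, a \in s -> (F a).[z] != 0) -> (\prod_(a <- s) F a).[z] != 0.
  by move=> hF; rewrite horner_prod prodf_seq_neq0; apply/allP => a /hF.
split.
- move=> z /closed_diskE z1; apply: nz => a; rewrite mem_filter => /andP[a1 _].
  rewrite !hornerE subr_eq0; apply/negP => /eqP E.
  have : mo (a * z) < 1.
    by rewrite moM; apply: le_lt_trans a1; rewrite ler_piMr ?mo_ge0.
  by rewrite -E mo1 ltxx.
- move=> z /closed_diskE z1; rewrite hornerZ mulf_neq0 //; apply: nz => a.
  rewrite mem_filter hornerXsubC subr_eq0 -leNgt => /andP[a1 /hr ha].
  apply: contraNneq ha => za; rewrite -za in a1 *.
  by rewrite eq_le z1.
- move=> z z0; rewrite {1}qE !hornerZ mulrCA; congr (_ * _).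
  have -> : \prod_(a <- r) ('X - a%:P) =
      \prod_(a <- r1) ('X - a%:P) * \prod_(a <- r2) ('X - a%:P).
    rewrite /r1 /r2 2!big_filter; exact: bigID.
  rewrite hornerM; congr (_ * _); rewrite !horner_prod.
  elim: r1 => [|a s IH]; first by rewrite !big_nil mulr1.
  rewrite !big_cons IH /= exprS hornerXsubC hornerD hornerN hornerZ hornerX hornerC.
  have -> : z - a = z * (1 - a * z^-1) by rewrite mulrBr mulr1 mulrCA divff ?mulr1.
  by rewrite mulrACA.
Qed.

(** A common denominator [q] reduces [h] to a polynomial matrix. After both are factored, the number
    of zeros of [q] inside is subtracted from every exponent. No zeros lie on the circle, so those
    not inside are off the closed disk. *)
Lemma wiener_hopf_exists h : rational_mx h -> (forall z, circle z -> h z \in unitmx) ->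
  exists kappa Hm Hp, wiener_hopf h kappa Hm Hp.
Proof.
move=> hr hu.
have /choice[P0 hP0] : forall u : 'I_n * 'I_n, exists x : {poly R[i]} * {poly R[i]},
    forall z, circle z -> x.2.[z] != 0 /\ h z u.1 u.2 = x.1.[z] / x.2.[z].
  by move=> [i j]; have [p [q hpq]] := hr i j; exists (p, q).
pose q := \prod_u (P0 u).2.
pose P : 'M[{poly R[i]}]_n := \matrix_(i, j) ((P0 (i, j)).1 * \prod_(u | u != (i, j)) (P0 u).2).
have q0 z : circle z -> q.[z] != 0.
  move=> cz; rewrite /q horner_prod; apply/prodf_neq0 => u _.
  by have [] := hP0 u z cz.
have hE z : circle z -> h z = q.[z]^-1 *: eval_mx z P.
  move=> cz; apply/matrixP => i j; rewrite mxE eval_mxE mxE.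
  have [x0 /= ->] := hP0 (i, j) z cz.
  have qz := q0 z cz; rewrite /q (bigD1 (i, j)) //= hornerM in qz *.
  have := qz; rewrite mulf_eq0 negb_or => /andP[_ y0].
  by rewrite hornerM [RHS]mulrC invfM [X in _ = _ * X]mulrC mulrA mulfK.
have dP z : circle z -> (\det P).[z] != 0.
  move=> cz; have := hu z cz; rewrite (hE z cz) unitmxE detZ unitfE mulf_eq0 negb_or.
  by rewrite det_eval_mx => /andP[].
have c1 : circle (1 : R[i]) by apply/circleE; rewrite mo1.
have dP0 : \det P != 0.
  by apply: contraTneq (dP 1 c1) => ->; rewrite horner0 eqxx.
have [kappa [M [B [PE hM hB]]]] := @birkhoff _ n (fun a : R[i] => mo a < 1) P dP0.
have [q1 [q2 [d [q10 q20 qE]]]] := split_poly q0.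
exists (fun j => (kappa j)%:Z - d%:Z), (fun u => q1.[u]^-1 *: eval_mx u M),
  (fun z => q2.[z]^-1 *: eval_mx z B); split.
- exists M, q1; split=> // z /closed_diskE z1; apply/negP => /hM[a [_ a1 az]].
  have : mo (a * z) < 1.
    by rewrite moM; apply: le_lt_trans a1; rewrite ler_piMr ?mo_ge0.
  by rewrite az mo1 ltxx.
- exists B, q2; split=> // z /closed_diskE z1; apply/negP => /hB[dz].
  rewrite -leNgt => z1'; have /dP : circle z by apply/circleE/eqP; rewrite eq_le z1.
  by move: dz; rewrite /root => ->.
move=> z cz; have z0 : z != 0 by rewrite -mo_gt0 (circleE z).1.
rewrite (hE z cz) PE // qE // !invfM.
have -> : diag_mx (\row_j z ^ ((kappa j)%:Z - d%:Z)) =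
    z ^- d *: diag_mx (\row_j z ^+ kappa j).
  apply/matrixP => i j; rewrite !mxE expfzDr // mulrnAr; congr (_ *+ _).
  by rewrite mulrC -exprnN.
rewrite -!(scalemxAl, scalemxAr) !scalerA; congr (_ *: _).
by rewrite mulrC mulrA mulrAC.
Qed.

Lemma wiener_hopf_reflect h kappa Hm Hp : wiener_hopf h kappa Hm Hp ->
  wiener_hopf (fun z => (h z^-1)^T) (fun j => - kappa j) (fun z => (Hp z)^T)
    (fun z => (Hm z)^T).
Proof.
move=> [um up hE]; split; try exact: rational_unit_tr.
move=> z cz; rewrite hE; last exact: circleV.
rewrite invrK !trmx_mul mulmxA; congr (_ *m _ *m _).
by rewrite tr_diag_mx; congr diag_mx; apply/rowP => j; rewrite !mxE exprz_inv.
Qed.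

Lemma wiener_hopf_ge0 f (K : R) z0 kappa Hm Hp j : lipschitz1 f K -> circle z0 ->
  wiener_hopf (f z0) kappa Hm Hp -> ~ near_kernel f -> 0 <= kappa j.
Proof.
move=> fK cz0 [um up hE] nk; rewrite leNgt; apply/negP => kj; apply: nk.
apply: (@near_kernel_intro R n f K z0 (fun w => col j (invmx (Hp w)))
  (fun u => col j (Hm u)) (kappa j)) => //.
- have u0 := rational_unit_unitmx up closed_disk0; apply/negP => /eqP E.
  have : Hp 0 *m col j (invmx (Hp 0)) = col j 1%:M by rewrite !colE mulmxA mulmxV.
  rewrite E mulmx0 => /matrixP /(_ j 0); rewrite !mxE eqxx => /eqP.
  by rewrite eq_sym oner_eq0.
- by move=> i; apply: disk_approx_eq (rational_unit_approx_inv i j up) => z _; rewrite mxE.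
- by move=> i; apply: disk_approx_eq (rational_unit_approx i j um) => z _; rewrite mxE.
move=> w cw; have uw := rational_unit_unitmx up (circle_closed_disk cw).
rewrite (hE w cw) [X in _ *m X]colE -!mulmxA [Hp w *m _]mulmxA mulmxV // mul1mx.
have -> : diag_mx (\row_j w ^ kappa j) *m delta_mx j 0 = w ^ kappa j *: delta_mx j (0 : 'I_1).
  apply/matrixP => k l; rewrite ord1 mul_diag_mx !mxE.
  by have [->|] := eqVneq k j; rewrite ?eqxx // !mulr0.
by rewrite -scalemxAr -colE.
Qed.

Lemma wiener_hopf_trivial f z0 kappa Hm Hp : rational2_mx f ->
  ~ near_kernel f -> ~ near_kernel (reflect_tr f) -> circle z0 ->
  wiener_hopf (f z0) kappa Hm Hp -> kappa = fun=> 0.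
Proof.
move=> rf nk nk' cz0 wh; have [K fK] := rational2_lipschitz rf.
apply/funext => j; apply/eqP; rewrite eq_le (wiener_hopf_ge0 j fK cz0 wh nk) andbT.
rewrite -oppr_ge0; apply: (@wiener_hopf_ge0 (reflect_tr f) K z0^-1 (fun j => - kappa j)
   (fun z => (Hp z)^T) (fun z => (Hm z)^T) j) => //.
- exact: reflect_tr_lipschitz.
- exact: circleV.
- by have := wiener_hopf_reflect wh; rewrite /reflect_tr invrK.
Qed.

End rational_units.

(** * Extensions to the Riemann sphere and uniqueness of the indices *)

Section riemann_sphere.
Context {R : realType} {n : nat}.
Implicit Types (H h M P : R[i] -> 'M[R[i]]_n) (z u : R[i]).

Lemma derivable_comp_inv (V : normedModType R[i]) (e : R[i] -> V) z : z != 0 ->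
  derivable e z^-1 1 -> derivable (fun u => e u^-1) z 1.
Proof.
move=> z0 de; apply/derivable1_diffP; apply: (@differentiable_comp _ _ _ _ (fun u => u^-1) e).
  by apply/derivable1_diffP; apply: derivableV => //; exact: derivable_id.
exact/derivable1_diffP.
Qed.

Lemma nbhs_SomeP z (Q : one_point_compactification R[i] -> Prop) :
  (\forall s \near (Some z : one_point_compactification R[i]), Q s) <->
  \forall u \near z, Q (Some u).
Proof. by []. Qed.

Lemma nbhs_NoneP (Q : one_point_compactification R[i] -> Prop) :
  (\forall s \near (None : one_point_compactification R[i]), Q s) <->
  Q None /\ exists r : R, forall u, r < mo u -> Q (Some u).
Proof.
split=> [[K [cK _] KQ]|[Q0 [r hr]]].
  split; first by apply: KQ; right.
  have [M _ hM] := @compact_mo_bounded R _ K (fun u => u) cK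
    (continuous_subspaceT (fun u => @cvg_id _ _)).
  exists M => u Mu; apply: KQ; left; exists u => // /hM.
  by rewrite leNgt Mu.
exists [set u | mo u <= r].
  by split; [exact: compact_mo_le | exact: closed_mo_le].
move=> s [[u /= /negP ur <-]|->] //; apply: hr; by rewrite ltNge.
Qed.

Lemma sphere_inv0 : sphere_inv (0 : R[i]) = None.
Proof. by rewrite /sphere_inv eqxx. Qed.

Lemma sphere_inv_neq0 u : u != 0 -> sphere_inv u = Some u^-1.
Proof. by rewrite /sphere_inv => /negPf ->. Qed.

Lemma sphere_inv_exterior u : closed_disk u -> closed_exterior (sphere_inv u).
Proof.
move=> /closed_diskE u1; have [->|u0] := eqVneq u 0; first by rewrite sphere_inv0.
rewrite sphere_inv_neq0 // /closed_exterior /= normr_mo (lecR 1) moV.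
by rewrite invf_ge1 // mo_gt0.
Qed.

Lemma continuous_inv_mo z (r : R) : z != 0 -> 0 < r ->
  exists2 s : R, 0 < s & forall u, mo (u - z) < s -> u != 0 /\ mo (u^-1 - z^-1) < r.
Proof.
move=> z0 r0; have : u^-1 @[u --> z] --> z^-1 by exact: (inv_continuous z0).
move=> /cvg_moP /(_ r r0) /nbhs_moP[s s0 hs].
exists (Num.min s (mo z)); first by rewrite lt_min s0 mo_gt0.
move=> u; rewrite lt_min => /andP[us uz]; split; last exact: hs.
by apply: contraTneq uz => ->; rewrite sub0r moN ltxx.
Qed.

Lemma continuous_sphere_inv : continuous (@sphere_inv R).
Proof.
move=> u Q; have [->|u0] := eqVneq u 0.
  rewrite sphere_inv0 => /nbhs_NoneP[Q0 [r hr]].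
  have r1 : 0 < `|r| + 1 by rewrite ltr_wpDl.
  apply/nbhs_moP; exists (`|r| + 1)^-1; first by rewrite invr_gt0.
  move=> w; rewrite subr0 => hw; rewrite /=; have [->|w0] := eqVneq w 0.
    by rewrite sphere_inv0.
  rewrite sphere_inv_neq0 //; apply: hr; rewrite moV.
  have : `|r| + 1 < (mo w)^-1 by rewrite -[`|r| + 1]invrK ltf_pV2 ?posrE ?invr_gt0 ?mo_gt0.
  have := ler_norm r; lra.
rewrite sphere_inv_neq0 // => /nbhs_SomeP /nbhs_moP[r r0 hr].
have [s s0 hs] := continuous_inv_mo u0 r0.
apply/nbhs_moP; exists s => // w /hs[w0 hw] /=.
by rewrite sphere_inv_neq0 //; exact: hr.
Qed.

Lemma within_continuous_sphere_inv (T : topologicalType)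
    (e : one_point_compactification R[i] -> T) :
  {within closed_exterior, continuous e} ->
  {within closed_disk, continuous (fun u => e (sphere_inv u))}.
Proof.
move=> /subspace_continuousP he; apply/subspace_continuousP => u Du Q hQ.
have := he _ (sphere_inv_exterior Du) Q hQ => /continuous_sphere_inv.
rewrite /nbhs /= !nbhs_simpl; apply: filterS => w /= hw Dw.
exact: hw (sphere_inv_exterior Dw).
Qed.

Definition exterior_extension H (s : one_point_compactification R[i]) : 'M[R[i]]_n :=
  if s is Some z then H z^-1 else H 0.

Lemma exterior_extension_inv H u : exterior_extension H (sphere_inv u) = H u.
Proof.
have [->|u0] := eqVneq u 0; first by rewrite sphere_inv0.
by rewrite sphere_inv_neq0 //= invrK.
Qed.

Lemma continuous_exterior_extension H : holomorphic_mx H ->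
  {within closed_exterior, continuous (exterior_extension H)}.
Proof.
move=> hH; apply/within_continuous_mxP => i j.
have [/within_moP hc _] := hH i j.
have ext u : closed_exterior (Some u : one_point_compactification R[i]) ->
    u != 0 /\ closed_disk u^-1.
  rewrite /closed_exterior /= normr_mo (lecR 1) => u1.
  have u0 : 0 < mo u by exact: lt_le_trans u1.
  split; first by rewrite -mo_gt0.
  by apply/closed_diskE; rewrite moV invf_le1.
apply/subspace_continuousP => -[z|] Ez; apply/cvg_moP => r r0; rewrite near_withinE.
  have [z0 Dz] := ext z Ez; have [s s0 hs] := hc _ Dz r r0.
  have [t t0 ht] := continuous_inv_mo z0 s0.
  apply/nbhs_SomeP/nbhs_moP; exists t => // w /ht[w0 hw] /ext[_ Dw].
  exact: hs.
have [s s0 hs] := hc _ closed_disk0 r r0.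
apply/nbhs_NoneP; split; first by rewrite subrr mo0.
exists s^-1 => u su /ext[u0 Du]; apply: hs => //.
by rewrite subr0 moV -[s]invrK ltf_pV2 ?posrE ?invr_gt0 ?mo_gt0.
Qed.

Lemma rational_unit_minus H : rational_unit H ->
  minus_extension (fun z => H z^-1) (exterior_extension H).
Proof.
move=> uH; have hH := rational_unit_holomorphic uH; split.
- by [].
- exact: continuous_exterior_extension.
- move=> [z|] Ez; last exact: rational_unit_unitmx uH closed_disk0.
  apply: rational_unit_unitmx uH _; apply/closed_diskE; move: Ez.
  rewrite /closed_exterior /= normr_mo (lecR 1) => z1.
  by rewrite moV invf_le1 // (lt_le_trans ltr01).
- move=> z; rewrite normr_mo (ltcR 1) => z1.
  have z0 : z != 0 by rewrite -mo_gt0 (lt_trans ltr01).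
  apply: derivable_comp_inv => //; apply/derivable_mx_coordP => i j.
  have [_] := hH i j; apply; apply/open_diskE.
  by rewrite moV invf_lt1 // (lt_trans ltr01).
- have -> : (fun u => exterior_extension H (sphere_inv u)) = H.
    by apply/funext => u; exact: exterior_extension_inv.
  apply/derivable_mx_coordP => i j; have [_] := hH i j; apply.
  by apply/open_diskE; rewrite mo0.
Qed.

Lemma rational_unit_plus H : rational_unit H -> plus_extension H H.
Proof.
move=> uH; have hH := rational_unit_holomorphic uH; split.
- by [].
- by apply/within_continuous_mxP => i j; have [] := hH i j.
- by move=> z Dz; exact: rational_unit_unitmx.
- by move=> z Dz; apply/derivable_mx_coordP => i j; have [_] := hH i j; apply.
Qed.

Lemma wiener_hopf_factorization h Hm Hp : rational_mx h ->
  (forall z, circle z -> h z \in unitmx) -> wiener_hopf h (fun=> 0) Hm Hp ->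
  right_factorization h (fun=> 0) (fun z => Hm z^-1) (exterior_extension Hm) Hp Hp.
Proof.
move=> hr hu [um up hE]; split=> //.
- by split; [exact: rational_unit_rational_inv | exact: rational_unit_minus].
- by split; [exact: rational_unit_rational | exact: rational_unit_plus].
Qed.

(** The chart 1/z carries the exterior to the disk. Differentiability at 0 is the condition at
    infinity; elsewhere the chain rule applies, as [sphere_inv] is plain inversion near a nonzero
    point. *)
Lemma minus_extension_holomorphic h he : minus_extension h he ->
  holomorphic_mx (fun u => he (sphere_inv u)).
Proof.
move=> [_ hc _ hd hd0] i j.
have /within_continuous_mxP/(_ i j) hc' := within_continuous_sphere_inv hc.
split=> // u /open_diskE u1; have [->|u0] := eqVneq u 0.
  by move: hd0 => /derivable_mx_coordP/(_ i j).
have /derivable_mx_coordP/(_ i j) d : derivable (fun u => he (Some u)) u^-1 1.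
  by apply: hd; rewrite normr_mo (ltcR 1) moV invf_gt1 ?mo_gt0.
apply: near_eq_derivable (derivable_comp_inv u0 d).
apply/nbhs_moP; exists (mo u); first by rewrite mo_gt0.
move=> w hw; rewrite sphere_inv_neq0 //.
by apply: contraTneq hw => ->; rewrite sub0r moN ltxx.
Qed.

Lemma plus_extension_holomorphic h he : plus_extension h he -> holomorphic_mx he.
Proof.
move=> [_ hc _ hd] i j; split; first by move: hc => /within_continuous_mxP/(_ i j).
by move=> z /hd /derivable_mx_coordP.
Qed.

Lemma right_factorization_circle h kappa hm hme hp hpe z :
  right_factorization h kappa hm hme hp hpe -> circle z ->
  h z = hme (sphere_inv z^*) *m diag_mx (\row_j z ^ kappa j) *m hpe z.
Proof.
move=> [_ _ [_ [hm1 _ _ _ _]] [_ [hp1 _ _ _]] hE] cz; rewrite hE // hp1 //.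
have z1 := (circleE z).1 cz.
by rewrite conj_circle // sphere_inv_neq0 ?invrK ?hm1 // invr_eq0 -mo_gt0 z1.
Qed.

Lemma right_factorization_pair h hm hme hp hpe :
  right_factorization h (fun=> 0) hm hme hp hpe ->
  canonical_pair h (fun u => hme (sphere_inv u)) hpe.
Proof.
move=> hf; have [_ _ [_ hm1] [_ hp1] _] := hf; split.
- exact: minus_extension_holomorphic hm1.
- exact: plus_extension_holomorphic hp1.
- by move=> u Du; have [_ _ hu _ _] := hm1; apply: hu; exact: sphere_inv_exterior.
- by move=> u Du; have [_ _ hu _] := hp1; exact: hu.
move=> z cz; rewrite (right_factorization_circle hf cz).
have -> : diag_mx (\row_j z ^ (fun=> 0 : int) j) = 1%:M :> 'M[R[i]]_n.
  by apply/matrixP => i j; rewrite !mxE expr0z.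
by rewrite mulmx1.
Qed.

Lemma wiener_hopf_pair h Hm Hp : wiener_hopf h (fun=> 0) Hm Hp ->
  canonical_pair h Hm Hp.
Proof.
move=> [um up hE]; split; try exact: rational_unit_holomorphic.
- by move=> z; exact: rational_unit_unitmx.
- by move=> z; exact: rational_unit_unitmx.
move=> z cz; rewrite hE // conj_circle; last exact/circleE.
have -> : diag_mx (\row_j z ^ (fun=> 0 : int) j) = 1%:M :> 'M[R[i]]_n.
  by apply/matrixP => i j; rewrite !mxE expr0z.
by rewrite mulmx1.
Qed.

Lemma unitmx_row_neq0 (A : 'M[R[i]]_n) j : A \in unitmx -> row j A != 0.
Proof.
move=> uA; apply/negP => /eqP E; have : row j A *m invmx A = row j 1%:M.
  by rewrite -row_mul mulmxV.
rewrite E mul0mx => /matrixP/(_ 0 j); rewrite !mxE eqxx => /eqP.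
by rewrite eq_sym oner_eq0.
Qed.

(** Reflection carries the relation to 0, where its right-hand side vanishes, so X 0 has a zero
    row. *)
Lemma reflection_row k (X Y : R[i] -> 'M[R[i]]_n) j : holomorphic_mx X ->
  holomorphic_mx Y -> (forall z, circle z -> row j (X z^*) = z ^+ k.+1 *: row j (Y z)) ->
  X 0 \notin unitmx.
Proof.
move=> hX hY XY; apply/negP => uX.
have hXr : holomorphic_mx (fun u => row j (X u)).
  by move=> a b; apply: holomorphic_eq (hX j b) => z _; rewrite mxE.
have hYr : holomorphic_mx (fun u => u ^+ k.+1 *: row j (Y u)).
  move=> a b; apply: (@holomorphic_eq _ (fun u => ('X^(k.+1)).[u] * Y u j b)).
    by move=> z _; rewrite !mxE hornerXn.
  exact: holomorphicM (holomorphic_horner _) (hY j b).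
have := reflection_mx hYr hXr XY closed_disk0; rewrite conjC0 expr0n scale0r => E.
by have := unitmx_row_neq0 j uX; rewrite E eqxx.
Qed.

(* If some index were nonzero, then a row of an invertible quotient of the minus
   factors (or a column, depending on the sign) would vanish at infinity. *)
Lemma canonical_pair_indices h M P kappa : canonical_pair h M P ->
  partial_indices h kappa -> forall j, kappa j = 0.
Proof.
move=> [hM hP uM uP hE] [hm [hme [hp [hpe hf]]]] j.
have [_ _ [_ hm1] [_ hp1] _] := hf.
pose M' u := hme (sphere_inv u).
have hM' : holomorphic_mx M' := minus_extension_holomorphic hm1.
have hP' := plus_extension_holomorphic hp1.
have uM' u : closed_disk u -> M' u \in unitmx.
  by move=> Du; have [_ _ hu _ _] := hm1; apply: hu; exact: sphere_inv_exterior.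
have uP' u : closed_disk u -> hpe u \in unitmx.
  by move=> Du; have [_ _ hu _] := hp1; exact: hu.
have key z : circle z -> M z^* *m P z = M' z^* *m diag_mx (\row_j z ^ kappa j) *m hpe z.
  by move=> cz; rewrite -hE // (right_factorization_circle hf cz).
case E : (kappa j) => [[|k]|k] //; exfalso.
  apply: (negP (@reflection_row k (fun u => invmx (M' u) *m M u)
    (fun u => hpe u *m invmx (P u)) j _ _ _)).
  - exact: holomorphic_mulmx (holomorphic_invmx uM' hM') hM.
  - exact: holomorphic_mulmx hP' (holomorphic_invmx uP hP).
  - move=> z cz; have Dz := circle_closed_disk cz; have Dz' := closed_disk_conj Dz.
    have -> : M z^* = M' z^* *m diag_mx (\row_j z ^ kappa j) *m hpe z *m invmx (P z).
      by rewrite -key // mulmxK ?uP.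
    rewrite !mulmxA mulVmx ?uM' // mul1mx -mulmxA row_mul.
    by rewrite row_diag_mx -scalemxAl -rowE mxE E.
  - by rewrite unitmx_mul unitmx_inv uM' ?uM //; exact: closed_disk0.
apply: (negP (@reflection_row k (fun u => (invmx (M u) *m M' u)^T)
  (fun u => (P u *m invmx (hpe u))^T) j _ _ _)).
- move=> a b; apply: holomorphic_eq (holomorphic_mulmx (holomorphic_invmx uM hM) hM' b a).
  by move=> z _; rewrite [RHS]mxE.
- move=> a b; apply: holomorphic_eq (holomorphic_mulmx hP (holomorphic_invmx uP' hP') b a).
  by move=> z _; rewrite [RHS]mxE.
- move=> z cz; have Dz := circle_closed_disk cz; have Dz' := closed_disk_conj Dz.
  have z0 : z != 0 by rewrite -mo_gt0 (circleE z).1.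
  have -> : P z = invmx (M z^*) *m (M' z^* *m diag_mx (\row_j z ^ kappa j) *m hpe z).
    by rewrite -key // mulKmx ?uM.
  rewrite !mulmxA mulmxK ?uP' //; move: (invmx _ *m M' _) => X.
  rewrite trmx_mul tr_diag_mx row_mul row_diag_mx -scalemxAl -rowE scalerA mxE E.
  by rewrite NegzE -exprnN mulfV ?expf_neq0 // scale1r.
- by rewrite unitmx_tr unitmx_mul unitmx_inv uM ?uM' //; exact: closed_disk0.
Qed.

Lemma canonical_extension_valueP h Hm Hp z A : rational_mx h ->
  (forall z, circle z -> h z \in unitmx) -> wiener_hopf h (fun=> 0) Hm Hp ->
  closed_disk z -> canonical_extension_value h z A <-> A = Hm z^* *m Hp z.
Proof.
move=> hr hu wh Dz; have pr := wiener_hopf_pair wh; split.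
  move=> [hm [hme [hp [hpe [hf ->]]]]].
  by rewrite conjcE (canonical_pair_unique (right_factorization_pair hf) pr Dz).
move=> ->; exists (fun z => Hm z^-1), (exterior_extension Hm), Hp, Hp.
split; first exact: wiener_hopf_factorization.
by rewrite conjcE exterior_extension_inv.
Qed.

Lemma wiener_hopf_trivial_indices h Hm Hp : rational_mx h ->
  (forall z, circle z -> h z \in unitmx) -> wiener_hopf h (fun=> 0) Hm Hp ->
  trivial_partial_indices h.
Proof.
move=> hr hu wh; split; last first.
  by move=> kappa hk; exact: canonical_pair_indices (wiener_hopf_pair wh) hk.
exists (fun=> 0), (fun z => Hm z^-1), (exterior_extension Hm), Hp, Hp.
exact: wiener_hopf_factorization.
Qed.

End riemann_sphere.

(** * Continuity in parameters *)

Section parametric_continuity.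
Context {R : realType} {n : nat}.

Lemma holomorphic_mx_bounded (H : R[i] -> 'M[R[i]]_n) : holomorphic_mx H ->
  exists2 S : R, 0 < S & forall z, closed_disk z -> nsq (H z) <= S.
Proof.
move=> hH.
have /choice[K hK] : forall u : 'I_n * 'I_n, exists K : R, 0 < K /\
    forall z, closed_disk z -> mo (H z u.1 u.2) <= K.
  move=> [i j]; have [K K0 h] := compact_mo_bounded (@compact_closed_disk R) (hH i j).1.
  by exists K.
exists (\sum_i \sum_j K (i, j) ^+ 2 + 1).
  by rewrite ltr_wpDl // !sumr_ge0 // => i _; rewrite sumr_ge0 // => j _; exact: sqr_ge0.
move=> z Dz; apply: (@le_trans _ _ (\sum_i \sum_j K (i, j) ^+ 2)); last by rewrite lerDl.
apply: ler_sum => i _; apply: ler_sum => j _; have [K0 h] := hK (i, j).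
by apply: lerXn2r; rewrite ?nnegrE ?mo_ge0 ?(ltW K0) //; exact: h.
Qed.

Lemma within_continuous_comp (T U S : topologicalType) (A : set T) (B : set U)
    (phi : U -> T) (e : T -> S) : continuous phi -> (forall u, B u -> A (phi u)) ->
  {within A, continuous e} -> {within B, continuous (fun u => e (phi u))}.
Proof.
move=> cphi BA /subspace_continuousP he; apply/subspace_continuousP => u Bu Q hQ.
have h : nbhs u (fun w => A (phi w) -> Q (e (phi w))).
  exact: cphi (he _ (BA _ Bu) Q hQ).
have : nbhs u (fun w => B w -> Q (e (phi w))).
  by apply: filterS h => w hw Bw; exact: hw (BA _ Bw).
exact.
Qed.

Lemma cvg_det m (T : Type) (F : set_system T) (FF : Filter F)
    (H : T -> 'M[R[i]]_m) (A : 'M[R[i]]_m) :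
  (forall i j, H t i j @[t --> F] --> A i j) -> \det (H t) @[t --> F] --> \det A.
Proof.
move=> HA; apply: cvg_sumr => s; apply: cvgM; first exact: cvg_cst.
elim: (index_enum 'I_m) => [|i r IH].
  by rewrite big_nil; under eq_fun do rewrite big_nil; exact: cvg_cst.
rewrite big_cons; under eq_fun do rewrite big_cons.
exact: (cvgM (HA i _) IH).
Qed.

Lemma within_continuous_invmx (T : topologicalType) (A : set T) (H : T -> 'M[R[i]]_n) :
  (forall t, A t -> H t \in unitmx) -> {within A, continuous H} ->
  {within A, continuous (fun t => invmx (H t))}.
Proof.
move=> uH /within_continuous_mxP hH; apply/within_continuous_mxP => i j.
apply: (@subspace_eq_continuous _ _ _ (fun t => (\det (H t))^-1 * cofactor (H t) j i)).
  move=> t; rewrite inE => At; have ut := uH t At.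
  by rewrite /from_subspace /= /invmx ut !mxE.
have cH t : A t -> forall i j, H u i j @[u --> within A (nbhs t)] --> H t i j.
  by move=> At a b; have /subspace_continuousP := hH a b; apply.
apply/subspace_continuousP => t At; apply: cvgM.
  apply: cvgV; last exact: cvg_det (cH t At).
  by have := uH t At; rewrite unitmxE unitfE.
apply: cvgM; first exact: cvg_cst.
apply: cvg_det => a b; rewrite !mxE; under eq_fun do rewrite !mxE.
exact: cH.
Qed.

(** A tube argument over the compact circle turns joint continuity into the uniform closeness that
    [canonical_lipschitz] takes as hypothesis. The local bound d / 4 is used at y and at y0, and 2
    (d / 4) + 2 (d / 4) = d. *)
Lemma compact_circle_near (Y : topologicalType) (C : set Y)
    (g : Y -> R[i] -> 'M[R[i]]_n) y0 (d : R) : C y0 -> 0 < d ->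
  {within C `*` circle, continuous (fun p => g p.1 p.2)} ->
  \forall y \near y0, C y -> forall z, circle z -> nsq (g y z - g y0 z) <= d.
Proof.
move=> Cy0 d0 /within_continuous_mxP gc.
suff : \forall y \near within C (nbhs y0),
    circle `<=` (fun z => circle z -> nsq (g y z - g y0 z) <= d).
  by rewrite near_withinE; apply: filterS => y h Cy z cz; exact: (h Cy z cz cz).
have /compact_near_coveringP cov := @compact_circle R.
apply: (cov Y (within C (nbhs y0)) (fun y z => circle z -> nsq (g y z - g y0 z) <= d)) => z0 cz0.
pose D (p : Y * R[i]) := g p.1 p.2 - g y0 z0.
have : nsq (D p) @[p --> within (C `*` circle) (nbhs (y0, z0))] --> nsq (0 : 'M[R[i]]_n).
  apply: cvg_nsq => i j; rewrite mxE -(subrr (g y0 z0 i j)).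
  under eq_fun do rewrite mx_subE.
  apply: cvgB; last exact: cvg_cst.
  by have /subspace_continuousP := gc i j; apply.
have -> : nsq (0 : 'M[R[i]]_n) = 0.
  by rewrite /nsq big1 // => i _; rewrite big1 // => j _; rewrite mxE mo0 expr0n.
move=> /cvgrPdist_lt/(_ (d / 4)); rewrite near_withinE => /(_ (divr_gt0 d0 (ltr0n R 4))).
case=> -[U W] /= [nU nW] UW.
have small y z : U y -> W z -> C y -> circle z -> nsq (D (y, z)) <= d / 4.
  move=> Uy Wz Cy cz; have := UW (y, z) (conj Uy Wz) (conj Cy cz).
  by rewrite sub0r normrN => /ltW; apply: le_trans; exact: ler_norm.
exists (W, U `&` C) => /=; first by split=> //; apply: filterS nU => y Uy Cy.
move=> [z y] /= [Wz [Uy Cy]] cz.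
have Uy0 := nbhs_singleton nU.
have := nsqB (D (y, z)) (D (y0, z)); rewrite /D /= opprB addrA subrK => h.
have h1 := small y z Uy Wz Cy cz; have h2 := small y0 z Uy0 Wz Cy0 cz.
apply: le_trans h _; move: h1 h2; rewrite /D /=.
move: (nsq _) (nsq _) => a b; lra.
Qed.

(* The factors themselves need not depend continuously on [y]. *)
Lemma canonical_value_continuous (Y : topologicalType) (C : set Y)
    (g M P : Y -> R[i] -> 'M[R[i]]_n) :
  {within C `*` circle, continuous (fun p => g p.1 p.2)} ->
  (forall y, C y -> canonical_pair (g y) (M y) (P y)) ->
  {within C `*` closed_disk, continuous (fun p => M p.1 p.2^* *m P p.1 p.2)}.
Proof.
move=> gc pr.
(* The stability estimate concerns inverses, so continuity is proved for [E] and transferred by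
   matrix inversion. *)
pose E (p : Y * R[i]) := invmx (P p.1 p.2) *m invmx (M p.1 p.2^*).
have uM p : (C `*` closed_disk) p -> M p.1 p.2^* \in unitmx.
  by move=> [/pr[_ _ h _ _] Dp]; apply: h; exact: closed_disk_conj.
have uP p : (C `*` closed_disk) p -> P p.1 p.2 \in unitmx.
  by move=> [/pr[_ _ _ h _] Dp]; exact: h.
have uE p : (C `*` closed_disk) p -> E p \in unitmx.
  by move=> hp; rewrite unitmx_mul !unitmx_inv uM ?uP.
suff : {within C `*` closed_disk, continuous E}.
  move=> /(within_continuous_invmx uE).
  apply: subspace_eq_continuous => p; rewrite inE => hp.
  rewrite /from_subspace /= /E; apply: (can_inj (@trmxK _ _ _)); congr trmx.
  have h : (invmx (P p.1 p.2) *m invmx (M p.1 p.2^*)) *m (M p.1 p.2^* *m P p.1 p.2) = 1%:M.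
    by rewrite mulmxA mulmxKV ?uM // mulVmx ?uP.
  by rewrite -[RHS](mulKmx (uE p hp)) /E h mulmx1.
apply/within_continuous_mxP => i j; apply/subspace_continuousP => -[y0 a0] [/= Cy0 Da0].
apply/cvg_moP => r r0; rewrite near_withinE.
have [hM hP uM0 uP0 hg] := pr y0 Cy0.
have hiP := holomorphic_invmx uP0 hP; have hiM := holomorphic_invmx uM0 hM.
have [S0 S00 hS0] := holomorphic_mx_bounded hiP.
have [S1 S10 hS1] := holomorphic_mx_bounded hiM.
(* The first bound is the smallness hypothesis of [canonical_lipschitz], the second makes its
   conclusion at most (r / 4)^2. As S0 and S1 depend on y0 alone, this holds for all points of the
   disk at once; the variation in a at fixed y0 adds r / 2, in total 3r / 4. *)
pose d := Num.min (4 * S0 * S1)^-1 ((r / 4) ^+ 2 / (4 * S0 ^+ 2 * S1 ^+ 2)).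
have S4 : 0 < 4 * S0 * S1 by rewrite !mulr_gt0.
have S5 : 0 < 4 * S0 ^+ 2 * S1 ^+ 2 by rewrite !mulr_gt0 // exprn_gt0.
have d0 : 0 < d by rewrite lt_min invr_gt0 S4 divr_gt0 ?exprn_gt0 ?divr_gt0.
have d1 : 4 * S0 * S1 * d <= 1.
  by rewrite -[leRHS](divff (lt0r_neq0 S4)) ler_pM2l // ge_min lexx.
have d2 : 4 * d * S0 ^+ 2 * S1 ^+ 2 <= (r / 4) ^+ 2.
  have -> : 4 * d * S0 ^+ 2 * S1 ^+ 2 = d * (4 * S0 ^+ 2 * S1 ^+ 2) by ring.
  by rewrite -ler_pdivlMr // ge_min lexx orbT.
have nearY := compact_circle_near Cy0 d0 gc.
have hE0 : {within closed_disk, continuous (fun a => E (y0, a) i j)}.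
  have -> : (fun a => E (y0, a) i j) =
      fun a => \sum_k invmx (P y0 a) i k * invmx (M y0 a^*) k j.
    by apply/funext => a; rewrite mxE.
  apply/subspace_continuousP => a Da.
  apply: cvg_sumr => k; apply: cvgM.
    by have [/subspace_continuousP + _] := hiP i k; apply.
  have [c _] := hiM k j.
  have /subspace_continuousP := within_continuous_comp (@continuous_conjc R)
    (@closed_disk_conj R) c.
  exact.
have [s s0 hs] := (within_moP _ _).1 hE0 a0 Da0 (r / 2) (divr_gt0 r0 (ltr0n R 2)).
have nearA : \forall a \near a0, mo (a - a0) < s by apply/nbhs_moP; exists s.
exists ([set y | C y -> forall z, circle z -> nsq (g y z - g y0 z) <= d],
  [set a | mo (a - a0) < s]); first by split.
move=> [y a] [/= hy ha] [/= Cy Da].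
have := canonical_lipschitz (pr y Cy) (pr y0 Cy0) hS0 hS1 (hy Cy) (ltW d0) d1 Da.
move=> /le_trans/(_ d2) hl.
have h1 : mo (E (y0, a) i j - E (y, a) i j) <= r / 4.
  rewrite -(@ler_pXn2r _ 2) ?nnegrE ?mo_ge0 ?divr_ge0 ?(ltW r0) //.
  by apply: le_trans hl; rewrite -mx_subE; exact: le_entry_nsq.
have h2 := hs a Da ha.
have aux (x x' x'' : R[i]) : mo (x - x') <= r / 4 ->
    mo (x - x'') < r / 2 -> mo (x' - x'') < r.
  move=> k1 k2; have -> : x' - x'' = (x - x'') - (x - x') by rewrite opprB [RHS]addrC addrA subrK.
  apply: le_lt_trans (moB _ _) _; have := ler_ltD k1 k2; rewrite addrC => k3.
  apply: lt_trans k3 _; have -> : r / 4 + r / 2 = r * (3 / 4) by field.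
  by rewrite gtr_pMr // ltr_pdivrMr // mul1r ltr_nat.
exact: aux h1 h2.
Qed.

End parametric_continuity.

(** * Triviality of the indices and extension to the 3-sphere *)

Lemma rational2_section {R : realType} {n : nat} (f : R[i] -> R[i] -> 'M[R[i]]_n) z :
  rational2_mx f -> circle z -> rational_mx (f z).
Proof.
move=> hf cz i j; have [p [q h]] := hf i j; exists p.[z%:P], q.[z%:P] => w cw.
exact: h.
Qed.

Lemma fredholm_section {R : realType} {n : nat} (f : R[i] -> R[i] -> 'M[R[i]]_n) :
  (0 < n)%N -> (forall z w, circle z -> circle w -> f z w \in unitmx) ->
  rational2_mx f ->
  (exists T, is_quarter_plane_toeplitz f T /\ fredholm T) ->
  (forall z, circle z -> exists H : (R[i] -> 'M[R[i]]_n) * (R[i] -> 'M[R[i]]_n),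
    wiener_hopf (f z) (fun=> 0) H.1 H.2) /\
  (forall w, circle w -> exists H : (R[i] -> 'M[R[i]]_n) * (R[i] -> 'M[R[i]]_n),
    wiener_hopf (fun z => f z w) (fun=> 0) H.1 H.2).
Proof.
move=> n0 fu fr [T [hT FT]]; have hf := rational2_bounded fr.
have nk := fredholm_not_near_kernel n0 hf hT FT.
have nk' := fredholm_not_near_cokernel n0 hf hT FT.
split=> [z cz|w cw].
  have [kappa [Hm [Hp wh]]] := wiener_hopf_exists (rational2_section fr cz)
    (fun w cw => fu z w cz cw).
  by exists (Hm, Hp); move: wh => /[dup] /(wiener_hopf_trivial fr nk nk' cz) ->.
have fr' := rational2_swap fr.
have [kappa [Hm [Hp wh]]] := wiener_hopf_exists (rational2_section fr' cw)
  (fun z cz => fu z w cz cw).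
(* Reflection and exchange of the variables commute by conversion, so [near_kernel_swap] serves both
   symbols. *)
have := wiener_hopf_trivial fr' (fun h => nk (near_kernel_swap h))
  (fun h => nk' (near_kernel_swap h)) cw wh.
by move=> kE; exists (Hm, Hp); rewrite -kE.
Qed.

Lemma continuous_pair (T U V : topologicalType) (e : T -> U) (g : T -> V) :
  continuous e -> continuous g -> continuous (fun t => (e t, g t)).
Proof. by move=> ce cg t; exact: (cvg_pair (ce t) (cg t)). Qed.

Theorem proposition3p4 (R : realType) (X : topologicalType) (n : nat)
    (n_gt0 : (0 < n)%N) (f : R[i] -> R[i] -> X -> 'M[R[i]]_n)
    (f_cont : {within (circle `*` circle) `*` [set: X],
       continuous (fun p : R[i] * R[i] * X => f p.1.1 p.1.2 p.2)})
    (f_unit : forall z w x, circle z -> circle w -> f z w x \in unitmx)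
    (f_rational : forall x, rational2_mx (fun z w => f z w x))
    (f_fredholm : forall x, exists T,
       is_quarter_plane_toeplitz (fun z w => f z w x) T /\ fredholm T) :
  [/\ forall x z, circle z -> trivial_partial_indices (fun w => f z w x),
      forall x w, circle w -> trivial_partial_indices (fun z => f z w x) &
      exists fE : R[i] -> R[i] -> X -> 'M[R[i]]_n,
        [/\ forall x z w, circle z -> closed_disk w ->
              forall A, canonical_extension_value (fun w' => f z w' x) w A <->
                        A = fE z w x,
            forall x z w, closed_disk z -> circle w ->
              forall A, canonical_extension_value (fun z' => f z' w x) z A <->
                        A = fE z w x,
            {within sphere3 `*` [set: X],
               continuous (fun p : R[i] * R[i] * X => fE p.1.1 p.1.2 p.2)},
            forall z w x, sphere3 (z, w) -> fE z w x \in unitmx &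
            forall z w x, circle z -> circle w -> fE z w x = f z w x]].
Proof.
have sec x := fredholm_section n_gt0 (fun z w => f_unit z w x) (f_rational x) (f_fredholm x).
have r1 x z : circle z -> rational_mx (fun w => f z w x).
  exact: rational2_section (f_rational x).
have r2 x w : circle w -> rational_mx (fun z => f z w x).
  exact: rational2_section (rational2_swap (f_rational x)).
(* A factorization is chosen for every parameter, without any continuity; off the circle the premise
   is false and a dummy serves. *)
have /choice[H1 hH1] : forall y : R[i] * X,
    exists H : (R[i] -> 'M[R[i]]_n) * (R[i] -> 'M[R[i]]_n), circle y.1 ->
    wiener_hopf (fun w => f y.1 w y.2) (fun=> 0) H.1 H.2.
  move=> [z x]; have [cz|ncz] := pselect (circle z).
    by have [H hH] := (sec x).1 z cz; exists H.
  by exists (fun=> 0, fun=> 0).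
have /choice[H2 hH2] : forall y : R[i] * X,
    exists H : (R[i] -> 'M[R[i]]_n) * (R[i] -> 'M[R[i]]_n), circle y.1 ->
    wiener_hopf (fun z => f z y.1 y.2) (fun=> 0) H.1 H.2.
  move=> [w x]; have [cw|ncw] := pselect (circle w).
    by have [H hH] := (sec x).2 w cw; exists H.
  by exists (fun=> 0, fun=> 0).
have w1 x z : circle z -> wiener_hopf (fun w => f z w x) (fun=> 0) (H1 (z, x)).1 (H1 (z, x)).2.
  exact: hH1 (z, x).
have w2 x w : circle w -> wiener_hopf (fun z => f z w x) (fun=> 0) (H2 (w, x)).1 (H2 (w, x)).2.
  exact: hH2 (w, x).
pose E1 (p : R[i] * X * R[i]) := (H1 p.1).1 p.2^* *m (H1 p.1).2 p.2.
pose E2 (p : R[i] * X * R[i]) := (H2 p.1).1 p.2^* *m (H2 p.1).2 p.2.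
have E1f z w x : circle z -> circle w -> E1 ((z, x), w) = f z w x.
  by move=> cz cw; have [_ _ _ _ h] := wiener_hopf_pair (w1 x z cz); rewrite /E1 /= -h.
have E2f z w x : circle z -> circle w -> E2 ((w, x), z) = f z w x.
  by move=> cz cw; have [_ _ _ _ h] := wiener_hopf_pair (w2 x w cw); rewrite /E2 /= -h.
(* On the torus both branches equal f, which makes the definition unambiguous. *)
pose fE z w x := if pselect (circle z) then E1 ((z, x), w) else E2 ((w, x), z).
have fE1 z w x : circle z -> fE z w x = E1 ((z, x), w).
  by rewrite /fE; case: pselect.
have fE2 z w x : circle w -> fE z w x = E2 ((w, x), z).
  by move=> cw; rewrite /fE; case: pselect => // cz; rewrite E1f ?E2f.
split.
- move=> x z cz; apply: wiener_hopf_trivial_indices (w1 x z cz); first exact: r1.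
  by move=> w cw; exact: f_unit.
- move=> x w cw; apply: wiener_hopf_trivial_indices (w2 x w cw); first exact: r2.
  by move=> z cz; exact: f_unit.
exists fE; split.
- move=> x z w cz Dw A; rewrite fE1 //.
  by apply: canonical_extension_valueP (w1 x z cz) Dw;
    [exact: r1 | move=> w' cw'; exact: f_unit].
- move=> x z w Dz cw A; rewrite fE2 //.
  by apply: canonical_extension_valueP (w2 x w cw) Dz;
    [exact: r2 | move=> z' cz'; exact: f_unit].
(* On each half of the sphere the circle variable is grouped with x as the parameter and the disk
   variable comes last, the form required by [canonical_value_continuous]. *)
- pose C := (circle `*` [set: X] : set (R[i] * X)).
  pose rot1 (p : R[i] * R[i] * X) := ((p.1.1, p.2), p.1.2).
  pose rot2 (p : R[i] * R[i] * X) := ((p.1.2, p.2), p.1.1).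
  pose tor1 (p : R[i] * X * R[i]) := ((p.1.1, p.2), p.1.2).
  pose tor2 (p : R[i] * X * R[i]) := ((p.2, p.1.1), p.1.2).
  have c11 (U V W : topologicalType) : continuous (fun q : U * V * W => q.1.1).
    by move=> p; exact: (@cvg_comp _ _ _ fst fst _ (nbhs p.1) _ cvg_fst cvg_fst).
  have c12 (U V W : topologicalType) : continuous (fun q : U * V * W => q.1.2).
    by move=> p; exact: (@cvg_comp _ _ _ fst snd _ (nbhs p.1) _ cvg_fst cvg_snd).
  have c2 (U V W : topologicalType) : continuous (fun q : U * V * W => q.2).
    by move=> p; exact: cvg_snd.
  have crot1 : continuous rot1 :=
    continuous_pair (continuous_pair (@c11 _ _ _) (@c2 _ _ _)) (@c12 _ _ _).
  have crot2 : continuous rot2 :=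
    continuous_pair (continuous_pair (@c12 _ _ _) (@c2 _ _ _)) (@c11 _ _ _).
  have ctor1 : continuous tor1 :=
    continuous_pair (continuous_pair (@c11 _ _ _) (@c2 _ _ _)) (@c12 _ _ _).
  have ctor2 : continuous tor2 :=
    continuous_pair (continuous_pair (@c2 _ _ _) (@c11 _ _ _)) (@c12 _ _ _).
  have g1 : {within C `*` circle, continuous (fun p => f p.1.1 p.2 p.1.2)}.
    apply: (within_continuous_comp ctor1 _ f_cont).
    by move=> [[z x] w] [[/= cz _] cw].
  have g2 : {within C `*` circle, continuous (fun p => f p.2 p.1.1 p.1.2)}.
    apply: (within_continuous_comp ctor2 _ f_cont).
    by move=> [[w x] z] [[/= cw _] cz].
  have cE1 : {within C `*` closed_disk, continuous E1}.
    apply: (@canonical_value_continuous R n _ C (fun y w => f y.1 w y.2)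
      (fun y => (H1 y).1) (fun y => (H1 y).2) g1).
    by move=> [z x] [cz _]; exact: wiener_hopf_pair (w1 x z cz).
  have cE2 : {within C `*` closed_disk, continuous E2}.
    apply: (@canonical_value_continuous R n _ C (fun y z => f z y.1 y.2)
      (fun y => (H2 y).1) (fun y => (H2 y).2) g2).
    by move=> [w x] [cw _]; exact: wiener_hopf_pair (w2 x w cw).
  have clX (A B : set R[i]) : closed A -> closed B -> closed ((A `*` B) `*` [set: X]).
    move=> cA cB.
    have -> : (A `*` B) `*` [set: X] = (fun p => p.1.1) @^-1` A `&` (fun p => p.1.2) @^-1` B.
      by apply/seteqP; split => [[[z w] x] [[]]|[[z w] x] []].
    by apply: closedI; apply: closed_comp => // p _;
      [exact: (@c11 R[i] R[i] X) | exact: (@c12 R[i] R[i] X)].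
  have -> : sphere3 `*` [set: X] = ((circle `*` closed_disk) `*` [set: X] `|`
      (closed_disk `*` circle) `*` [set: X])%classic :> set (R[i] * R[i] * X).
    apply/seteqP; split => p; first by case=> -[h|h] _; [left | right].
    by case=> -[h _]; split=> //; [left | right].
  have cD : closed (@closed_disk R) by rewrite closed_diskS; exact: closed_mo_le.
  (* Pasting: both halves are closed and [fE] is continuous on each. *)
  apply: withinU_continuous.
  + exact: clX (@closed_circle R) cD.
  + exact: clX cD (@closed_circle R).
  + apply: (@subspace_eq_continuous _ _ _ (fun p => E1 (rot1 p))).
      by move=> [[z w] x]; rewrite inE => -[[cz _] _]; rewrite /from_subspace /= fE1.
    apply: (within_continuous_comp crot1 _ cE1).
    by move=> [[z w] x] [[/= cz Dw] _].
  + apply: (@subspace_eq_continuous _ _ _ (fun p => E2 (rot2 p))).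
      by move=> [[z w] x]; rewrite inE => -[[_ cw] _]; rewrite /from_subspace /= fE2.
    apply: (within_continuous_comp crot2 _ cE2).
    by move=> [[z w] x] [[/= Dz cw] _].
- move=> z w x [[/= cz Dw]|[/= Dz cw]].
    have [_ _ uM uP _] := wiener_hopf_pair (w1 x z cz).
    by rewrite fE1 // /E1 unitmx_mul uM ?uP //; exact: closed_disk_conj.
  have [_ _ uM uP _] := wiener_hopf_pair (w2 x w cw).
  by rewrite fE2 // /E2 unitmx_mul uM ?uP //; exact: closed_disk_conj.
- by move=> z w x cz cw; rewrite fE1 // E1f.
Qed.
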